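(* Let $d=1$, $1\leq p,\theta\leq\infty$, $r>\max\{1/p,1/2\}$. Then, for $m\in\mathbb{N}$, $$ e_m(B^{r}_{p,\theta})_{B_{\infty,1}}\asymp m^{-r+\left(\frac{1}{p}-\frac{1}{2}\right)_+}, $$ where $a_+=\max\{a,0\}$.
   Context: $\mathbb{T}=[0,2\pi)$; $L_p(\mathbb{T})$ is the space of $2\pi$-periodic functions with norm $\|f\|_p=\big((2\pi)^{-1}\int_{\mathbb{T}}|f|^p\big)^{1/p}$ ($1\le p<\infty$), $\|f\|_\infty=\operatorname{ess\,sup}|f|$. For $h\in\mathbb{R}$, $\Delta_{h}f(x)=f(x+h)-f(x)$, $\Delta^k_{h}=\Delta_{h}\Delta^{k-1}_{h}$, and $\omega_k(f,t)_p=\sup_{|h|\le t}\|\Delta^k_{h}f\|_p$. For $r>0$, $1\le p,\theta\le\infty$ and a fixed integer $k>r$, the Nikol'skii–Besov space $B^r_{p,\theta}$ consists of $f\in L_p(\mathbb{T})$ with finite norm $\|f\|_{B^r_{p,\theta}}=\|f\|_p+\big(\int_0^\infty (t^{-r}\omega_k(f,t)_p)^\theta\,\frac{dt}{t}\big)^{1/\theta}$ for $\theta<\infty$, and $\|f\|_p+\sup_{t>0}t^{-r}\omega_k(f,t)_p$ for $\theta=\infty$; the class $B^r_{p,\theta}$ denotes its unit ball. Let $V_l(t)=l^{-1}\sum_{k=l}^{2l-1}D_k(t)$ with $D_k(t)=\sum_{|j|\le k}e^{ijt}$ be the de la Vallée-Poussin kernel and $V_l(f)=f*V_l$. Set $\sigma_0(f)=V_1(f)$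 and $\sigma_s(f)=V_{2^s}(f)-V_{2^{s-1}}(f)$ for $s\in\mathbb{N}$. $B_{\infty,1}$ is the space of $f\in L_\infty(\mathbb{T})$ with $\|f\|_{B_{\infty,1}}:=\sum_{s\ge0}\|\sigma_s(f)\|_\infty<\infty$. For $f\in B_{\infty,1}$, $e_m(f)_{B_{\infty,1}}=\inf_{\Theta_m}\inf_{c_k}\|f-\sum_{k\in\Theta_m}c_ke^{ikx}\|_{B_{\infty,1}}$, where $\Theta_m$ ranges over sets of $m$ integers and $c_k\in\mathbb{C}$; for a class $F$, $e_m(F)_{B_{\infty,1}}=\sup_{f\in F}e_m(f)_{B_{\infty,1}}$. The notation $a(m)\asymp b(m)$ means there are constants $0<C_1<C_2$ independent of $m$ with $C_1a(m)\le b(m)\le C_2a(m)$ for all $m\in\mathbb{N}$. *)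

(* Defs.v *)
From HB Require Import structures.
From mathcomp Require Import all_boot all_order all_algebra.
From mathcomp Require Import all_classical all_reals all_analysis.
From mathcomp Require Import complex.

Set Implicit Arguments.
Unset Strict Implicit.
Unset Printing Implicit Defensive.
Import Order.TTheory GRing.Theory Num.Theory.
Import numFieldNormedType.Exports.
Local Open Scope classical_set_scope.
Local Open Scope ring_scope.

Section Defs.
Variable R : realType.

Lemma torus_itv_measurable : measurable (`[0%R, 2 * pi[ : set R).
Proof. exact: measurable_itv. Qed.

Lemma inv2pi_ge0 : (0 : R) <= (2 * pi)^-1.
Proof. by rewrite invr_ge0 mulr_ge0 // ltW // pi_gt0. Qed.

Definition inv2pi_nng : {nonneg R} := NngNum inv2pi_ge0.

Definition torus_measure :=
  mscale inv2pi_nng (mrestr (@lebesgue_measure R) torus_itv_measurable).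


Definition cabs (z : R[i]) : \bar R := (ComplexField.Normc.normc z)%:E.

Definition Tnorm (p : \bar R) (g : R -> R[i]) : \bar R :=
  Lnorm torus_measure p (fun x => cabs (g x)).

Definition einv (p : \bar R) : R :=
  match p with r%:E => r^-1 | _ => 0 end.

Definition periodic2pi (f : R -> R[i]) := forall x, f (x + 2 * pi) = f x.

Definition cmeasurable (f : R -> R[i]) :=
  measurable_fun setT (fun x => complex.Re (f x)) /\
  measurable_fun setT (fun x => complex.Im (f x)).

Definition in_Lp (p : \bar R) (f : R -> R[i]) :=
  periodic2pi f /\ cmeasurable f /\ (Tnorm p f < +oo)%E.

Definition Delta (h : R) (f : R -> R[i]) : R -> R[i] := fun x => f (x + h) - f x.
Definition Deltak (k : nat) (h : R) (f : R -> R[i]) := iter k (Delta h) f.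

Definition omega (k : nat) (p : \bar R) (f : R -> R[i]) (t : R) : \bar R :=
  ereal_sup [set Tnorm p (Deltak k h f) | h in [set h : R | `|h| <= t]].

(* Nikol'skii-Besov norm (with fixed k > r) *)
Definition besov_norm (k : nat) (r : R) (p theta : \bar R) (f : R -> R[i])
    : \bar R :=
  (Tnorm p f +
   match theta with
   | th%:E =>
       (\int[@lebesgue_measure R]_(t in `]0%R, +oo[)
          ((((t `^ (- r))%:E * omega k p f t) `^ th) * (t^-1)%:E)) `^ th^-1
   | +oo => ereal_sup [set ((t `^ (- r))%:E * omega k p f t) | t in `]0%R, +oo[]
   | -oo => 0
   end)%E.

Definition besov_class (k : nat) (r : R) (p theta : \bar R) : set (R -> R[i]) :=
  [set f | in_Lp p f /\ (besov_norm k r p theta f <= 1)%E].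

Definition expi (n : int) (x : R) : R[i] :=
  Complex (cos (n%:~R * x)) (sin (n%:~R * x)).

Definition dirichlet (k : nat) (t : R) : R[i] :=
  \sum_(j < (2 * k).+1) expi (j%:Z - k%:Z) t.

Definition vallee_poussin (l : nat) (t : R) : R[i] :=
  (l%:R)^-1 * \sum_(l <= k < 2 * l) dirichlet k t.

Definition conv (f g : R -> R[i]) (x : R) : R[i] :=
  Complex (Rintegral torus_measure setT (fun t => complex.Re (f (x - t) * g t)))
          (Rintegral torus_measure setT (fun t => complex.Im (f (x - t) * g t))).

Definition VP (l : nat) (f : R -> R[i]) := conv f (vallee_poussin l).

Definition sigma_blk (s : nat) (f : R -> R[i]) : R -> R[i] :=
  match s with
  | 0 => VP 1 f
  | s'.+1 => fun x => VP (2 ^ s) f x - VP (2 ^ s') f x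
  end.

Definition Binf1_norm (f : R -> R[i]) : \bar R :=
  (\sum_(s <oo) Tnorm +oo%E (sigma_blk s f))%E.

Definition em_fun (m : nat) (f : R -> R[i]) : \bar R :=
  ereal_inf [set y | exists (Theta : seq int) (c : int -> R[i]),
     [/\ uniq Theta, size Theta = m &
         y = Binf1_norm (fun x => f x - \sum_(k <- Theta) c k * expi k x)]].

Definition em_class (m : nat) (F : set (R -> R[i])) : \bar R :=
  ereal_sup [set em_fun m f | f in F].

End Defs.

(* Main.v *)
(** Upper bound.  Put [r' = r - (1/p - 1/2)_+ > 1/2].  Testing a difference
    [Delta_h^k f], [h ~ 2^-s], against its own Fourier sum shows that the
    coefficients of [f] on the frequencies [~ 2^s] have l2 norm [O(2^(-s r'))].
    A trigonometric polynomial of degree [2^u] with l2 norm [rho] is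
    approximated uniformly, with error [O((1 + v) 2^(v/2) rho)], by
    [O(2^(u-v))] exponentials: a derandomised choice of exponentials minimises
    an exponential potential over an equidistant grid, so that the error is
    large only on few grid points; the part interpolating these large values
    has much smaller l2 norm and is treated again.  Letting [v] grow slightly
    faster than linearly in the block index and summing over the dyadic blocks
    gives the upper bound.

    Lower bound.  A polynomial with coefficients of modulus at least 1 on
    [2^s >= 2 m] frequencies of one dyadic block keeps, after removal of [m]
    exponentials, half of its coefficients, and Parseval bounds the sup norm
    of the block from below.  The polynomials are Rudin-Shapiro polynomials
    for [p >= 2] and modulated de la Vallee-Poussin kernels for [p < 2]. *)
Require Import Defs.
From mathcomp Require Import all_boot all_order all_algebra.
From mathcomp Require Import all_classical all_reals all_analysis.
From mathcomp Require Import complex measurable_realfun ess_sup_inf.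
From mathcomp Require Import ring lra zify.
Import Order.TTheory GRing.Theory Num.Theory.
Import numFieldNormedType.Exports.
Import ComplexField.Normc.
Set Implicit Arguments.
Unset Strict Implicit.
Unset Printing Implicit Defensive.
Local Open Scope complex_scope.
Local Open Scope classical_set_scope.
Local Open Scope ring_scope.

Local Notation Re := complex.Re.
Local Notation Im := complex.Im.
Local Arguments expi : simpl never.

(** * Complex exponentials and equidistant grids *)

Section complex_modulus.
Variable R : realType.
Implicit Types z : R[i].

Lemma normc_ge0 z : 0 <= normc z.
Proof. by case: z => a b; rewrite /= sqrtr_ge0. Qed.

Lemma sqr_normcE z : normc z ^+ 2 = Re z ^+ 2 + Im z ^+ 2.
Proof. by case: z => a b /=; rewrite sqr_sqrtr // addr_ge0 // sqr_ge0. Qed.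

Lemma sqr_normc_conj z : (normc z ^+ 2)%:C = z * z^*%C.
Proof. by rewrite -sqr_normc rmorphXn. Qed.

Lemma sqr_normcB (z w : R[i]) :
  normc (z - w) ^+ 2 = normc z ^+ 2 + normc w ^+ 2 - 2 * Re (z * w^*%C).
Proof. by rewrite !sqr_normcE; case: z => a b; case: w => c d /=; ring. Qed.

Lemma normc_sum (I : Type) (s : seq I) (P : pred I) (F : I -> R[i]) :
  normc (\sum_(i <- s | P i) F i) <= \sum_(i <- s | P i) normc (F i).
Proof.
elim/big_ind2: _ => [|x a y b xa yb|//]; first by rewrite normc0.
exact: le_trans (le_normcD _ _) (lerD xa yb).
Qed.

Lemma normcX z n : normc (z ^+ n) = normc z ^+ n.
Proof. by elim: n => [|n ih]; rewrite ?normc1 // !exprS normcM ih. Qed.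

Lemma normc_real (x : R) : normc x%:C = `|x|.
Proof. by rewrite /= expr0n addr0 sqrtr_sqr. Qed.

Lemma normc_conj z : normc z^*%C = normc z.
Proof. by case: z => a b /=; rewrite sqrrN. Qed.

Lemma normc_nat (n : nat) : normc (n%:R : R[i]) = n%:R.
Proof. by rewrite (normcMn 1) normc1. Qed.

Lemma le_normcB (z w : R[i]) : normc (z - w) <= normc z + normc w.
Proof. by rewrite -(normcN w); exact: le_normcD. Qed.

Lemma normr_Re_le z : `|Re z| <= normc z.
Proof. by have := normc_ge_Re z; rewrite lecR. Qed.

Lemma normr_Im_le z : `|Im z| <= normc z.
Proof.
rewrite -(ler_pXn2r (n := 2)) ?nnegrE ?normc_ge0 // sqr_normcE.
by rewrite real_normK ?num_real // lerDr sqr_ge0.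
Qed.

Lemma normc_le_ReDIm z : normc z <= `|Re z| + `|Im z|.
Proof.
rewrite -(ler_pXn2r (n := 2)) ?nnegrE ?normc_ge0 ?addr_ge0 // sqr_normcE.
rewrite sqrrD !real_normK ?num_real // -addrA [_ *+ 2 + _]addrC addrA lerDl.
by rewrite mulrn_wge0 // mulr_ge0.
Qed.

Lemma natc_neq0 (n : nat) : (0 < n)%N -> (n%:R : R[i]) != 0.
Proof. by rewrite pnatr_eq0 lt0n. Qed.

End complex_modulus.

Section complex_exponentials.
Variable R : realType.
Implicit Types (m n : int) (x y h eta : R).

Lemma expiD m n x : expi (m + n) x = expi m x * expi n x.
Proof.
rewrite /expi intrD mulrDl cosD sinD; apply/eqP; rewrite eq_complex /=.
by apply/andP; split; apply/eqP; ring.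
Qed.

Lemma expi_argD n x y : expi n (x + y) = expi n x * expi n y.
Proof.
rewrite /expi mulrDr cosD sinD; apply/eqP; rewrite eq_complex /=.
by apply/andP; split; apply/eqP; ring.
Qed.

Lemma expi0 x : expi 0 x = 1.
Proof. by rewrite /expi mul0r cos0 sin0. Qed.

Lemma expi_arg0 n : expi n (0 : R) = 1.
Proof. by rewrite /expi mulr0 cos0 sin0. Qed.

Lemma expi_conj n x : (expi n x)^*%C = expi (- n) x.
Proof. by rewrite /expi /= rmorphN mulNr cosN sinN. Qed.

Lemma expi_argN n x : expi n (- x) = expi (- n) x.
Proof. by rewrite /expi rmorphN mulNr mulrN. Qed.

Lemma normc_expi n x : normc (expi n x) = 1.
Proof. by rewrite /= cos2Dsin2 sqrtr1. Qed.

Lemma expi_mulN n x : expi n x * expi (- n) x = 1.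
Proof. by rewrite -expiD subrr expi0. Qed.

Lemma expi_argMn n x (j : nat) : expi n (x *+ j) = expi n x ^+ j.
Proof.
by elim: j => [|j ih]; rewrite ?mulr0n ?expi_arg0 // mulrS expi_argD ih exprS.
Qed.

Lemma expi_2pi n : expi n (2 * pi : R) = 1.
Proof.
have nat_case (k : nat) : expi k (2 * pi : R) = 1.
  rewrite /expi -[k%:~R]/(k%:R) mulr_natl [2 * pi]mulr_natl -[_ *+ k]add0r.
  by rewrite (periodicn (@cosD2pi _)) (periodicn (@sinD2pi _)) cos0 sin0.
case: n => k; first exact: nat_case.
by rewrite NegzE -expi_conj nat_case conjc1.
Qed.

Lemma expi_periodic n : periodic2pi (@expi R n).
Proof. by move=> x; rewrite expi_argD expi_2pi mulr1. Qed.

Lemma cos_lt1 x : 0 < x < 2 * pi -> cos x < 1.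
Proof.
move=> /andP[x0 x2]; have -> : x = (x / 2) *+ 2 by rewrite -mulr_natr mulfVK.
rewrite cos_mulr2n cos2sin2.
suff : 0 < sin (x / 2) by move=> /(exprn_gt0 2); lra.
by apply: sin_gt0_pi; apply/andP; split; lra.
Qed.

Lemma sqr_normc_expiB1 n h : normc (expi n h - 1) ^+ 2 = 2 - 2 * cos (n%:~R * h).
Proof.
rewrite sqr_normcE; have := cos2Dsin2 (n%:~R * h); rewrite /expi /= oppr0 addr0.
move: (cos _) (sin _) => a b ab1.
have -> : (a - 1) ^+ 2 + b ^+ 2 = (a ^+ 2 + b ^+ 2) - 2 * a + 1 by ring.
by rewrite ab1; ring.
Qed.

Lemma normr_sin_le x : `|sin x| <= `|x|.
Proof.
wlog x0 : x / 0 <= x.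
  move=> nonneg_case; have [/nonneg_case//|/ltW x0] := leP 0 x.
  by rewrite -normrN -sinN -[leRHS]normrN nonneg_case ?oppr_ge0.
have cont_sin : {within `[0, x], continuous (@sin R)}.
  by apply: continuous_subspaceT; exact: continuous_sin.
have [c _] := MVT_segment x0 (fun y _ => is_derive_sin y) cont_sin.
rewrite sin0 !subr0 => ->; rewrite normrM ler_piMl // ler_norml.
by rewrite cos_geN1 cos_le1.
Qed.

Lemma normc_expiB1_le n h : normc (expi n h - 1) <= `|n%:~R * h|.
Proof.
rewrite -ler_sqr ?nnegrE ?normc_ge0 // sqr_normc_expiB1 real_normK ?num_real //.
move: (n%:~R * h) => y; pose z := y / 2.
have -> : y = z *+ 2 by rewrite /z mulr2n; lra.
have : sin z ^+ 2 <= z ^+ 2.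
  rewrite -real_normK ?num_real // -[leRHS]real_normK ?num_real //.
  by rewrite ler_sqr ?nnegrE // normr_sin_le.
by rewrite cos_mulr2n cos2sin2 !mulr2n; nra.
Qed.

Lemma normc_expiB1_le2 n h : normc (expi n h - 1) <= 2.
Proof. by apply: le_trans (le_normcB _ _) _; rewrite normc_expi (normc_nat _ 1); lra. Qed.

Definition symbol_bounded (D : nat) h eta :=
  forall n, (`|n| <= D)%N -> normc (expi n h - 1) <= eta.

Lemma expiB1_lower_bound n h : 4^-1 <= `|n|%:R * h <= 1 ->
  2 - 2 * cos (4^-1 : R) <= normc (expi n h - 1) ^+ 2.
Proof.
move=> /andP[nh_ge nh_le]; rewrite sqr_normc_expiB1.
have -> : cos (n%:~R * h) = cos (`|n|%:R * h).
  rewrite natr_absz intr_norm; have [n0|n0] := leP 0 (n%:~R : R).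
    by rewrite ger0_norm.
  by rewrite ltr0_norm // mulNr cosN.
suff : cos (`|n|%:R * h) <= cos (4^-1 : R) by lra.
have pi2 := pi_ge2 R.
by rewrite leNgt ltr_cos ?in_itv /= -?leNgt //; apply/andP; split; lra.
Qed.

End complex_exponentials.

Section equidistant_grid.
Variable R : realType.

Definition grid (M j : nat) : R := (2 * pi / M%:R) *+ j.

Definition grid_mean (M : nat) (g : R -> R) (x : R) : R :=
  M%:R^-1 * \sum_(j < M) g (x - grid M j).

Lemma le_grid_mean (M : nat) (f g : R -> R) (x : R) :
  (forall y, f y <= g y) -> grid_mean M f x <= grid_mean M g x.
Proof. by move=> fg; rewrite ler_wpM2l ?invr_ge0 // ler_sum. Qed.

Lemma grid_meanD (M : nat) (f g : R -> R) (x : R) :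
  grid_mean M (fun y => f y + g y) x = grid_mean M f x + grid_mean M g x.
Proof. by rewrite /grid_mean big_split mulrDr. Qed.

Lemma grid_meanZ (M : nat) (a : R) (f : R -> R) (x : R) :
  grid_mean M (fun y => a * f y) x = a * grid_mean M f x.
Proof. by rewrite /grid_mean -mulr_sumr mulrCA. Qed.

Lemma expi_grid1_neq1 (M : nat) (n : int) : (`|n| < M)%N -> n != 0 ->
  expi n (2 * pi / M%:R : R) != 1.
Proof.
move=> nM n0; apply/eqP => /(congr1 (@complex.Re R)) /= cos1.
have M0 : (0 : R) < M%:R by rewrite ltr0n (leq_ltn_trans _ nM).
have pi20 : (0 : R) < 2 * pi by rewrite mulr_gt0 ?pi_gt0.
have : cos (`|n|%:R * (2 * pi / M%:R) : R) < 1.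
  apply: cos_lt1; rewrite mulrA; apply/andP; split.
    by rewrite divr_gt0 // mulr_gt0 // ltr0n absz_gt0.
  by rewrite ltr_pdivrMr // [ltRHS]mulrC ltr_pM2r // ltr_nat.
rewrite natr_absz intr_norm; move: cos1; rewrite -cos_norm normrM.
rewrite [`|2 * pi / _|]ger0_norm ?divr_ge0 ?mulr_ge0 ?pi_ge0 //.
by move=> ->; rewrite ltxx.
Qed.

Lemma sum_expi_grid (M : nat) (n : int) : (`|n| < M)%N ->
  \sum_(j < M) expi n (grid M j) = (if n == 0 then M%:R else 0) :> R[i].
Proof.
move=> nM; have [->|n0] := eqVneq n 0.
  by under eq_bigr do rewrite expi0; rewrite sumr_const card_ord.
under eq_bigr do rewrite expi_argMn.
have root1 : expi n (2 * pi / M%:R : R) - 1 != 0 by rewrite subr_eq0 expi_grid1_neq1.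
apply: (mulfI root1); rewrite mulr0 -subrX1 -expi_argMn.
suff -> : (2 * pi / M%:R) *+ M = 2 * pi :> R by rewrite expi_2pi subrr.
by rewrite -mulr_natr mulfVK // pnatr_eq0 -lt0n (leq_ltn_trans _ nM).
Qed.

Lemma sum_expi_gridB (M : nat) (n : int) (x : R) : (`|n| < M)%N ->
  \sum_(j < M) expi n (x - grid M j) = (if n == 0 then M%:R else 0).
Proof.
move=> nM; under eq_bigr do rewrite expi_argD expi_argN.
rewrite -mulr_sumr sum_expi_grid ?abszN // oppr_eq0.
by case: eqP => [->|_]; rewrite ?mulr0 // expi0 mul1r.
Qed.

End equidistant_grid.

Arguments grid {R} M j.

(** * Trigonometric polynomials *)

Section finite_sums.

Lemma sum_uniq_subset (I : eqType) (V : nmodType) (s t : seq I) (F : I -> V) :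
  uniq s -> uniq t -> {subset s <= t} ->
  (forall i, i \in t -> i \notin s -> F i = 0) ->
  \sum_(i <- t) F i = \sum_(i <- s) F i.
Proof.
move=> us ut st F0; rewrite (bigID (mem s)) /= [X in _ + X]big1_seq ?addr0.
  rewrite -big_filter; apply: perm_big; apply: uniq_perm => //.
    exact: filter_uniq.
  by move=> i; rewrite mem_filter; case: (boolP (i \in s)) => // /st ->.
by move=> i /andP[i_s i_t]; exact: F0.
Qed.

Lemma ler_sum_uniq_subset (R : numDomainType) (I : eqType) (s t : seq I) (F : I -> R) :
  uniq s -> uniq t -> {subset s <= t} -> (forall i, 0 <= F i) ->
  \sum_(i <- s) F i <= \sum_(i <- t) F i.
Proof.
move=> us ut st F0; pose G i := if i \in s then F i else 0.
apply: (@le_trans _ _ (\sum_(i <- t) G i)); last first.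
  by apply: ler_sum => i _; rewrite /G; case: ifP.
rewrite (sum_uniq_subset us ut st) => [|i _ /negbTE]; last by rewrite /G => ->.
by rewrite big_seq [leRHS]big_seq; apply: ler_sum => i is_; rewrite /G is_.
Qed.

Lemma sqr_sum_mul_le (R : realFieldType) (I : Type) (s : seq I) (a b : I -> R) :
  (\sum_(i <- s) a i * b i) ^+ 2 <= (\sum_(i <- s) a i ^+ 2) * \sum_(i <- s) b i ^+ 2.
Proof.
set A := \sum_(i <- s) a i ^+ 2; set B := \sum_(i <- s) a i * b i.
set C := \sum_(i <- s) b i ^+ 2.
have C0 : 0 <= C by apply: sumr_ge0 => i _; exact: sqr_ge0.
have A0 : 0 <= A by apply: sumr_ge0 => i _; exact: sqr_ge0.
have quad_ge0 x y : 0 <= x ^+ 2 * A - 2 * (x * y) * B + y ^+ 2 * C.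
  rewrite /A /B /C !mulr_sumr -sumrB -big_split sumr_ge0 //= => i _.
  by rewrite (_ : _ + _ = (x * a i - y * b i) ^+ 2) ?sqr_ge0 //; ring.
have [C00|Cn0] := eqVneq C 0; first by have := quad_ge0 B (A + 1); rewrite C00; nra.
have Cp : 0 < C by rewrite lt_neqAle eq_sym Cn0.
by rewrite -subr_ge0 -(pmulr_rge0 _ Cp); have := quad_ge0 C B; nra.
Qed.

Lemma sqr_sum_le (R : realFieldType) (I : Type) (s : seq I) (a : I -> R) :
  (\sum_(i <- s) a i) ^+ 2 <= (size s)%:R * \sum_(i <- s) a i ^+ 2.
Proof.
have := sqr_sum_mul_le s (fun=> 1) a; under eq_bigr do rewrite mul1r.
under [X in _ <= X * _ -> _]eq_bigr do rewrite expr1n.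
by rewrite big_const_seq count_predT iter_addr_0.
Qed.

Lemma sum_mul_le_sqrt (R : rcfType) (I : Type) (s : seq I) (a b : I -> R) :
  \sum_(i <- s) a i * b i <=
  Num.sqrt (\sum_(i <- s) a i ^+ 2) * Num.sqrt (\sum_(i <- s) b i ^+ 2).
Proof.
have sqr_sum_ge0 (c : I -> R) : 0 <= \sum_(i <- s) c i ^+ 2.
  by apply: sumr_ge0 => i _; exact: sqr_ge0.
apply: le_trans (ler_norm _) _; rewrite -sqrtr_sqr -sqrtrM ?sqr_sum_ge0 //.
by rewrite ler_wsqrtr // sqr_sum_mul_le.
Qed.

End finite_sums.

Section frequencies.
Implicit Types (D : nat) (n : int).

Definition freqs D : seq int := [seq j%:Z - D%:Z | j <- iota 0 (2 * D).+1].

Lemma mem_freqs D n : (n \in freqs D) = (`|n| <= D)%N.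
Proof.
apply/mapP/idP => [[j]|nD]; first by rewrite mem_iota => jD ->; lia.
by exists (absz (n + D%:Z)); [rewrite mem_iota|]; lia.
Qed.

Lemma freqs_uniq D : uniq (freqs D).
Proof. by rewrite map_inj_uniq ?iota_uniq // => i j; lia. Qed.

Lemma size_freqs D : size (freqs D) = (2 * D).+1.
Proof. by rewrite size_map size_iota. Qed.

Lemma eq_sum_freqs (V : nmodType) D (F G : int -> V) :
  (forall n, (`|n| <= D)%N -> F n = G n) ->
  \sum_(n <- freqs D) F n = \sum_(n <- freqs D) G n.
Proof. by move=> FG; apply: eq_big_seq => n; rewrite mem_freqs => /FG. Qed.

Lemma ler_sum_freqs (R : numDomainType) D (F G : int -> R) :
  (forall n, (`|n| <= D)%N -> F n <= G n) ->
  \sum_(n <- freqs D) F n <= \sum_(n <- freqs D) G n.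
Proof.
by move=> FG; rewrite big_seq [leRHS]big_seq ler_sum // => n; rewrite mem_freqs => /FG.
Qed.

Lemma sum_freqs_widen (V : nmodType) D D' (F : int -> V) : (D <= D')%N ->
  (forall n, (D < `|n|)%N -> F n = 0) ->
  \sum_(n <- freqs D') F n = \sum_(n <- freqs D) F n.
Proof.
move=> DD' F0; apply: sum_uniq_subset; rewrite ?freqs_uniq //.
  by move=> n; rewrite !mem_freqs => /leq_trans; apply.
by move=> n _; rewrite mem_freqs -ltnNge; exact: F0.
Qed.

Lemma sum_freqs_single (V : nmodType) D (F : int -> V) n :
  (forall k, (D < `|k|)%N -> F k = 0) -> (forall k, k != n -> F k = 0) ->
  \sum_(k <- freqs D) F k = F n.
Proof.
move=> F0 Fn; have [nD|nD] := boolP (n \in freqs D).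
  by rewrite (bigD1_seq n) ?freqs_uniq //= big1 ?addr0.
rewrite big1_seq => [|k /andP[_ kD]].
  by rewrite F0 // ltnNge -mem_freqs.
by rewrite Fn //; apply: contraNneq nD => <-.
Qed.

Lemma sum_freqsN (V : nmodType) D (F : int -> V) :
  \sum_(n <- freqs D) F (- n) = \sum_(n <- freqs D) F n.
Proof.
rewrite -(big_map -%R predT F); apply: perm_big; apply: uniq_perm.
- by rewrite map_inj_uniq ?freqs_uniq //; exact: oppr_inj.
- exact: freqs_uniq.
move=> n; rewrite mem_freqs; apply/mapP/idP => [[k]|nD].
  by rewrite mem_freqs => kD ->; rewrite abszN.
by exists (- n); rewrite ?opprK // mem_freqs abszN.
Qed.

Lemma sum_freqs_nat (V : nmodType) (N : nat) (F : int -> V) :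
  (forall n, ~~ (0 <= n < N%:Z) -> F n = 0) ->
  \sum_(n <- freqs N) F n = \sum_(j < N) F j.
Proof.
move=> F0; rewrite -(big_mkord predT (fun j => F j%:Z)) -[RHS](big_map Posz predT F).
apply: sum_uniq_subset; rewrite ?freqs_uniq //.
- by rewrite map_inj_uniq ?iota_uniq // => i j; lia.
- by move=> n /mapP[j]; rewrite mem_index_iota mem_freqs => jN ->; lia.
move=> n _ nN; apply: F0; apply: contra nN => nN.
by apply/mapP; exists `|n|%N; rewrite ?mem_index_iota; lia.
Qed.

End frequencies.

Section trigonometric_polynomials.
Variable R : realType.
Local Notation C := R[i].
Implicit Types (D : nat) (c d : int -> C) (x h : R).

Definition trigpoly D c x : C := \sum_(n <- freqs D) c n * expi n x.

Definition bandlimited D c := forall n, (D < `|n|)%N -> c n = 0.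

Definition l1norm D c : R := \sum_(n <- freqs D) normc (c n).

Definition energy D c : R := \sum_(n <- freqs D) normc (c n) ^+ 2.

Definition fmult (m : int -> R) c (n : int) : C := (m n)%:C * c n.

Lemma eq_trigpoly D c d x : (forall n, (`|n| <= D)%N -> c n = d n) ->
  trigpoly D c x = trigpoly D d x.
Proof. by move=> cd; apply: eq_sum_freqs => n /cd ->. Qed.

Lemma trigpoly_band D D' c x : bandlimited D c -> bandlimited D' c ->
  trigpoly D c x = trigpoly D' c x.
Proof.
move=> cD cD'; transitivity (trigpoly (maxn D D') c x).
  by rewrite /trigpoly (sum_freqs_widen (leq_maxl D D')) // => n /cD ->; rewrite mul0r.
by rewrite /trigpoly (sum_freqs_widen (leq_maxr D D')) // => n /cD' ->; rewrite mul0r.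
Qed.

Lemma bandlimitedW D D' c : (D <= D')%N -> bandlimited D c -> bandlimited D' c.
Proof. by move=> DD' cD n nD'; apply: cD; exact: leq_ltn_trans DD' nD'. Qed.

Lemma trigpoly_widen D D' c x : (D <= D')%N -> bandlimited D c ->
  trigpoly D' c x = trigpoly D c x.
Proof. by move=> DD' cD; apply: trigpoly_band => //; exact: bandlimitedW cD. Qed.

Lemma trigpoly_fmultB D (m1 m2 : int -> R) c x :
  trigpoly D (fmult (fun n => m1 n - m2 n) c) x =
  trigpoly D (fmult m1 c) x - trigpoly D (fmult m2 c) x.
Proof. by rewrite -sumrB; apply: eq_bigr => n _; rewrite /fmult rmorphB !mulrBl. Qed.

Lemma trigpolyD D c d x :
  trigpoly D (fun n => c n + d n) x = trigpoly D c x + trigpoly D d x.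
Proof. by rewrite -big_split; apply: eq_bigr => n _; rewrite mulrDl. Qed.

Lemma trigpolyB D c d x :
  trigpoly D (fun n => c n - d n) x = trigpoly D c x - trigpoly D d x.
Proof. by rewrite -sumrB; apply: eq_bigr => n _; rewrite mulrBl. Qed.

Lemma trigpolyZ D (a : C) c x : trigpoly D (fun n => a * c n) x = a * trigpoly D c x.
Proof. by rewrite /trigpoly mulr_sumr; apply: eq_bigr => n _; rewrite mulrA. Qed.

Lemma trigpoly0 D x : trigpoly D (fun=> 0) x = 0.
Proof. by rewrite /trigpoly big1 // => n _; rewrite mul0r. Qed.

Lemma trigpoly_periodic D c : periodic2pi (trigpoly D c).
Proof. by move=> x; apply: eq_bigr => n _; rewrite expi_periodic. Qed.

Lemma trigpoly_argD D c x h :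
  trigpoly D c (x + h) = trigpoly D (fun n => c n * expi n h) x.
Proof. by apply: eq_bigr => n _; rewrite expi_argD mulrAC mulrA. Qed.

Lemma trigpoly_argN D c x : trigpoly D c (- x) = trigpoly D (fun n => c (- n)) x.
Proof.
rewrite /trigpoly -(sum_freqsN D (fun n => c n * _)).
by apply: eq_bigr => n _; rewrite expi_argN opprK.
Qed.

Lemma trigpoly_modulate D (a : int) c x : bandlimited D c ->
  trigpoly (D + `|a|) (fun n => c (n - a)) x = expi a x * trigpoly D c x.
Proof.
move=> cD; rewrite /trigpoly (@sum_uniq_subset _ _ [seq n + a | n <- freqs D]) ?freqs_uniq //.
- by rewrite big_map mulr_sumr; apply: eq_bigr => n _; rewrite addrK expiD; ring.
- by rewrite map_inj_uniq ?freqs_uniq //; exact: addIr.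
- by move=> n /mapP[j]; rewrite !mem_freqs => jD ->; lia.
move=> n _ nD; rewrite cD ?mul0r // ltnNge; apply: contra nD => nD.
by apply/mapP; exists (n - a); rewrite ?mem_freqs // subrK.
Qed.

Lemma conj_trigpoly D c x :
  (trigpoly D c x)^*%C = \sum_(n <- freqs D) (c n)^*%C * expi (- n) x.
Proof.
rewrite /trigpoly (rmorph_sum (@conjc R)); apply: eq_bigr => n _.
by rewrite rmorphM /= -expi_conj.
Qed.

Lemma normc_trigpoly_le D c x : normc (trigpoly D c x) <= l1norm D c.
Proof.
apply: le_trans (normc_sum _ _ _) _; apply: ler_sum => n _.
by rewrite normcM normc_expi mulr1.
Qed.

Lemma l1norm_ge0 D c : 0 <= l1norm D c.
Proof. by apply: sumr_ge0 => n _; exact: normc_ge0. Qed.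

Lemma energy_ge0 D c : 0 <= energy D c.
Proof. by apply: sumr_ge0 => n _; exact: sqr_ge0. Qed.

Lemma le_energy D c d : (forall n, (`|n| <= D)%N -> normc (c n) <= normc (d n)) ->
  energy D c <= energy D d.
Proof.
by move=> cd; apply: ler_sum_freqs => n nD; rewrite lerXn2r ?nnegrE ?normc_ge0 ?cd.
Qed.

Lemma energyZ D (a : R) c : energy D (fun n => a%:C * c n) = a ^+ 2 * energy D c.
Proof.
rewrite /energy mulr_sumr; apply: eq_bigr => n _.
by rewrite normcM normc_real exprMn real_normK ?num_real.
Qed.

Lemma sqr_l1norm_le D c : l1norm D c ^+ 2 <= (2 * D).+1%:R * energy D c.
Proof. by rewrite -size_freqs; exact: sqr_sum_le. Qed.

End trigonometric_polynomials.

Section discrete_fourier_analysis.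
Variable R : realType.
Local Notation C := R[i].
Implicit Types (D L M : nat) (c d : int -> C) (y : nat -> C) (x : R).

Lemma sum_grid_trigpoly_conj M D c d x : (2 * D < M)%N ->
  \sum_(j < M) trigpoly D c (x - grid M j) * (trigpoly D d (x - grid M j))^*%C =
  M%:R * \sum_(n <- freqs D) c n * (d n)^*%C.
Proof.
move=> DM; transitivity (\sum_(n <- freqs D) \sum_(m <- freqs D)
    c n * (d m)^*%C * \sum_(j < M) expi (n - m) (x - grid M j)).
  under eq_bigr do rewrite conj_trigpoly big_distrlr /=.
  rewrite exchange_big /=; apply: eq_bigr => n _.
  rewrite exchange_big /=; apply: eq_bigr => m _.
  by rewrite mulr_sumr; apply: eq_bigr => j _; rewrite expiD; ring.
rewrite mulr_sumr; apply: eq_sum_freqs => n nD.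
rewrite (bigD1_seq n) ?mem_freqs ?freqs_uniq //= [X in _ + X]big1_seq ?addr0.
  by rewrite sum_expi_gridB ?subrr ?eqxx 1?mulrC //; lia.
move=> m /andP[mn]; rewrite mem_freqs => mD; rewrite sum_expi_gridB; last lia.
by rewrite subr_eq0 eq_sym (negbTE mn) mulr0.
Qed.

Lemma grid_mean_sqr_trigpoly M D c x : (2 * D < M)%N ->
  grid_mean M (fun u => normc (trigpoly D c u) ^+ 2) x = energy D c.
Proof.
move=> DM; have M0 : (M%:R : R) != 0 by rewrite pnatr_eq0; lia.
apply: (mulfI M0); rewrite mulVKf //; apply: (@complexI R).
rewrite rmorphM rmorph_nat !rmorph_sum /=.
under eq_bigr do rewrite sqr_normc_conj.
by under [in RHS]eq_bigr do rewrite sqr_normc_conj; rewrite sum_grid_trigpoly_conj.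
Qed.

Definition dft M y (n : int) : C := M%:R^-1 * \sum_(j < M) y j * expi n (- grid M j).

Lemma dftB M y z n : dft M (fun j => y j - z j) n = dft M y n - dft M z n.
Proof.
rewrite /dft -mulrBr -sumrB; congr (_ * _).
by apply: eq_bigr => j _; rewrite mulrBl.
Qed.

Lemma dft_trigpoly M D c n : bandlimited D c -> (`|n| + D < M)%N ->
  dft M (fun j => trigpoly D c (grid M j)) n = c n.
Proof.
move=> cD nM; have M0 : (M%:R : C) != 0 by apply: natc_neq0; exact: leq_ltn_trans nM.
apply: (mulfI M0); rewrite mulVKf //; under eq_bigr do rewrite mulr_suml.
rewrite exchange_big /=.
transitivity (\sum_(k <- freqs D) c k * (if k == n then M%:R else 0)).
  apply: eq_sum_freqs => k kD.
  transitivity (c k * \sum_(j < M) expi (k - n) (grid M j)).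
    by rewrite mulr_sumr; apply: eq_bigr => j _; rewrite expiD expi_argN mulrA.
  by rewrite sum_expi_grid ?subr_eq0 //; lia.
rewrite (@sum_freqs_single _ _ _ n) ?eqxx 1?mulrC //.
- by move=> k /cD ->; rewrite mul0r.
- by move=> k /negbTE ->; rewrite mulr0.
Qed.

Lemma sum_mul_conj_trigpoly_dft M L y : (0 < M)%N ->
  \sum_(j < M) y j * (trigpoly L (dft M y) (grid M j))^*%C = (M%:R * energy L (dft M y))%:C.
Proof.
move=> M0; rewrite rmorphM rmorph_nat /energy rmorph_sum /= mulr_sumr.
under eq_bigr do rewrite conj_trigpoly mulr_sumr.
rewrite exchange_big /=; apply: eq_bigr => n _.
rewrite sqr_normc_conj {2}/dft -mulrA mulVKf ?natc_neq0 // mulr_suml.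
by apply: eq_bigr => j _; rewrite expi_argN; ring.
Qed.

Lemma energy_dft_le M L y : (2 * L < M)%N ->
  M%:R * energy L (dft M y) <= \sum_(j < M) normc (y j) ^+ 2.
Proof.
move=> LM; have M0 : (0 < M)%N by exact: leq_ltn_trans LM.
pose T := trigpoly L (dft M y).
have : 0 <= \sum_(j < M) normc (y j - T (grid M j)) ^+ 2.
  by apply: sumr_ge0 => j _; rewrite sqr_ge0.
under eq_bigr do rewrite sqr_normcB.
rewrite sumrB big_split /= -mulr_sumr.
have -> : \sum_(j < M) Re (y j * (T (grid M j))^*%C) = M%:R * energy L (dft M y).
  rewrite -[LHS](raddf_sum (@complex.Re R : Rcomplex R -> R)).
  by rewrite sum_mul_conj_trigpoly_dft.
have -> : \sum_(j < M) normc (T (grid M j)) ^+ 2 = M%:R * energy L (dft M y).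
  rewrite /energy -(sum_freqsN L (fun n => normc (dft M y n) ^+ 2)).
  rewrite -/(energy L (fun n => dft M y (- n))) -(grid_mean_sqr_trigpoly _ 0 LM).
  rewrite mulVKf ?pnatr_eq0 -?lt0n //.
  by apply: eq_bigr => j _; rewrite -trigpoly_argN sub0r opprK.
lra.
Qed.

Definition grid_conv M y (K : R -> C) x : C :=
  M%:R^-1 * \sum_(j < M) y j * K (x - grid M j).

Lemma normc_grid_conv_le M y (K : R -> C) (B : R) x : (forall j, normc (y j) <= B) ->
  normc (grid_conv M y K x) <= B * grid_mean M (fun u => normc (K u)) x.
Proof.
move=> yB; rewrite /grid_conv normcM normcV normc_nat mulrCA ler_wpM2l ?invr_ge0 //.
apply: le_trans (normc_sum _ _ _) _; rewrite mulr_sumr; apply: ler_sum => j _.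
by rewrite normcM ler_wpM2r ?normc_ge0.
Qed.

Lemma grid_conv_trigpoly M L y (v : int -> C) x :
  grid_conv M y (trigpoly L v) x = trigpoly L (fun n => v n * dft M y n) x.
Proof.
rewrite /grid_conv /trigpoly /dft; under eq_bigr do rewrite mulr_sumr.
rewrite exchange_big /= mulr_sumr; apply: eq_bigr => n _.
rewrite mulrCA -mulrA; congr (_ * _); rewrite mulr_sumr mulr_suml.
by apply: eq_bigr => j _; rewrite expi_argD; ring.
Qed.

(* Convolution with a trigonometric polynomial is exact on a grid finer than the
   sum of the two degrees. *)
Lemma trigpoly_mul_bounded M D L c (v : int -> C) (B K : R) : bandlimited D c ->
  (D + L < M)%N -> (forall x, normc (trigpoly D c x) <= B) ->
  (forall x, grid_mean M (fun u => normc (trigpoly L v u)) x <= K) ->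
  forall x, normc (trigpoly L (fun n => v n * c n) x) <= B * K.
Proof.
move=> cD DLM cB vK x; have B0 : 0 <= B by exact: le_trans (normc_ge0 _) (cB 0).
have -> : trigpoly L (fun n => v n * c n) x =
    grid_conv M (fun j => trigpoly D c (grid M j)) (trigpoly L v) x.
  rewrite grid_conv_trigpoly; apply: eq_trigpoly => n nL; rewrite dft_trigpoly //.
  by rewrite (leq_ltn_trans _ DLM) // addnC leq_add2l.
by apply: le_trans (normc_grid_conv_le _ _ _ (fun j => cB _)) _; rewrite ler_wpM2l.
Qed.

End discrete_fourier_analysis.

(** * Finite differences and the de la Vallee-Poussin kernel *)

Section finite_differences.
Variable R : realType.
Local Notation C := R[i].
Implicit Types (k : nat) (h x : R) (f g : R -> C).

Lemma Deltak_linear k h (a b : C) f g :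
  Deltak k h (fun y => a * f y + b * g y) = (fun x => a * Deltak k h f x + b * Deltak k h g x).
Proof.
apply/funext; rewrite /Deltak; elim: k => //= k ih x.
by rewrite /Delta !ih; ring.
Qed.

Lemma DeltakZ k h (a : C) f : Deltak k h (fun y => a * f y) = (fun x => a * Deltak k h f x).
Proof.
rewrite (_ : (fun y => a * f y) = (fun y => a * f y + 0 * f y)).
  by rewrite Deltak_linear; apply/funext => x; rewrite mul0r addr0.
by apply/funext => x; rewrite mul0r addr0.
Qed.

Lemma DeltakD k h f g :
  Deltak k h (fun y => f y + g y) = (fun x => Deltak k h f x + Deltak k h g x).
Proof.
have one_lincomb u v : (fun x => u x + v x) = (fun x : R => 1 * u x + 1 * v x :> C).
  by apply/funext => x; rewrite !mul1r.
by rewrite one_lincomb Deltak_linear -one_lincomb.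
Qed.

Lemma DeltaM h f g :
  Delta h (fun y => f y * g y) = (fun y => Delta h f y * g (y + h) + f y * Delta h g y).
Proof. by apply/funext => y; rewrite /Delta; ring. Qed.

Lemma Deltak_trigpoly k h D (c : int -> C) :
  Deltak k h (trigpoly D c) = trigpoly D (fun n => (expi n h - 1) ^+ k * c n).
Proof.
apply/funext; rewrite /Deltak; elim: k => [x|k ih x] /=.
  by apply: eq_trigpoly => n _; rewrite expr0 mul1r.
rewrite /Delta !ih trigpoly_argD -trigpolyB.
by apply: eq_trigpoly => n _; rewrite exprS; ring.
Qed.

Lemma Delta_trigpoly h D (c : int -> C) :
  Delta h (trigpoly D c) = trigpoly D (fun n => (expi n h - 1) * c n).
Proof. exact: (Deltak_trigpoly 1). Qed.

End finite_differences.

Section differences_of_products.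
Variable R : realType.
Local Notation C := R[i].
Variables (M D : nat) (h eta : R).
Hypotheses (DM : (2 * D < M)%N) (eta0 : 0 <= eta).
Hypothesis symbol_le : symbol_bounded D h eta.
Implicit Types (c d : int -> C) (x : R).

Lemma grid_mean_trigpolyM_le c d x :
  grid_mean M (fun u => normc (trigpoly D c u * trigpoly D d u)) x <=
  Num.sqrt (energy D c) * Num.sqrt (energy D d).
Proof.
have Mi0 : 0 <= (M%:R^-1 : R) by rewrite invr_ge0.
rewrite -(grid_mean_sqr_trigpoly c x DM) -(grid_mean_sqr_trigpoly d x DM) /grid_mean.
rewrite !sqrtrM // mulrACA -expr2 sqr_sqrtr // ler_wpM2l //.
by under eq_bigr do rewrite normcM; exact: sum_mul_le_sqrt.
Qed.

Lemma sqrt_energy_symbol_le c :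
  Num.sqrt (energy D (fun n => (expi n h - 1) * c n)) <= eta * Num.sqrt (energy D c).
Proof.
rewrite -[X in _ <= X * _](ger0_norm eta0) -sqrtr_sqr -sqrtrM ?sqr_ge0 // ler_wsqrtr // -energyZ.
apply: le_energy => n nD; rewrite !normcM normc_real ger0_norm //.
by rewrite ler_wpM2r ?normc_ge0 ?symbol_le.
Qed.

Lemma energy_translate c : energy D (fun n => c n * expi n h) = energy D c.
Proof. by apply: eq_bigr => n _; rewrite normcM normc_expi mulr1. Qed.

(* By the product rule each difference falls on one of the two factors, where it
   costs a factor [eta] in l2. *)
Lemma grid_mean_Deltak_trigpolyM_le k c d x :
  grid_mean M (fun u => normc (Deltak k h (fun y => trigpoly D c y * trigpoly D d y) u)) x <=
  (2 * eta) ^+ k * (Num.sqrt (energy D c) * Num.sqrt (energy D d)).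
Proof.
elim: k c d => [|k ih] c d; first by rewrite expr0 mul1r; exact: grid_mean_trigpolyM_le.
have eta_k : 0 <= (2 * eta) ^+ k by rewrite exprn_ge0 // mulr_ge0.
pose c' n := (expi n h - 1) * c n; pose d' n := (expi n h - 1) * d n.
pose dh n := d n * expi n h.
have product_rule u :
    Deltak k.+1 h (fun y => trigpoly D c y * trigpoly D d y) u =
    Deltak k h (fun y => trigpoly D c' y * trigpoly D dh y) u +
    Deltak k h (fun y => trigpoly D c y * trigpoly D d' y) u.
  rewrite /Deltak iterSr -!/(Deltak k h _) DeltaM !Delta_trigpoly.
  rewrite [X in Deltak k h X](_ : _ = (fun y => trigpoly D c' y * trigpoly D dh y +
      trigpoly D c y * trigpoly D d' y)) ?DeltakD //.
  by apply/funext => y; rewrite trigpoly_argD.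
apply: (@le_trans _ _ (grid_mean M (fun u =>
    normc (Deltak k h (fun y => trigpoly D c' y * trigpoly D dh y) u) +
    normc (Deltak k h (fun y => trigpoly D c y * trigpoly D d' y) u)) x)).
  by apply: le_grid_mean => u; rewrite product_rule; exact: le_normcD.
rewrite grid_meanD; apply: le_trans (lerD (ih _ _) (ih _ _)) _.
rewrite -mulrDr exprSr -mulrA ler_wpM2l // energy_translate mulr2n mulrDl mul1r mulrDl.
apply: lerD; first by rewrite mulrA ler_wpM2r ?sqrtr_ge0 ?sqrt_energy_symbol_le.
by rewrite mulrCA ler_wpM2l ?sqrtr_ge0 ?sqrt_energy_symbol_le.
Qed.

End differences_of_products.

Section vallee_poussin_kernel.
Variable R : realType.
Local Notation C := R[i].
Implicit Types (l N M : nat) (n a : int) (x h eta : R).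

Definition vp_coef l n : R := l%:R^-1 * \sum_(l <= k < 2 * l) (`|n| <= k)%N%:R.

Lemma vp_coef_ge0 l n : 0 <= vp_coef l n.
Proof. by rewrite mulr_ge0 ?invr_ge0 ?ler0n // sumr_ge0. Qed.

Lemma vp_coef_le1 l n : vp_coef l n <= 1.
Proof.
have [->|l0] := posnP l; first by rewrite /vp_coef invr0 mul0r.
rewrite /vp_coef mulrC ler_pdivrMr ?ltr0n // mul1r.
apply: (@le_trans _ _ (\sum_(l <= k < 2 * l) 1)).
  by apply: ler_sum => k _; case: (_ <= _)%N.
by rewrite sumr_const_nat ler_nat; lia.
Qed.

Lemma vp_coef_eq1 l n : (0 < l)%N -> (`|n| <= l)%N -> vp_coef l n = 1.
Proof.
move=> l0 nl; rewrite /vp_coef.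
rewrite (eq_big_nat _ _ (F2 := fun=> 1)) => [|k /andP[lk _]]; last by rewrite (leq_trans nl).
rewrite sumr_const_nat (_ : (2 * l - l = l)%N); last lia.
by rewrite mulVf // pnatr_eq0 -lt0n.
Qed.

Lemma vp_coef_eq0 l n : (2 * l <= `|n|)%N -> vp_coef l n = 0.
Proof.
move=> nl; rewrite /vp_coef big_nat big1 ?mulr0 // => k /andP[_ kl].
by rewrite leqNgt (leq_trans kl nl).
Qed.

Lemma vp_coef_ge_half l n : (0 < l)%N -> (2 * `|n| <= 3 * l)%N -> 2^-1 <= vp_coef l n.
Proof.
move=> l0 nl; have [nl1|nl1] := leqP `|n| l; first by rewrite vp_coef_eq1 //; lra.
rewrite /vp_coef (big_cat_nat _ (n := `|n|%N)) /=; [|lia|lia].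
rewrite [X in _ + X](eq_big_nat _ _ (F2 := fun=> 1)) => [|k /andP[-> _] //].
rewrite sumr_const_nat mulrC ler_pdivlMr ?ltr0n //.
apply: ler_wpDl; first by rewrite sumr_ge0.
rewrite natrB; last lia.
have : (2 * `|n|)%:R <= (3 * l)%:R :> R by rewrite ler_nat.
by rewrite !natrM; lra.
Qed.

Lemma bandlimited_vp_coef l : bandlimited (2 * l) (fun n => (vp_coef l n)%:C).
Proof. by move=> n nl; rewrite vp_coef_eq0 // ltnW. Qed.

Lemma bandlimited_fmult_vp l (c : int -> C) : bandlimited (2 * l) (fmult (vp_coef l) c).
Proof. by move=> n nl; rewrite /fmult bandlimited_vp_coef ?mul0r. Qed.

Lemma dirichletE k x : dirichlet k x = \sum_(n <- freqs k) expi n x.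
Proof.
by rewrite /dirichlet big_map -[(2 * k).+1 in RHS]subn0 -/(index_iota 0 _) big_mkord.
Qed.

Lemma vallee_poussinE l :
  vallee_poussin l = trigpoly (2 * l) (fun n => (vp_coef l n)%:C).
Proof.
apply/funext => x; rewrite /vallee_poussin /trigpoly.
transitivity (l%:R^-1 * \sum_(l <= k < 2 * l) \sum_(n <- freqs (2 * l))
   (`|n| <= k)%N%:R * expi n x : C).
  congr (_ * _); apply: eq_big_nat => k /andP[_ kl].
  rewrite dirichletE (@sum_freqs_widen _ k (2 * l)) ?(ltnW kl) //.
    by apply: eq_sum_freqs => n ->; rewrite mul1r.
  by move=> n; rewrite ltnNge => /negbTE ->; rewrite mul0r.
rewrite exchange_big /= mulr_sumr; apply: eq_bigr => n _.
rewrite -mulr_suml mulrA; congr (_ * _).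
rewrite /vp_coef rmorphM /= fmorphV rmorph_nat rmorph_sum /=; congr (_ * _).
by apply: eq_bigr => k _; rewrite rmorph_nat.
Qed.

Definition exp_sum N x : C := \sum_(j < N) expi j x.

Lemma conj_exp_sum N x : (exp_sum N x)^*%C = \sum_(j < N) expi (- j%:Z) x.
Proof.
rewrite /exp_sum (rmorph_sum (@conjc R)).
by apply: eq_bigr => j _; rewrite -expi_conj.
Qed.

Lemma exp_sum_trigpoly N x :
  exp_sum N x = trigpoly N (fun n => (0 <= n < N%:Z)%R%:R) x.
Proof.
rewrite /trigpoly sum_freqs_nat => [|n /negbTE ->]; last by rewrite mul0r.
by apply: eq_bigr => j _; rewrite (_ : _ && _ = true) ?mul1r //; have := ltn_ord j; lia.
Qed.

Lemma grid_mean_sqr_exp_sum M N x : (2 * N < M)%N ->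
  grid_mean M (fun u => normc (exp_sum N u) ^+ 2) x = N%:R.
Proof.
move=> NM; transitivity (energy N (fun n => (0 <= n < N%:Z)%R%:R : C)).
  rewrite -(grid_mean_sqr_trigpoly _ x NM); congr grid_mean.
  by apply/funext => u; rewrite exp_sum_trigpoly.
rewrite /energy sum_freqs_nat => [|n /negbTE ->]; last by rewrite normc0 expr0n.
rewrite (eq_bigr (fun=> 1)) ?sumr_const ?card_ord // => j _.
by rewrite (_ : _ && _ = true) ?normc1 ?expr1n //; have := ltn_ord j; lia.
Qed.

Lemma sum_dirichlet N x : \sum_(k < N) dirichlet k x = (normc (exp_sum N x) ^+ 2)%:C.
Proof.
elim: N => [|N ih].
  by rewrite /exp_sum !big_ord0 normc0 expr0n.
rewrite big_ord_recr /= ih !sqr_normc_conj /exp_sum big_ord_recr /= -/(exp_sum N x).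
have -> : (exp_sum N x + expi N x)^*%C = (exp_sum N x)^*%C + expi (- N%:Z) x.
  by rewrite -expi_conj; exact: (rmorphD (@conjc R)).
rewrite mulrDl !mulrDr expi_mulN -!addrA; congr (_ + _).
rewrite addrA conj_exp_sum mulr_suml mulr_sumr.
rewrite /dirichlet -(big_mkord predT (fun j => expi (j%:Z - N%:Z) x)).
rewrite (big_cat_nat _ (n := N)) //=; [|lia].
rewrite big_nat_recl; [|lia].
rewrite subrr expi0 [1 + _]addrC addrA; congr (_ + _ + _).
  by rewrite big_mkord; apply: eq_bigr => j _; rewrite -expiD.
rewrite -(big_mkord predT (fun j => expi N x * expi (- j%:Z) x)) big_nat_rev /=.
rewrite -{1}[N]add0n big_addn (_ : (2 * N - N = N)%N); last lia.
apply: eq_big_nat => j jN; rewrite -expiD.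
by congr expi; lia.
Qed.

Lemma vallee_poussin_fejer l x : vallee_poussin l x =
  l%:R^-1 * (exp_sum (2 * l) x * (exp_sum (2 * l) x)^*%C - exp_sum l x * (exp_sum l x)^*%C).
Proof.
rewrite /vallee_poussin -!sqr_normc_conj -!sum_dirichlet; congr (_ * _).
rewrite -!(big_mkord predT (fun k => dirichlet k x)).
by rewrite [in RHS](big_cat_nat _ (n := l)) //=; [rewrite addrAC subrr add0r|lia].
Qed.

Definition modulated_vp a l x : C := expi a x * vallee_poussin l x.

Lemma modulated_vp_trigpoly a l :
  modulated_vp a l = trigpoly (2 * l + `|a|) (fun n => (vp_coef l (n - a))%:C).
Proof.
apply/funext => x; rewrite /modulated_vp vallee_poussinE.
by rewrite -(trigpoly_modulate _ _ (@bandlimited_vp_coef l)).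
Qed.

Lemma modulated_vp0 l : modulated_vp 0 l = vallee_poussin l.
Proof. by apply/funext => x; rewrite /modulated_vp expi0 mul1r. Qed.

Lemma grid_mean_Deltak_modulated_fejer_le M D h eta k a N x : (2 * D < M)%N -> 0 <= eta ->
  symbol_bounded D h eta -> (N + `|a| <= D)%N ->
  grid_mean M (fun u =>
    normc (Deltak k h (fun y => expi a y * exp_sum N y * (exp_sum N y)^*%C) u)) x <=
  (2 * eta) ^+ k * N%:R.
Proof.
move=> DM eta0 symbol_le ND; pose g n : C := (0 <= n < N%:Z)%R%:R.
have gN : bandlimited N g.
  by move=> n nN; rewrite /g (_ : _ && _ = false) //; apply/negbTE; lia.
have first_factor y : expi a y * exp_sum N y = trigpoly D (fun n => g (n - a)) y.
  rewrite exp_sum_trigpoly -trigpoly_modulate // (@trigpoly_widen _ _ D _ y ND) //.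
  by move=> n nN; apply: gN; lia.
have second_factor y : (exp_sum N y)^*%C = trigpoly D (fun n => g (- n)) y.
  rewrite -trigpoly_argN (@trigpoly_widen _ N D) //; last lia.
  rewrite -exp_sum_trigpoly conj_exp_sum.
  by apply: eq_bigr => j _; rewrite expi_argN.
have energyN (c : int -> C) : (forall y, normc (trigpoly D c y) = normc (exp_sum N y)) ->
    energy D c = N%:R.
  move=> cN; rewrite -(grid_mean_sqr_trigpoly _ x DM) -(@grid_mean_sqr_exp_sum M N x); last lia.
  by congr grid_mean; apply/funext => y; rewrite cN.
have -> : (fun y => expi a y * exp_sum N y * (exp_sum N y)^*%C) =
    (fun y => trigpoly D (fun n => g (n - a)) y * trigpoly D (fun n => g (- n)) y).
  by apply/funext => y; rewrite first_factor second_factor.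
apply: le_trans (grid_mean_Deltak_trigpolyM_le DM eta0 symbol_le k _ _ x) _.
rewrite !energyN => [|y|y].
- by rewrite -expr2 sqr_sqrtr.
- by rewrite -second_factor normc_conj.
- by rewrite -first_factor normcM normc_expi mul1r.
Qed.

Lemma grid_mean_Deltak_modulated_vp_le M h eta k a l x : (0 < l)%N ->
  (2 * (2 * l + `|a|) < M)%N -> 0 <= eta ->
  symbol_bounded (2 * l + `|a|) h eta ->
  grid_mean M (fun u => normc (Deltak k h (modulated_vp a l) u)) x <= 3 * (2 * eta) ^+ k.
Proof.
move=> l0 lM eta0 symbol_le; have L0 : (0 : R) < l%:R by rewrite ltr0n.
pose F N y := expi a y * exp_sum N y * (exp_sum N y)^*%C.
pose mean_F N := grid_mean M (fun u => normc (Deltak k h (F N) u)) x.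
have mean_F_le N : (N <= 2 * l)%N -> l%:R^-1 * mean_F N <= l%:R^-1 * ((2 * eta) ^+ k * N%:R).
  move=> Nl; rewrite ler_wpM2l ?invr_ge0 ?(ltW L0) //.
  apply: (@grid_mean_Deltak_modulated_fejer_le M _ h eta k a N x lM eta0 symbol_le).
  by rewrite leq_add2r.
have -> : modulated_vp a l = (fun y => l%:R^-1 * F (2 * l)%N y + - l%:R^-1 * F l y).
  by apply/funext => y; rewrite /modulated_vp vallee_poussin_fejer /F; ring.
apply: (@le_trans _ _ (l%:R^-1 * mean_F (2 * l)%N + l%:R^-1 * mean_F l)).
  rewrite -!grid_meanZ -grid_meanD; apply: le_grid_mean => u; rewrite Deltak_linear.
  by apply: le_trans (le_normcD _ _) _; rewrite !normcM normcN normcV normc_nat.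
apply: le_trans (lerD (mean_F_le _ (leqnn _)) (mean_F_le l _)) _; first by rewrite leq_pmull.
by rewrite natrM (_ : _ + _ = 3 * (2 * eta) ^+ k) //; field; rewrite gt_eqF.
Qed.

Lemma grid_mean_vallee_poussin_le M l x : (0 < l)%N -> (4 * l < M)%N ->
  grid_mean M (fun u => normc (vallee_poussin l u)) x <= 3.
Proof.
move=> l0 lM; rewrite -modulated_vp0 -[leRHS]mulr1 -(expr0 (2 * 2)).
apply: (@grid_mean_Deltak_modulated_vp_le M 0 2 0 0 l x) => //; first by rewrite addn0 mulnA.
by move=> n _; exact: normc_expiB1_le2.
Qed.

End vallee_poussin_kernel.

Arguments vp_coef {R} l n.

Section sup_norm_bounds.
Variable R : realType.
Local Notation C := R[i].
Implicit Types (c : int -> C) (B : R).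

Lemma vp_interpolation_bounded (M l : nat) (y : nat -> C) B : (0 < l)%N -> (4 * l < M)%N ->
  (forall j, normc (y j) <= B) ->
  forall x, normc (trigpoly (2 * l) (fmult (vp_coef l) (dft M y)) x) <= 3 * B.
Proof.
move=> l0 lM yB x; rewrite -grid_conv_trigpoly -vallee_poussinE mulrC.
apply: le_trans (normc_grid_conv_le _ _ _ yB) _.
rewrite ler_wpM2l ?grid_mean_vallee_poussin_le //.
exact: le_trans (normc_ge0 _) (yB 0).
Qed.

Lemma fmult_vp_bounded (D l : nat) c B : (0 < l)%N -> bandlimited D c ->
  (forall x, normc (trigpoly D c x) <= B) ->
  forall x, normc (trigpoly D (fmult (vp_coef l) c) x) <= 3 * B.
Proof.
move=> l0 cD cB x; rewrite (@trigpoly_band _ D (2 * l)) 1?mulrC.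
- apply: (trigpoly_mul_bounded (M := (2 * (2 * l) + D).+1) cD _ cB) => [|u]; first lia.
  by rewrite -vallee_poussinE grid_mean_vallee_poussin_le //; lia.
- by move=> n nD; rewrite /fmult cD ?mulr0.
- exact: bandlimited_fmult_vp.
Qed.

Lemma fmult_vpB_bounded (D l1 l2 : nat) c B : (0 < l1)%N -> (0 < l2)%N -> bandlimited D c ->
  (forall x, normc (trigpoly D c x) <= B) ->
  forall x, normc (trigpoly D (fmult (fun n => vp_coef l1 n - vp_coef l2 n) c) x) <= 6 * B.
Proof.
move=> l10 l20 cD cB x; rewrite trigpoly_fmultB; apply: le_trans (le_normcB _ _) _.
by have := fmult_vp_bounded l10 cD cB x; have := fmult_vp_bounded l20 cD cB x; lra.
Qed.

Lemma bernstein D c B (h eta : R) k : (0 < D)%N -> bandlimited D c ->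
  (forall x, normc (trigpoly D c x) <= B) -> 0 <= eta ->
  symbol_bounded (2 * D) h eta ->
  forall x, normc (Deltak k h (trigpoly D c) x) <= 3 * (2 * eta) ^+ k * B.
Proof.
move=> D0 cD cB eta0 symbol_le x; pose v n : C := (expi n h - 1) ^+ k * (vp_coef D n)%:C.
have -> : Deltak k h (trigpoly D c) x = trigpoly (2 * D) (fun n => v n * c n) x.
  rewrite Deltak_trigpoly (@trigpoly_widen _ D) => [||n /cD ->]; rewrite ?mulr0 ?leq_pmull //.
  by apply: eq_trigpoly => n nD; rewrite /v vp_coef_eq1 // mulr1.
rewrite mulrC; apply: (trigpoly_mul_bounded (M := (4 * D + D).+1) cD _ cB) => [|u].
  lia.
rewrite -Deltak_trigpoly -vallee_poussinE -modulated_vp0.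
by apply: grid_mean_Deltak_modulated_vp_le; rewrite ?addn0 //; lia.
Qed.

End sup_norm_bounds.

(** * Sparse approximation *)

Section derandomised_sampling.
Variable R : realType.

Lemma expR_le_quadratic (x : R) : x <= 2^-1 -> expR x <= 1 + x + 2 * x ^+ 2.
Proof.
move=> x2; have expN := expR_ge1Dx (- x); have x1 : 0 < 1 - x by lra.
have : (1 - x) * expR x <= 1.
  by rewrite -[leRHS](expRxMexpNx_1 x) [leRHS]mulrC ler_wpM2r ?expR_ge0.
rewrite mulrC -ler_pdivlMr // => /le_trans; apply; rewrite ler_pdivrMr //.
by have := sqr_ge0 x; nra.
Qed.

Lemma exists_le_weighted_mean (I : eqType) (s : seq I) (w F : I -> R) (X : R) :
  {in s, forall i, 0 <= w i} -> \sum_(i <- s) w i = 1 ->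
  \sum_(i <- s) w i * F i <= X -> exists2 i, i \in s & F i <= X.
Proof.
move=> w0 w1 wFX; apply: contrapT => noF.
have XF i : i \in s -> X < F i.
  by move=> si; rewrite ltNge; apply/negP => FX; apply: noF; exists i.
have excess0 i : i \in s -> 0 <= w i * (F i - X).
  by move=> si; rewrite mulr_ge0 ?w0 // subr_ge0 ltW ?XF.
have : \sum_(i <- s | i \in s) w i * (F i - X) == 0.
  rewrite eq_le sumr_ge0 // -big_seq andbT; under eq_bigr do rewrite mulrBr.
  by rewrite sumrB -mulr_suml w1 mul1r subr_le0.
rewrite psumr_eq0 // => /allP excess_eq0.
suff : \sum_(i <- s) w i = 0 by rewrite w1 => /eqP; rewrite oner_eq0.
rewrite big1_seq // => i /andP[_ si]; have := excess_eq0 i si; rewrite si mulf_eq0 /=.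
by rewrite subr_eq0 (gt_eqF (XF _ si)) orbF => /eqP.
Qed.

Section greedy_selection.
Variables (I : eqType) (s : seq I) (w : I -> R) (J : finType) (y : I -> J -> R) (lam : R).
Hypothesis w0 : {in s, forall i, 0 <= w i}.
Hypothesis w1 : \sum_(i <- s) w i = 1.
Hypothesis y1 : {in s, forall i j, `|y i j| <= 1}.
Hypothesis wy0 : forall j, \sum_(i <- s) w i * y i j = 0.
Hypothesis lam_bound : 0 <= lam <= 2^-1.

Lemma mean_expR_le j : \sum_(i <- s) w i * expR (lam * y i j) <= 1 + 2 * lam ^+ 2.
Proof.
have /andP[lam0 lam1] := lam_bound.
apply: (@le_trans _ _ (\sum_(i <- s) (w i * (1 + 2 * lam ^+ 2) + lam * (w i * y i j)))).
  rewrite big_seq [leRHS]big_seq; apply: ler_sum => i si.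
  rewrite (_ : _ + _ = w i * (1 + lam * y i j + 2 * lam ^+ 2)); last by ring.
  have := y1 si j; rewrite ler_norml => /andP[ya yb].
  rewrite ler_wpM2l ?w0 //; apply: le_trans (expR_le_quadratic _) _; first by nra.
  by rewrite lerD2l ler_wpM2l // exprMn ler_piMr ?sqr_ge0 //; nra.
by rewrite big_split /= -mulr_suml w1 mul1r -mulr_sumr wy0 mulr0 addr0.
Qed.

Lemma greedy_step (S : J -> R) : exists2 i, i \in s &
  \sum_j expR (lam * (y i j + S j)) <= (1 + 2 * lam ^+ 2) * \sum_j expR (lam * S j).
Proof.
apply: (exists_le_weighted_mean w0 w1); under eq_bigr do rewrite mulr_sumr.
rewrite exchange_big /= mulr_sumr; apply: ler_sum => j _.
rewrite (eq_bigr (fun i => (w i * expR (lam * y i j)) * expR (lam * S j))) => [|i _].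
  by rewrite -mulr_suml ler_wpM2r ?expR_ge0 ?mean_expR_le.
by rewrite mulrDr expRD mulrA.
Qed.

(* Method of conditional expectations: each new index is chosen so that the
   exponential potential does not exceed its mean. *)
Lemma greedy_selection (m : nat) : exists t : seq I, [/\ size t = m, {subset t <= s} &
  \sum_j expR (lam * \sum_(i <- t) y i j) <= #|J|%:R * (1 + 2 * lam ^+ 2) ^+ m].
Proof.
elim: m => [|m [t [tm ts t_le]]].
  exists [::]; split=> //; rewrite expr0 mulr1.
  by under eq_bigr do rewrite big_nil mulr0 expR0; rewrite sumr_const.
have [i si i_le] := greedy_step (fun j => \sum_(i <- t) y i j).
exists (i :: t); split=> /=; first by rewrite tm.
  by move=> k; rewrite inE => /orP[/eqP -> //|/ts].
under eq_bigr do rewrite big_cons.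
apply: le_trans i_le _; rewrite [_ ^+ m.+1]exprS [leRHS]mulrCA ler_wpM2l //.
by have := sqr_ge0 lam; lra.
Qed.

End greedy_selection.

Lemma one_plus_inv_exp_le2 (m : nat) : (1 + (2 * m%:R)^-1 : R) ^+ m <= 2.
Proof.
have [->|m0] := posnP m; first by rewrite expr0; lra.
apply: (@le_trans _ _ (expR (2 * m%:R)^-1 ^+ m)).
  have inv0 : 0 <= (2 * m%:R : R)^-1 by rewrite invr_ge0 mulr_ge0.
  by apply: lerXn2r; rewrite ?nnegrE ?expR_ge0 ?expR_ge1Dx //; lra.
have -> : expR (2 * m%:R)^-1 ^+ m = expR 2^-1 :> R.
  by rewrite -expRM_natl; congr expR; field; rewrite pnatr_eq0 -lt0n.
by apply: le_trans (expR_le_quadratic _) _; lra.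
Qed.

End derandomised_sampling.

Section quarter_turns.
Variable R : realType.
Implicit Types (b : 'I_4) (z : R[i]).

Definition Re_turn b z : R := Re ('i%C ^+ b * z).

Lemma normr_Re_turn_le b z : `|Re_turn b z| <= normc z.
Proof.
apply: le_trans (normr_Re_le _) _; rewrite normcM normcX.
by rewrite (_ : normc 'i%C = 1) ?expr1n ?mul1r //= expr0n expr1n add0r sqrtr1.
Qed.

Lemma Re_turn_sum b (I : Type) (s : seq I) (F : I -> R[i]) :
  Re_turn b (\sum_(i <- s) F i) = \sum_(i <- s) Re_turn b (F i).
Proof.
rewrite /Re_turn mulr_sumr.
exact: (raddf_sum (@complex.Re R : Rcomplex R -> R)).
Qed.

Lemma Re_turn_realM b (a : R) z : Re_turn b (a%:C * z) = a * Re_turn b z.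
Proof.
rewrite /Re_turn mulrCA; case: ('i%C ^+ b * z) => u v /=.
by rewrite mul0r subr0.
Qed.

Lemma exists_Re_turn_ge_half z : exists b, normc z / 2 <= Re_turn b z.
Proof.
have normc_le := normc_le_ReDIm z.
have [turn0 turn1 turn2 turn3] : [/\ Re_turn (inord 0) z = Re z,
    Re_turn (inord 1) z = - Im z, Re_turn (inord 2) z = - Re z &
    Re_turn (inord 3) z = Im z].
  by rewrite /Re_turn !inordK // !exprS expr0; case: z {normc_le} => u v /=; split; ring.
have [ReIm|ImRe] := leP `|Re z| `|Im z|.
  have [Im0|Im0] := leP 0 (Im z); [exists (inord 3)|exists (inord 1)].
    by rewrite turn3; move: normc_le ReIm; rewrite [`|Im z|]ger0_norm //; lra.
  by rewrite turn1; move: normc_le ReIm; rewrite [`|Im z|]ltr0_norm //; lra.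
have [Re0|Re0] := leP 0 (Re z); [exists (inord 0)|exists (inord 2)].
  by rewrite turn0; move: normc_le ImRe; rewrite [`|Re z|]ger0_norm //; lra.
by rewrite turn2; move: normc_le ImRe; rewrite [`|Re z|]ltr0_norm //; lra.
Qed.

End quarter_turns.

Section sampling_step.
Variable R : realType.
Local Notation C := R[i].
Implicit Types (c : int -> C) (x : R).

Definition phase c (k : int) : C := c k / (normc (c k))%:C.

Lemma normc_phase_le1 c k : normc (phase c k) <= 1.
Proof.
rewrite /phase normcM normcV normc_real ger0_norm ?normc_ge0 //.
by have [->|ck] := eqVneq (normc (c k)) 0; rewrite ?mul0r // divff.
Qed.

Lemma normc_phase c k : (normc (c k))%:C * phase c k = c k.
Proof.
have [ck|ck] := eqVneq (normc (c k)) 0; first by rewrite ck mul0r (eq0_normc ck).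
by rewrite /phase mulrCA divff ?mulr1 // (inj_eq (@complexI R)).
Qed.

Section centred_atoms.
Variables (D : nat) (c : int -> C).
Local Notation A := (l1norm D c).
Hypothesis A0 : 0 < A.

Definition centred_atom (k : int) x : C :=
  ((2 * A)^-1)%:C * (trigpoly D c x - A%:C * phase c k * expi k x).

Let AC : A%:C != 0 :> C. Proof. by rewrite (inj_eq (@complexI R)) /= gt_eqF. Qed.

Lemma normc_centred_atom_le1 k x : normc (centred_atom k x) <= 1.
Proof.
have A2 : 0 < 2 * A by rewrite mulr_gt0.
rewrite /centred_atom normcM normc_real gtr0_norm ?invr_gt0 //.
rewrite mulrC ler_pdivrMr // mul1r; apply: le_trans (le_normcB _ _) _.
have TA : normc (trigpoly D c x) <= A by exact: normc_trigpoly_le.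
have atomA : A * normc (phase c k) <= A by rewrite ler_piMr ?normc_phase_le1 // ltW.
rewrite (normcM (_ * _)) (normcM _ (phase c k)) normc_real.
by rewrite (gtr0_norm A0) normc_expi mulr1; lra.
Qed.

Lemma mean_centred_atom x :
  \sum_(k <- freqs D) (normc (c k) / A)%:C * centred_atom k x = 0.
Proof.
transitivity (\sum_(k <- freqs D) ((2 * A)^-1)%:C *
    ((normc (c k))%:C * (A^-1%:C * trigpoly D c x) - c k * expi k x)).
  apply: eq_bigr => k _; rewrite /centred_atom -[X in _ = _ * (_ - X * _)](normc_phase c k).
  rewrite (rmorphM (real_complex R) (normc (c k)) A^-1) [_ (A^-1)]fmorphV.
  move: (phase c k) (trigpoly D c x) (((2 * A)^-1)%:C) => a b d /=; field.
  by rewrite AC.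
rewrite -mulr_sumr sumrB -mulr_suml -(rmorph_sum (real_complex R)) -/(l1norm D c) mulrA.
by rewrite -rmorphM /= divff ?gt_eqF // rmorph1 mul1r subrr mulr0.
Qed.

Definition sampled_coef (t : seq int) (n : int) : C :=
  (A / (size t)%:R)%:C * \sum_(k <- t) (if k == n then phase c k else 0).

Lemma sampled_coef_eq0 t n : n \notin t -> sampled_coef t n = 0.
Proof.
move=> nt; rewrite /sampled_coef big1_seq ?mulr0 // => k /andP[_ kt].
by case: eqP => // kn; rewrite -kn kt in nt.
Qed.

Lemma trigpoly_sampled_coef t x : {subset t <= freqs D} ->
  trigpoly D (sampled_coef t) x = (A / (size t)%:R)%:C * \sum_(k <- t) phase c k * expi k x.
Proof.
move=> tD; rewrite trigpolyZ; congr (_ * _); rewrite /trigpoly.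
under eq_bigr do rewrite mulr_suml.
rewrite exchange_big /=; apply: eq_big_seq => k kt.
rewrite (@sum_freqs_single _ _ _ k) ?eqxx // => n nk.
  case: eqP => [kn|]; last by rewrite mul0r.
  by have := tD _ kt; rewrite mem_freqs leqNgt kn nk.
by rewrite eq_sym (negbTE nk) mul0r.
Qed.

Lemma trigpolyB_sampled_coef t x : (0 < size t)%N -> {subset t <= freqs D} ->
  trigpoly D (fun n => c n - sampled_coef t n) x =
  (2 * A / (size t)%:R)%:C * \sum_(k <- t) centred_atom k x.
Proof.
move=> t0 tD; have tC := natc_neq0 R t0.
have -> : \sum_(k <- t) centred_atom k x = ((2 * A)^-1)%:C * ((size t)%:R * trigpoly D c x -
    A%:C * \sum_(k <- t) phase c k * expi k x).
  rewrite /centred_atom -mulr_sumr sumrB big_const_seq count_predT iter_addr_0.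
  congr (_ * (_ - _)); first by rewrite mulr_natl.
  by rewrite mulr_sumr; apply: eq_bigr => k _; rewrite mulrA.
rewrite trigpolyB trigpoly_sampled_coef // mulrA -rmorphM /= !rmorphM !fmorphV /=.
by rewrite !rmorphM !rmorph_nat; field; rewrite AC tC.
Qed.

End centred_atoms.

Lemma exists_sample (D m M : nat) c : (0 < m)%N -> 0 < l1norm D c ->
  exists t : seq int, [/\ size t = m, {subset t <= freqs D} &
    \sum_(j < M) expR (normc (\sum_(k <- t) centred_atom D c k (grid M j)) /
      (4 * Num.sqrt m%:R)) <= 8 * M%:R].
Proof.
move=> m0; set A := l1norm D c => A0; pose sm : R := Num.sqrt m%:R.
have sm1 : 1 <= sm by rewrite -[leLHS]sqrtr1 ler_wsqrtr // ler1n.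
have sm2 : sm ^+ 2 = m%:R by rewrite sqr_sqrtr.
pose lam := (2 * sm)^-1.
have lam_bound : 0 <= lam <= 2^-1.
  by rewrite invr_ge0 mulr_ge0 /= ?lef_pV2 ?posrE; lra.
pose y k (j : 'I_M * 'I_4) : R := Re_turn j.2 (centred_atom D c k (grid M j.1)).
have [||||t [tm tD t_le]] :=
    @greedy_selection R int (freqs D) (fun k => normc (c k) / A) _ y lam _ _ _ _ lam_bound m.
- by move=> k _; rewrite divr_ge0 ?normc_ge0 // ltW.
- by rewrite -mulr_suml divff // gt_eqF.
- move=> k _ j; apply: le_trans (normr_Re_turn_le _ _) _; exact: normc_centred_atom_le1.
- move=> j; rewrite /y; under eq_bigr do rewrite -Re_turn_realM.
  by rewrite -Re_turn_sum mean_centred_atom // /Re_turn mulr0.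
exists t; split=> //; apply: (@le_trans _ _ (#|{: 'I_M * 'I_4}|%:R * (1 + 2 * lam ^+ 2) ^+ m)).
  apply: le_trans t_le; rewrite -(pair_bigA _ (fun j b => expR (lam * \sum_(k <- t) y k (j, b)))).
  apply: ler_sum => j _; set S := \sum_(k <- t) _; have [b Sb] := exists_Re_turn_ge_half S.
  rewrite (bigD1 b) //=; apply: ler_wpDr; first by apply: sumr_ge0 => b' _; exact: expR_ge0.
  rewrite ler_expR /y /= -Re_turn_sum -/S (_ : normc S / _ = lam * (normc S / 2)).
    by rewrite ler_wpM2l //; case/andP: lam_bound.
  by rewrite /lam -/sm; field; rewrite gt_eqF; lra.
rewrite card_prod !card_ord (_ : 2 * lam ^+ 2 = (2 * m%:R)^-1); last first.
  by rewrite exprVn exprMn sm2; field; rewrite pnatr_eq0 -lt0n.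
have := one_plus_inv_exp_le2 R m; have : (0 : R) <= M%:R by [].
by rewrite natrM; nra.
Qed.

Lemma sqr_le_expR (x : R) : 0 <= x -> x ^+ 2 <= 64 * expR (x / 4).
Proof.
move=> x0; have -> : x / 4 = x / 8 + x / 8 by lra.
rewrite expRD; have exp8 := expR_ge1Dx (x / 8).
have : (1 + x / 8) * (1 + x / 8) <= expR (x / 8) * expR (x / 8).
  by apply: ler_pM => //; lra.
nra.
Qed.

Lemma sqr_le_expR_tail (a B K : R) : 0 < B -> 0 <= K -> 4 * K * B < a ->
  a ^+ 2 <= (32 * B) ^+ 2 * expR (- (K / 4)) * expR (a / (8 * B)).
Proof.
move=> B0 K0 Ka; pose u := a / (4 * B).
have aE : a = 4 * B * u by rewrite /u; field; rewrite gt_eqF.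
have Ku : K < u by rewrite ltr_pdivlMr ?mulr_gt0 // mulrA [K * 4]mulrC.
rewrite aE (_ : 4 * B * u / (8 * B) = u / 2); last by field; rewrite gt_eqF.
rewrite (_ : (4 * B * u) ^+ 2 = 16 * B ^+ 2 * u ^+ 2); last by ring.
rewrite (_ : (32 * B) ^+ 2 * _ * _ = 16 * B ^+ 2 * (64 * expR (u / 2 - K / 4))); last first.
  by rewrite expRD; ring.
have B2 : 0 <= 16 * B ^+ 2 by rewrite pmulr_rge0 ?sqr_ge0.
rewrite ler_wpM2l //; apply: le_trans (sqr_le_expR _) _; first lra.
by rewrite ler_wpM2l // ler_expR; lra.
Qed.

(* Grid values above [4 K B] are rare; the part interpolating them has small
   energy, the rest is small in the sup norm. *)
Lemma split_large_values (D : nat) c (B K : R) : (0 < D)%N -> bandlimited D c -> 0 < B -> 0 <= K ->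
  \sum_(j < (4 * D).+1) expR (normc (trigpoly D c (grid (4 * D).+1 j)) / (8 * B)) <=
    8 * (4 * D).+1%:R ->
  exists d, [/\ bandlimited (2 * D) d,
    energy (2 * D) d <= 8 * (32 * B) ^+ 2 * expR (- (K / 4)) &
    forall x, normc (trigpoly (2 * D) (fun n => c n - d n) x) <= 12 * K * B].
Proof.
move=> D0 cD B0 K0; set M := (4 * D).+1 => potential; pose T := trigpoly D c.
pose small j := if normc (T (grid M j)) <= 4 * K * B then T (grid M j) else 0.
pose large j := T (grid M j) - small j.
have M0 : (0 : R) < M%:R by rewrite ltr0n.
pose a : R := (32 * B) ^+ 2 * expR (- (K / 4)).
have a0 : 0 <= a by rewrite mulr_ge0 ?sqr_ge0 ?expR_ge0.
have large_le j : normc (large j) ^+ 2 <= a * expR (normc (T (grid M j)) / (8 * B)).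
  rewrite /large /small; case: ifPn => [_|].
    by rewrite subrr normc0 expr0n mulr_ge0 ?expR_ge0.
  by rewrite -ltNge subr0 => KT; exact: sqr_le_expR_tail.
exists (fmult (vp_coef D) (dft M large)); split; first exact: bandlimited_fmult_vp.
  apply: (@le_trans _ _ (energy (2 * D) (dft M large))).
    apply: le_energy => n _; rewrite normcM normc_real ler_piMl ?normc_ge0 //.
    by rewrite ger0_norm ?vp_coef_ge0 // vp_coef_le1.
  rewrite -(ler_pM2l M0); apply: le_trans (energy_dft_le _ _) _; first by rewrite /M; lia.
  apply: (@le_trans _ _ (\sum_(j < M) a * expR (normc (T (grid M j)) / (8 * B)))).
    by apply: ler_sum => j _; exact: large_le.
  rewrite -mulr_sumr; apply: le_trans (ler_wpM2l a0 potential) _.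
  by rewrite (_ : a * _ = M%:R * (8 * (32 * B) ^+ 2 * expR (- (K / 4)))) // /a; ring.
move=> x; have -> : trigpoly (2 * D) (fun n => c n - fmult (vp_coef D) (dft M large) n) x =
    trigpoly (2 * D) (fmult (vp_coef D) (dft M small)) x.
  apply: eq_trigpoly => n nD; rewrite /fmult dftB dft_trigpoly //; last by rewrite /M; lia.
  have [nD'|nD'] := leqP `|n| D; first by rewrite vp_coef_eq1 // !mul1r; ring.
  by rewrite cD //; ring.
rewrite (_ : 12 * K * B = 3 * (4 * K * B)); last by ring.
apply: vp_interpolation_bounded => // j; rewrite /small; case: ifP => // _.
by rewrite normc0 !mulr_ge0 // ltW.
Qed.

End sampling_step.

Section sparse_approximation.
Variable R : realType.
Local Notation C := R[i].
Local Notation sqrt2 := (Num.sqrt 2 : R).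
Implicit Types (c d : int -> C) (N D : nat) (B rho : R).

Definition sparsely_approx N B c := exists (q : int -> C) (Th : seq int) (E : nat),
  [/\ (size Th <= N)%N, forall n, n \notin Th -> q n = 0, bandlimited E q, bandlimited E c &
      forall x, normc (trigpoly E (fun n => c n - q n) x) <= B].

Lemma sparsely_approxW N N' B B' c : (N <= N')%N -> B <= B' ->
  sparsely_approx N B c -> sparsely_approx N' B' c.
Proof.
move=> NN' BB' [q [Th [E [ThN qTh qE cE cB]]]]; exists q, Th, E.
by split=> // [|x]; [exact: leq_trans ThN NN'|exact: le_trans BB'].
Qed.

Lemma sparsely_approx_l1norm D c : bandlimited D c -> sparsely_approx 0 (l1norm D c) c.
Proof.
move=> cD; exists (fun=> 0), [::], D; split=> // x.
by rewrite (@eq_trigpoly _ _ _ c) ?normc_trigpoly_le // => n _; rewrite subr0.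
Qed.

Lemma sparsely_approxD N1 N2 B1 B2 c d :
  sparsely_approx N1 B1 c -> sparsely_approx N2 B2 d ->
  sparsely_approx (N1 + N2) (B1 + B2) (fun n => c n + d n).
Proof.
move=> [q1 [Th1 [E1 [Th1N q1Th q1E cE cB]]]] [q2 [Th2 [E2 [Th2N q2Th q2E dE dB]]]].
pose E := maxn E1 E2; have E1E : (E1 <= E)%N := leq_maxl E1 E2.
have E2E : (E2 <= E)%N := leq_maxr E1 E2.
exists (fun n => q1 n + q2 n), (Th1 ++ Th2), E; split.
- by rewrite size_cat leq_add.
- by move=> n; rewrite mem_cat negb_or => /andP[/q1Th -> /q2Th ->]; rewrite addr0.
- by move=> n nE; rewrite (bandlimitedW E1E q1E) // (bandlimitedW E2E q2E) // addr0.
- by move=> n nE; rewrite (bandlimitedW E1E cE) // (bandlimitedW E2E dE) // addr0.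
move=> x; have -> : trigpoly E (fun n => c n + d n - (q1 n + q2 n)) x =
    trigpoly E1 (fun n => c n - q1 n) x + trigpoly E2 (fun n => d n - q2 n) x.
  rewrite -(trigpoly_widen _ E1E) => [|n nE]; last by rewrite cE ?q1E ?subrr.
  rewrite -(trigpoly_widen _ E2E) => [|n nE]; last by rewrite dE ?q2E ?subrr.
  by rewrite -trigpolyD; apply: eq_trigpoly => n _; rewrite opprD addrACA.
by apply: le_trans (le_normcD _ _) _; exact: lerD.
Qed.

Lemma sparsely_approx_up_to_small_energy D m c (K : R) : let B := l1norm D c / Num.sqrt m%:R in
  (0 < D)%N -> (0 < m)%N -> bandlimited D c -> 0 <= K ->
  exists d, [/\ bandlimited (2 * D) d, energy (2 * D) d <= 8 * (32 * B) ^+ 2 * expR (- (K / 4)) &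
    sparsely_approx m (12 * K * B) (fun n => c n - d n)].
Proof.
move=> B D0 m0 cD K0; have sm0 : 0 < Num.sqrt m%:R :> R by rewrite sqrtr_gt0 ltr0n.
have B_ge0 : 0 <= B by rewrite divr_ge0 ?l1norm_ge0 // ltW.
have [A0|A_le0] := ltP 0 (l1norm D c); last first.
  have A0 : l1norm D c = 0 by apply/eqP; rewrite eq_le A_le0 l1norm_ge0.
  exists (fun=> 0); split=> //.
    rewrite /energy big1 => [|n _]; last by rewrite normc0 expr0n.
    by rewrite mulr_ge0 ?expR_ge0 // mulr_ge0 ?sqr_ge0.
  rewrite (_ : (fun n => c n - 0) = c); last by apply/funext => n; rewrite subr0.
  by apply: sparsely_approxW (sparsely_approx_l1norm cD) => //; rewrite A0 mulr_ge0 // mulr_ge0.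
have [t [tm tD potential]] := exists_sample (4 * D).+1 m0 A0.
pose e n := c n - sampled_coef D c t n.
have qD : bandlimited D (sampled_coef D c t).
  by move=> n nD; rewrite sampled_coef_eq0 //; apply: contraL nD => /tD; rewrite mem_freqs -leqNgt.
have eD : bandlimited D e by move=> n nD; rewrite /e cD ?qD ?subrr.
have B0 : 0 < B by rewrite divr_gt0.
have [|d [dD d_energy ed]] := split_large_values D0 eD B0 K0.
  apply: le_trans potential; rewrite le_eqVlt; apply/orP; left; apply/eqP.
  apply: eq_bigr => j _; rewrite trigpolyB_sampled_coef ?tm //.
  rewrite normcM normc_real ger0_norm ?divr_ge0 ?mulr_ge0 ?l1norm_ge0 //.
  rewrite /B -[in m%:R^-1](sqr_sqrtr (ler0n R m)); congr expR.
  by field; rewrite !gt_eqF.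
exists d; split=> //; exists (sampled_coef D c t), t, (2 * D)%N.
have DD : (D <= 2 * D)%N by rewrite leq_pmull.
split=> [||||x]; first by rewrite tm.
- by move=> n; exact: sampled_coef_eq0.
- exact: bandlimitedW DD qD.
- by move=> n nD; rewrite dD // (bandlimitedW DD cD) // subrr.
by rewrite (@eq_trigpoly _ _ _ (fun n => e n - d n)) // => n _; rewrite /e addrAC.
Qed.

Lemma sqrt2_ge1 : 1 <= sqrt2.
Proof. by rewrite -[leLHS]sqrtr1 ler_wsqrtr // ler1n. Qed.

Lemma sqr_sqrt2 : sqrt2 ^+ 2 = 2.
Proof. by rewrite sqr_sqrtr. Qed.

Lemma sqrt2X_ge1 n : 1 <= sqrt2 ^+ n.
Proof. by rewrite exprn_ege1 // sqrt2_ge1. Qed.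

Lemma sqrt2X_gt0 n : 0 < sqrt2 ^+ n.
Proof. exact: lt_le_trans ltr01 (sqrt2X_ge1 n). Qed.

Lemma sqr_sqrt2X n : (sqrt2 ^+ n) ^+ 2 = (2 ^ n)%:R.
Proof. by rewrite exprAC sqr_sqrt2 natrX. Qed.

Lemma sqrt_natX2 n : Num.sqrt (2 ^ n)%:R = sqrt2 ^+ n.
Proof. by rewrite -sqr_sqrt2X sqrtr_sqr gtr0_norm // sqrt2X_gt0. Qed.

Lemma l1norm_le_energy (u : nat) c rho : 0 <= rho -> energy (2 ^ u) c <= rho ^+ 2 ->
  l1norm (2 ^ u) c <= 2 * sqrt2 ^+ u * rho.
Proof.
move=> rho0 c_rho; have t0 := ltW (sqrt2X_gt0 u).
rewrite -(ler_pXn2r (n := 2)) ?nnegrE ?l1norm_ge0 ?mulr_ge0 //.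
apply: le_trans (sqr_l1norm_le _ _) _; rewrite exprMn ler_pM ?energy_ge0 //.
rewrite exprMn sqr_sqrt2X -natrX -natrM ler_nat.
by have := expn_gt0 2 u; lia.
Qed.

Lemma sqrt2X_mul_expRN_le (v : nat) : sqrt2 ^+ v * expR (- (12 * (1 + v%:R))) <= 64 ^- 2.
Proof.
have expN1_le : expR (- 1) <= (2^-1 : R).
  rewrite expRN lef_pV2 ?posrE ?expR_gt0 //.
  by have := expR_ge1Dx (1 : R); lra.
have -> : - (12 * (1 + v%:R)) = (12 * v.+1)%N%:R * - 1 :> R.
  by rewrite natrM -(natr1 v); ring.
rewrite expRM_natl exprM; set a := _ ^+ 12.
have a0 : 0 <= a by rewrite exprn_ge0 ?expR_ge0.
have a1 : a <= 64 ^- 2.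
  apply: le_trans (_ : 2^-1 ^+ 12 <= _); last by lra.
  by apply: lerXn2r; rewrite ?nnegrE ?expR_ge0.
have sqrt2_ge := sqrt2_ge1; have sqrt2_le2 : sqrt2 <= 2.
  by have := sqr_sqrt2; move: (sqrt2) sqrt2_ge => y; nra.
rewrite exprSr mulrA -exprMn -[leRHS]mul1r.
apply: ler_pM => //; first by rewrite exprn_ge0 // mulr_ge0 ?sqrtr_ge0.
by rewrite exprn_ile1 ?mulr_ge0 ?sqrtr_ge0 //; move: (sqrt2) sqrt2_ge sqrt2_le2 => y; nra.
Qed.

Definition level_size (u v : nat) : nat := if (v <= u)%N then (2 ^ (u.+1 - v))%N else 0.

Lemma level_size_rec u v : (v <= u)%N ->
  (2 ^ (u - v) + level_size u.+1 v.+2 <= level_size u v)%N.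
Proof.
move=> vu; rewrite /level_size vu [(u.+1 - v)%N]subSn // expnS mul2n -addnn leq_add2l.
by case: ifP => // vu2; rewrite leq_exp2l //; lia.
Qed.

Definition sparse_error (v : nat) rho : R := 64 ^+ 2 * (1 + v%:R) * sqrt2 ^+ v * rho.

Lemma sparse_error_ge0 (v : nat) rho : 0 <= rho -> 0 <= sparse_error v rho.
Proof. by move=> rho0; apply: mulr_ge0. Qed.

Lemma sparse_error_rec (v : nat) rho : 0 <= rho ->
  12 * (96 * (1 + v%:R)) * (2 * sqrt2 ^+ v * rho) +
  sparse_error v.+2 (16 ^+ 2 * sqrt2 ^+ v * expR (- (12 * (1 + v%:R))) * rho) <= sparse_error v rho.
Proof.
move=> rho0; pose z := sqrt2 ^+ v * rho; pose e := sqrt2 ^+ v * expR (- (12 * (1 + v%:R))).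
have z0 : 0 <= z by rewrite mulr_ge0 // ltW // sqrt2X_gt0.
have v0 : (0 : R) <= v%:R by [].
have ez : (3 + v%:R) * (e * z) <= (3 + v%:R) * (64 ^- 2 * z).
  by rewrite ler_wpM2l ?addr_ge0 // ler_wpM2r // sqrt2X_mul_expRN_le.
have -> : sparse_error v.+2 (16 ^+ 2 * sqrt2 ^+ v * expR (- (12 * (1 + v%:R))) * rho) =
    64 ^+ 2 * 512 * (3 + v%:R) * (e * z).
  by rewrite /sparse_error -[v.+2]addn2 natrD exprD sqr_sqrt2 /e /z; ring.
rewrite (_ : 12 * _ * _ = 2304 * (1 + v%:R) * z); last by rewrite /z; ring.
rewrite (_ : sparse_error v rho = 64 ^+ 2 * (1 + v%:R) * z); last by rewrite /sparse_error /z; ring.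
by have := mulr_ge0 v0 z0; lra.
Qed.

Lemma sampling_energy_decay (v : nat) B rho : 0 <= B -> B <= 2 * sqrt2 ^+ v * rho ->
  8 * (32 * B) ^+ 2 * expR (- (96 * (1 + v%:R) / 4)) <=
  (16 ^+ 2 * sqrt2 ^+ v * expR (- (12 * (1 + v%:R))) * rho) ^+ 2.
Proof.
move=> B0 Brho; pose e : R := expR (- (12 * (1 + v%:R))).
have -> : - (96 * (1 + v%:R) / 4) = - (12 * (1 + v%:R)) + - (12 * (1 + v%:R)) :> R by lra.
rewrite expRD -/e.
have -> : (16 ^+ 2 * sqrt2 ^+ v * e * rho) ^+ 2 =
    128 ^+ 2 * (2 * sqrt2 ^+ v * rho) ^+ 2 * (e * e) by ring.
rewrite ler_wpM2r ?mulr_ge0 ?expR_ge0 //.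
have : B ^+ 2 <= (2 * sqrt2 ^+ v * rho) ^+ 2.
  by apply: lerXn2r; rewrite ?nnegrE //; exact: le_trans Brho.
by have := sqr_ge0 B; lra.
Qed.

Lemma sparse_error_ge_l1norm (u v : nat) c rho : (u < v)%N -> 0 <= rho ->
  energy (2 ^ u) c <= rho ^+ 2 -> l1norm (2 ^ u) c <= sparse_error v rho.
Proof.
move=> uv rho0 c_rho; apply: le_trans (l1norm_le_energy rho0 c_rho) _.
rewrite ler_wpM2r //; apply: ler_pM; rewrite ?(ltW (sqrt2X_gt0 _)) //.
  by have : (0 : R) <= v%:R by []; lra.
by rewrite ler_weXn2l ?sqrt2_ge1 // ltnW.
Qed.

(* The large values left over by the sampling step form a polynomial of twice the
   degree but much smaller energy, to which the statement applies again with half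
   as many terms. *)
Lemma sparsely_approx_energy (u v : nat) c rho :
  bandlimited (2 ^ u) c -> 0 <= rho -> energy (2 ^ u) c <= rho ^+ 2 ->
  sparsely_approx (level_size u v) (sparse_error v rho) c.
Proof.
have [w] := ubnP (u.+1 - v); elim: w u v c rho => // w ih u v c rho uvw cu rho0 c_rho.
have [vu|uv] := leqP v u; last first.
  apply: sparsely_approxW (sparsely_approx_l1norm cu) => //.
  exact: sparse_error_ge_l1norm.
have K0 : (0 : R) <= 96 * (1 + v%:R) by rewrite mulr_ge0 ?addr_ge0.
have [d [du d_energy cd]] :=
  sparsely_approx_up_to_small_energy (expn_gt0 2 u) (expn_gt0 2 (u - v)) cu K0.
rewrite sqrt_natX2 -expnS in du d_energy cd; set B := l1norm _ c / _ in d_energy cd.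
have B0 : 0 <= B by rewrite divr_ge0 ?l1norm_ge0 // ltW ?sqrt2X_gt0.
have Brho : B <= 2 * sqrt2 ^+ v * rho.
  rewrite ler_pdivrMr ?sqrt2X_gt0 //; apply: le_trans (l1norm_le_energy rho0 c_rho) _.
  by rewrite -{1}(subnKC vu) exprD mulrA mulrAC.
pose rho' := 16 ^+ 2 * sqrt2 ^+ v * expR (- (12 * (1 + v%:R))) * rho.
have rho'0 : 0 <= rho'.
  by rewrite mulr_ge0 // mulr_ge0 ?expR_ge0 // mulr_ge0 ?sqr_ge0 // ltW // sqrt2X_gt0.
have d_approx : sparsely_approx (level_size u.+1 v.+2) (sparse_error v.+2 rho') d.
  apply: ih du rho'0 _; first by lia.
  exact: le_trans d_energy (sampling_energy_decay B0 Brho).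
rewrite (_ : c = fun n => c n - d n + d n); last by apply/funext => n; rewrite subrK.
apply: sparsely_approxW (sparsely_approxD cd d_approx); first exact: level_size_rec.
by apply: le_trans (sparse_error_rec v rho0); rewrite lerD2r ler_wpM2l // mulr_ge0.
Qed.

End sparse_approximation.

(** * Dyadic blocks *)

Section dyadic_multipliers.
Variable R : realType.
Local Notation C := R[i].
Implicit Types (s u D : nat) (n : int) (c : int -> C) (B : R).

Definition sigma_coef s n : R :=
  if s is s'.+1 then vp_coef (2 ^ s) n - vp_coef (2 ^ s') n else vp_coef 1 n.

Lemma sigma_coef_eq0_low s n : (`|n| <= 2 ^ s)%N -> sigma_coef s.+1 n = 0.
Proof.
move=> ns; rewrite /sigma_coef !vp_coef_eq1 ?subrr ?expn_gt0 //.
by rewrite (leq_trans ns) // leq_exp2l.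
Qed.

Lemma sigma_coef_eq0_high s n : (2 ^ s.+1 <= `|n|)%N -> sigma_coef s n = 0.
Proof.
case: s => [|s] ns; rewrite /sigma_coef; first by rewrite vp_coef_eq0.
by rewrite !vp_coef_eq0 ?subrr // -?expnS // (leq_trans _ ns) // leq_exp2l.
Qed.

Lemma sum_sigma_coef N n : \sum_(s < N.+1) sigma_coef s n = vp_coef (2 ^ N) n.
Proof.
elim: N => [|N ih]; first by rewrite big_ord_recr /= big_ord0 add0r.
by rewrite big_ord_recr /= ih addrC subrK.
Qed.

Lemma normr_sigma_coef_le1 s n : `|sigma_coef s n| <= 1.
Proof.
have coef0 := @vp_coef_ge0 R; have coef1 := @vp_coef_le1 R.
case: s => [|s]; rewrite /sigma_coef; first by rewrite ger0_norm.
have := coef0 (2 ^ s.+1)%N n; have := coef1 (2 ^ s.+1)%N n.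
have := coef0 (2 ^ s)%N n; have := coef1 (2 ^ s)%N n.
by move=> *; rewrite ler_norml; apply/andP; split; lra.
Qed.

Lemma sigma_coef_ge_half s n : (2 ^ s.+1 <= `|n| <= 2 ^ s.+1 + 2 ^ s)%N ->
  2^-1 <= sigma_coef s.+1 n.
Proof.
move=> /andP[n1 n2]; rewrite /= (@vp_coef_eq0 _ (2 ^ s)) ?subr0; last by rewrite -expnS.
by apply: vp_coef_ge_half; rewrite ?expn_gt0 //; move: n2; rewrite expnS; lia.
Qed.

Lemma bandlimited_fmult_sigma s c : bandlimited (2 ^ s.+1) (fmult (sigma_coef s) c).
Proof. by move=> n ns; rewrite /fmult sigma_coef_eq0_high ?mul0r // ltnW. Qed.

Lemma fmult_sigma_bounded s D c B : bandlimited D c ->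
  (forall x, normc (trigpoly D c x) <= B) ->
  forall x, normc (trigpoly D (fmult (sigma_coef s) c) x) <= 6 * B.
Proof.
move=> cD cB x; have B0 : 0 <= B := le_trans (normc_ge0 _) (cB 0).
case: s => [|s]; last by apply: fmult_vpB_bounded; rewrite ?expn_gt0.
by apply: le_trans (fmult_vp_bounded (ltnSn 0) cD cB x) _; lra.
Qed.

Lemma eq_sum_sigma_coef N (F : int -> C) n : (`|n| <= 2 ^ N)%N ->
  F n = \sum_(0 <= u < N.+1) fmult (sigma_coef u) F n.
Proof.
move=> nN; rewrite -mulr_suml big_mkord -(rmorph_sum (real_complex R)) sum_sigma_coef.
by rewrite vp_coef_eq1 ?mul1r ?expn_gt0.
Qed.

Definition sigma_cover u n : R := vp_coef (2 ^ u.+1) n - vp_coef (2 ^ (u - 2)) n.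

Lemma sigma_cover_eq0_high u n : (2 ^ u.+2 <= `|n|)%N -> sigma_cover u n = 0.
Proof.
move=> nu; rewrite /sigma_cover !vp_coef_eq0 ?subrr // -expnS // (leq_trans _ nu) //.
by rewrite leq_exp2l //; lia.
Qed.

Lemma sigma_cover_eq0_low u n : (`|n| <= 2 ^ (u - 2))%N -> sigma_cover u n = 0.
Proof.
move=> nu; rewrite /sigma_cover !vp_coef_eq1 ?subrr ?expn_gt0 // (leq_trans nu) //.
by rewrite leq_exp2l //; lia.
Qed.

Lemma sigma_cover_mul u n : (1 < u)%N -> sigma_cover u n * sigma_coef u n = sigma_coef u n.
Proof.
case: u => [//|[//|u]] _; have [nu|nu] := leqP `|n| (2 ^ u.+1).
  by rewrite sigma_coef_eq0_low // mulr0.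
have [nu3|nu3] := leqP (2 ^ u.+3) `|n|; first by rewrite sigma_coef_eq0_high // mulr0.
rewrite /sigma_cover vp_coef_eq1 ?expn_gt0 ?(ltnW nu3) // vp_coef_eq0 ?subr0 ?mul1r //.
by rewrite -expnS !subSS subn0 ltnW.
Qed.

Lemma fmult_sigma_cover_bounded u D c B : bandlimited D c ->
  (forall x, normc (trigpoly D c x) <= B) ->
  forall x, normc (trigpoly D (fmult (sigma_cover u) c) x) <= 6 * B.
Proof. by apply: fmult_vpB_bounded; rewrite expn_gt0. Qed.

Definition near_block s u : bool := (u < s + 3)%N && (s < u + 3)%N.

Lemma sigma_coef_mul_cover_eq0 s u n : ~~ near_block s u ->
  sigma_coef s n * sigma_cover u n = 0.
Proof.
rewrite negb_and -!leqNgt => /orP[us|su].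
  have [ns|ns] := leqP (2 ^ s.+1) `|n|; first by rewrite sigma_coef_eq0_high // mul0r.
  by rewrite sigma_cover_eq0_low ?mulr0 // ltnW // (leq_trans ns) // leq_exp2l //; lia.
have [nu|nu] := leqP (2 ^ u.+2) `|n|; first by rewrite sigma_cover_eq0_high // mulr0.
have -> : s = s.-1.+1 by lia.
by rewrite sigma_coef_eq0_low ?mul0r // ltnW // (leq_trans nu) // leq_exp2l //; lia.
Qed.

Lemma sum_near_block_le (N a b : nat) (e : nat -> R) : (forall u, 0 <= e u) ->
  \sum_(s < N) \sum_(a <= u < b | near_block s u) e u <= 5 * \sum_(a <= u < b) e u.
Proof.
move=> e0; rewrite -(big_mkord predT (fun s => \sum_(a <= u < b | near_block s u) e u)) /=.
rewrite (exchange_big_dep predT) //= mulr_sumr; apply: ler_sum => u _.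
rewrite -big_filter big_const_seq count_predT iter_addr_0 -[leLHS]mulr_natl ler_wpM2r //.
rewrite ler_nat -[5%N](size_iota (u - 2)); apply: uniq_leq_size.
  by rewrite filter_uniq // iota_uniq.
by move=> s'; rewrite mem_filter mem_iota mem_index_iota /near_block; lia.
Qed.

End dyadic_multipliers.

Arguments sigma_coef {R} s n.
Arguments sigma_cover {R} u n.

Section dyadic_approximant.
Variable R : realType.
Local Notation C := R[i].
Variables (F : int -> C) (n S : nat) (q : nat -> int -> C).
Hypotheses (n1 : (1 < n)%N) (nS : (n < S)%N).
Hypothesis q_eq0 : forall u j, (S <= u)%N -> q u j = 0.

Definition dyadic_approximant (j : int) : C :=
  \sum_(0 <= u < n.+1) fmult (sigma_coef u) F j +
  \sum_(n.+1 <= u < S) fmult (sigma_cover u) (q u) j.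

Definition block_residual (u : nat) (j : int) : C := fmult (sigma_coef u) F j - q u j.

Lemma bandlimited_dyadic_approximant : bandlimited (2 ^ S.+2) dyadic_approximant.
Proof.
move=> j jS; rewrite /dyadic_approximant !big1_seq ?addr0 // => u /andP[_].
  rewrite mem_index_iota => /andP[_ uS]; rewrite /fmult sigma_cover_eq0_high ?mul0r //.
  by rewrite (leq_trans _ (ltnW jS)) // leq_exp2l // !ltnS ltnW.
rewrite mem_index_iota => /andP[_ un]; rewrite /fmult sigma_coef_eq0_high ?mul0r //.
by rewrite (leq_trans _ (ltnW jS)) // leq_exp2l //; lia.
Qed.

Lemma dyadic_approximant_support (Th : nat -> seq int) :
  (forall u j, j \notin Th u -> q u j = 0) ->
  forall j, j \notin freqs (2 ^ n.+1) ++ flatten [seq Th u | u <- index_iota n.+1 S] ->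
  dyadic_approximant j = 0.
Proof.
move=> qTh j; rewrite mem_cat negb_or mem_freqs -ltnNge => /andP[jn jTh].
rewrite /dyadic_approximant !big1_seq ?addr0 // => u /andP[_ uS].
  rewrite /fmult qTh ?mulr0 //; apply: contra jTh => jTh.
  by apply/flattenP; exists (Th u) => //; apply/mapP; exists u.
move: uS; rewrite mem_index_iota => /andP[_ un].
by rewrite /fmult sigma_coef_eq0_high ?mul0r // (leq_trans _ (ltnW jn)) // leq_exp2l.
Qed.

Lemma dyadic_approximant_residual (U : nat) (j : int) : (S <= U)%N -> (`|j| <= 2 ^ U)%N ->
  F j - dyadic_approximant j =
  \sum_(n.+1 <= u < U.+1) fmult (sigma_cover u) (block_residual u) j.
Proof.
move=> SU jU; rewrite {1}(eq_sum_sigma_coef F jU) /dyadic_approximant.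
rewrite (big_cat_nat _ (n := n.+1)) //=; last by rewrite ltnS; lia.
rewrite opprD addrACA subrr add0r.
have -> : \sum_(n.+1 <= u < S) fmult (sigma_cover u) (q u) j =
    \sum_(n.+1 <= u < U.+1) fmult (sigma_cover u) (q u) j.
  rewrite [RHS](big_cat_nat _ (n := S)) ?(leqW SU) //= [X in _ = _ + X]big1_seq ?addr0 //.
  by move=> u /andP[_]; rewrite mem_index_iota /fmult => /andP[/q_eq0 -> _]; rewrite mulr0.
rewrite -sumrB; apply: eq_big_nat => u /andP[nu _].
rewrite /fmult /block_residual mulrBr mulrA -rmorphM /= sigma_cover_mul //.
exact: ltn_trans nu.
Qed.

Lemma sigma_block_residual (s U : nat) (j : int) : (s + 3 <= U)%N ->
  fmult (sigma_coef s) (fun j => F j - dyadic_approximant j) j =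
  \sum_(n.+1 <= u < U | near_block s u)
    fmult (sigma_coef s) (fmult (sigma_cover u) (block_residual u)) j.
Proof.
move=> sU; pose term u := fmult (sigma_coef s) (fmult (sigma_cover u) (block_residual u)) j.
have far_eq0 u : ~~ near_block s u -> term u = 0.
  by move=> su; rewrite /term /fmult mulrA -rmorphM /= sigma_coef_mul_cover_eq0 ?mul0r.
have [sj0|sj] := eqVneq (sigma_coef s j : R) 0.
  by rewrite /fmult sj0 mul0r big1 // => u _; rewrite mul0r.
have js : (`|j| <= 2 ^ s.+1)%N.
  by rewrite leqNgt; apply: contra sj => /ltnW/sigma_coef_eq0_high ->.
pose V := maxn S U; rewrite {1}/fmult (@dyadic_approximant_residual V) ?leq_maxl //; last first.
  by apply: leq_trans js _; rewrite leq_exp2l //; lia.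
rewrite mulr_sumr (bigID (near_block s)) /= [X in _ + X]big1 ?addr0 => [|u /far_eq0 //].
have [Un|nU] := leqP U n.+1.
  rewrite [RHS]big_geq // big1_seq // => u /andP[su].
  by rewrite mem_index_iota; move: su; rewrite /near_block; lia.
rewrite (big_cat_nat _ (n := U)) ?(ltnW nU) ?leqW ?leq_maxr //= [X in _ + X]big1_seq ?addr0 //.
by move=> u /andP[su]; rewrite mem_index_iota; move: su; rewrite /near_block; lia.
Qed.

Lemma sigma_block_residual_bounded (E : nat -> nat) (e : nat -> R) :
  (forall u, bandlimited (E u) (block_residual u)) ->
  (forall u x, normc (trigpoly (E u) (block_residual u) x) <= e u) ->
  forall s U x, (s + 3 <= U)%N ->
  normc (trigpoly (2 ^ s.+1) (fmult (sigma_coef s) (fun j => F j - dyadic_approximant j)) x) <=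
  \sum_(n.+1 <= u < U | near_block s u) 36 * e u.
Proof.
move=> resE res_e s U x sU.
have -> : trigpoly (2 ^ s.+1) (fmult (sigma_coef s) (fun j => F j - dyadic_approximant j)) x =
    \sum_(n.+1 <= u < U | near_block s u)
      trigpoly (2 ^ s.+1) (fmult (sigma_coef s) (fmult (sigma_cover u) (block_residual u))) x.
  rewrite /trigpoly exchange_big /=; apply: eq_bigr => j _.
  by rewrite (@sigma_block_residual s U) // mulr_suml.
apply: le_trans (normc_sum _ _ _) _; apply: ler_sum => u _.
have coverE : bandlimited (E u) (fmult (sigma_cover u) (block_residual u)).
  by move=> j jE; rewrite /fmult resE ?mulr0.
rewrite (@trigpoly_band _ _ (E u)); last 2 first.
- exact: bandlimited_fmult_sigma.
- by move=> j jE; rewrite /fmult resE ?mulr0.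
rewrite (_ : 36 * e u = 6 * (6 * e u)); last by ring.
by apply: fmult_sigma_bounded => //; exact: fmult_sigma_cover_bounded.
Qed.

End dyadic_approximant.

Section sparse_dyadic_approximation.
Variable R : realType.
Local Notation C := R[i].

Lemma sparse_dyadic_approx (F : int -> C) (a : nat -> R) (v : nat -> nat) (n S : nat) :
  (1 < n)%N -> (n < S)%N -> (forall u, (S <= u)%N -> (u.+1 < v u)%N) ->
  (forall u, 0 <= a u) ->
  (forall u, energy (2 ^ u.+1) (fmult (sigma_coef u) F) <= a u ^+ 2) ->
  exists (Q : int -> C) (Th : seq int) (E : nat),
  [/\ bandlimited E Q, forall j, j \notin Th -> Q j = 0,
    (size Th <= (2 ^ n.+2).+1 + \sum_(n.+1 <= u < S) level_size u.+1 (v u))%N &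
    forall s U x, (s + 3 <= U)%N ->
      normc (trigpoly (2 ^ s.+1) (fmult (sigma_coef s) (fun j => F j - Q j)) x) <=
      \sum_(n.+1 <= u < U | near_block s u) 36 * sparse_error (v u) (a u)].
Proof.
move=> n1 nS vS a0 Fa.
have block_approx u : sparsely_approx (level_size u.+1 (v u)) (sparse_error (v u) (a u))
    (fmult (sigma_coef u) F).
  by apply: sparsely_approx_energy => //; exact: bandlimited_fmult_sigma.
have [q /choice[Th /choice[E qThE]]] := choice block_approx.
have q_eq0 u j : (S <= u)%N -> q u j = 0.
  move=> Su; have [size_Th qTh _ _ _] := qThE u; apply: qTh; move: size_Th.
  by rewrite /level_size ifN -?ltnNge ?vS // leqn0 => /nilP ->.
exists (dyadic_approximant F n S q).
exists (freqs (2 ^ n.+1) ++ flatten [seq Th u | u <- index_iota n.+1 S]), (2 ^ S.+2)%N; split.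
- exact: bandlimited_dyadic_approximant.
- by apply: dyadic_approximant_support => u; have [] := qThE u.
- rewrite size_cat size_freqs -expnS leq_add2l size_flatten sumnE !big_map.
  by apply: leq_sum => u _; have [] := qThE u.
move=> s U x sU; apply: (sigma_block_residual_bounded n1 nS q_eq0 (E := E)) sU => u.
  by have [_ _ qE cE _] := qThE u => j jE; rewrite /block_residual cE ?qE ?subrr.
by have [] := qThE u.
Qed.

Definition block_level (q n u : nat) : nat := (u - n + (u - n) %/ q)%N.

Lemma block_level_gt (q n u : nat) : (0 < q)%N -> (n + q * n.+2 <= u)%N ->
  (u.+1 < block_level q n u)%N.
Proof.
move=> q0 nu; have : (n.+2 <= (u - n) %/ q)%N by rewrite leq_divRL // mulnC; lia.
by rewrite /block_level; lia.
Qed.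

Lemma sum_nat_divn (q J : nat) (G : nat -> nat) : (0 < q)%N ->
  (\sum_(0 <= d < q * J) G (d %/ q) = q * \sum_(0 <= i < J) G i)%N.
Proof.
move=> q0; elim: J => [|J ih]; first by rewrite muln0 !big_geq ?muln0.
rewrite (big_cat_nat _ (n := (q * J)%N)) //=; last by rewrite leq_mul2l leqnSn orbT.
rewrite ih big_nat_recr //= mulnDr; congr addn.
rewrite -{1}[(q * J)%N]add0n big_addn mulnS addnK.
rewrite (eq_big_nat _ _ (F2 := fun=> G J)) ?sum_nat_const_nat ?subn0 // => d /andP[_ dq].
by rewrite mulnC divnDMl ?divn_small ?add0n.
Qed.

Lemma sum_expn2_le (J K : nat) : (J <= K.+1)%N ->
  (\sum_(0 <= i < J) 2 ^ (K - i) <= 2 ^ K.+1)%N.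
Proof.
move=> JK; suff : (\sum_(0 <= i < J) 2 ^ (K - i) + 2 ^ (K.+1 - J) = 2 ^ K.+1)%N by lia.
elim: J JK => [|J ih] JK; first by rewrite big_geq.
rewrite big_nat_recr //= -(ih (ltnW JK)) subSS -addnA; congr addn.
by rewrite subSn ?expnS; lia.
Qed.

Lemma sum_level_size_le (q n : nat) : (0 < q)%N ->
  (\sum_(n <= u < n + q * n.+2) level_size u.+1 (block_level q n u) <= q * 2 ^ n.+3)%N.
Proof.
move=> q0; rewrite -{1}[n]add0n big_addn addKn.
apply: (@leq_trans (\sum_(0 <= d < q * n.+2) 2 ^ (n.+2 - d %/ q))%N).
  rewrite big_nat [leqRHS]big_nat; apply: leq_sum => d _.
  rewrite /level_size /block_level addnK.
  by case: ifP => // d_le; rewrite leq_exp2l //; lia.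
rewrite (sum_nat_divn n.+2 (fun i => 2 ^ (n.+2 - i))%N q0) leq_mul2l.
by rewrite sum_expn2_le ?orbT.
Qed.

End sparse_dyadic_approximation.

(** * Lebesgue norms *)

Section real_powers.
Variable R : realType.
Implicit Types (x r s : R).

Lemma powRD_gt0 x r s : 0 < x -> x `^ (r + s) = x `^ r * x `^ s.
Proof. by move=> x0; rewrite powRD // (gt_eqF x0) implybT. Qed.

Lemma powRK x r : 0 <= x -> r != 0 -> (x `^ r) `^ r^-1 = x.
Proof. by move=> x0 r0; rewrite -powRrM divff // powRr1. Qed.

Lemma powR2_nat (n : nat) : (2 : R) `^ n%:R = (2 ^ n)%:R.
Proof. by rewrite powR_mulrn // natrX. Qed.

Lemma powR2_bounds x : x < 0 -> 0 < (2 : R) `^ x < 1.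
Proof.
move=> x0; rewrite powR_gt0 //= /powR pnatr_eq0 /= expR_lt1.
by rewrite nmulr_rlt0 // ln_gt0 ?ltr1n.
Qed.

Lemma sqrt2X_powR (n : nat) : Num.sqrt 2 ^+ n = (2 : R) `^ (n%:R / 2).
Proof. by rewrite -powR12_sqrt // -powR_mulrn ?powR_ge0 // -powRrM mulrC. Qed.

Lemma le_poweR (u v : \bar R) r : 0 <= r -> (0 <= u -> u <= v -> u `^ r <= v `^ r)%E.
Proof.
move=> r0 u0 uv; apply: gt0_ler_poweR => //; rewrite in_itv /= leey andbT //.
exact: le_trans uv.
Qed.

Lemma poweRK (u : \bar R) r : (0 <= u)%E -> r != 0 -> ((u `^ r^-1) `^ r = u)%E.
Proof. by move=> u0 r0; rewrite -poweRrM mulVf // poweRe1. Qed.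

End real_powers.

Section Lnorm_inequalities.
Context d (T : measurableType d) (R : realType) (mu : {measure set T -> \bar R}).
Implicit Types (p : \bar R) (r s a : R) (f g : T -> R).

Lemma measurable_normr_powR f r : measurable_fun [set: T] f ->
  measurable_fun [set: T] (fun x => (`|f x| `^ r)%:E).
Proof.
move=> mf; apply/measurable_EFinP; apply: (measurableT_comp (measurable_powR r)).
exact: measurableT_comp.
Qed.

Lemma Lnorm_EFinE r f :
  Lnorm mu r%:E (EFin \o f) = ((\int[mu]_x (`|f x| `^ r)%:E) `^ r^-1)%E.
Proof. by rewrite unlock. Qed.

Lemma integral_powR_ge0 f r : (0 <= \int[mu]_x (`|f x| `^ r)%:E)%E.
Proof. by apply: integral_ge0 => x _; rewrite lee_fin powR_ge0. Qed.

Lemma Lnorm_le_integral r f (W : \bar R) : 0 < r -> (0 <= W)%E ->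
  (\int[mu]_x (`|f x| `^ r)%:E <= W `^ r)%E -> (Lnorm mu r%:E (EFin \o f) <= W)%E.
Proof.
move=> r0 W0 fW; rewrite Lnorm_EFinE -[leRHS](poweRK W0 (invr_neq0 (lt0r_neq0 r0))) invrK.
by rewrite le_poweR ?invr_ge0 ?(ltW r0) ?integral_powR_ge0.
Qed.

Lemma integral_powR_Lnorm r f : r != 0 ->
  (\int[mu]_x (`|f x| `^ r)%:E = Lnorm mu r%:E (EFin \o f) `^ r)%E.
Proof. by move=> r0; rewrite Lnorm_EFinE poweRK ?integral_powR_ge0. Qed.

Lemma Lnorm_pZl p a f : (1 <= p)%E -> 0 <= a -> measurable_fun [set: T] f ->
  (0 < mu setT)%E ->
  (Lnorm mu p (EFin \o (fun x => (a * f x)%R)) = a%:E * Lnorm mu p (EFin \o f))%E.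
Proof.
move=> p1 a0 mf mu0; case: p p1 => [r| |//]; last first.
  move=> _; rewrite unlock mu0 -ess_supZl //; congr ess_sup; apply/funext => x /=.
  by rewrite normrM ger0_norm.
rewrite lee_fin => r1; have r0 : 0 < r by exact: lt_le_trans r1.
rewrite !Lnorm_EFinE; under eq_integral do rewrite normrM ger0_norm // powRM // EFinM.
rewrite ge0_integralZl ?lee_fin ?powR_ge0 //; last exact: measurable_normr_powR.
rewrite poweRM ?lee_fin ?powR_ge0 ?integral_powR_ge0 //.
by rewrite poweR_EFin powRK // gt_eqF.
Qed.

Lemma Lnorm_bounded_interpolation p a (B : R) f : 0 < a -> (a%:E <= p)%E ->
  0 < B -> measurable_fun [set: T] f -> (forall x, `|f x| <= B) ->
  (Lnorm mu p (EFin \o f) <=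
   (B `^ (1 - a * einv p))%:E * (Lnorm mu a%:E (EFin \o f) `^ (a * einv p)))%E.
Proof.
move=> a0 ap B0 mf fB; case: p ap => [r| |//]; last first.
  move=> _; rewrite /= mulr0 subr0 powRr1 ?(ltW B0) // poweRe0 mule1 unlock.
  case: ifP => _; last by rewrite lee_fin ltW.
  by apply/ess_supP; apply: nearW => x; rewrite /= lee_fin.
rewrite lee_fin /= => ar; have r0 : 0 < r by exact: lt_le_trans ar.
apply: Lnorm_le_integral => //; first by rewrite mule_ge0 ?lee_fin ?powR_ge0 ?poweR_ge0.
rewrite poweRM ?lee_fin ?powR_ge0 ?poweR_ge0 // poweR_EFin -powRrM -poweRrM.
rewrite mulrBl mul1r divfK ?gt_eqF // -integral_powR_Lnorm ?gt_eqF //.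
have ma := measurable_normr_powR a mf.
rewrite -ge0_integralZl ?lee_fin ?powR_ge0 //.
apply: ge0_le_integral => //.
- exact: measurable_normr_powR.
- exact: measurable_funeM.
move=> x _; rewrite -EFinM lee_fin.
have [->|fx0] := eqVneq `|f x| 0; first by rewrite powR0 ?gt_eqF // mulr_ge0 ?powR_ge0.
rewrite -{1}(subrK a r) powRD_gt0; last by rewrite lt_neqAle eq_sym fx0 /=.
by rewrite ler_wpM2r ?powR_ge0 // ge0_ler_powR ?subr_ge0 ?nnegrE ?(ltW B0).
Qed.

Lemma Lnorm1M_bounded_le (B : R) f g : 0 < B -> measurable_fun [set: T] f ->
  measurable_fun [set: T] g -> (forall x, `|g x| <= B) ->
  (Lnorm mu 1 (EFin \o (f \* g)%R) <= B%:E * Lnorm mu 1 (EFin \o f))%E.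
Proof.
move=> B0 mf mg gB; rewrite !Lnorm1; have mfE : measurable_fun [set: T] (fun x => (`|f x|)%:E).
  by apply/measurable_EFinP; exact: measurableT_comp.
rewrite -ge0_integralZl ?lee_fin ?(ltW B0) //; apply: ge0_le_integral => //.
- by apply/measurable_EFinP; apply: measurableT_comp => //; exact: measurable_funM.
- exact: measurable_funeM.
by move=> x _; rewrite /= -EFinM lee_fin normrM mulrC ler_wpM2r.
Qed.

Lemma Lnorm1M_le_interpolation (r B : R) f g : 1 <= r <= 2 -> 0 < B ->
  measurable_fun [set: T] f -> measurable_fun [set: T] g -> (forall x, `|g x| <= B) ->
  (Lnorm mu 1 (EFin \o (f \* g)%R) <= Lnorm mu r%:E (EFin \o f) *
    ((B `^ (2 / r - 1))%:E * Lnorm mu 2%:E (EFin \o g) `^ (2 - 2 / r)))%E.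
Proof.
move=> /andP[r1 r2] B0 mf mg gB; have [r1e|r_neq1] := eqVneq r 1.
  rewrite r1e divr1 (_ : 2 - 1 = 1 :> R) ?subrr; last by ring.
  rewrite powRr1 ?(ltW B0) // poweRe0 mule1 muleC.
  exact: Lnorm1M_bounded_le.
have r0 : 0 < r by exact: lt_le_trans r1.
have rV1 : r^-1 < 1 by rewrite invf_lt1 // lt_neqAle eq_sym r_neq1.
have rV2 : 2^-1 <= r^-1 by rewrite lef_pV2 ?posrE.
pose s := (1 - r^-1)^-1; have s0 : 0 < s by rewrite invr_gt0 subr_gt0.
have s2 : 2 <= s by rewrite -[leLHS]invrK lef_pV2 ?posrE ?subr_gt0 //; lra.
apply: le_trans (hoelder mu mf mg r0 s0 _) _; first by rewrite invrK subrKC.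
rewrite lee_wpmul2l ?Lnorm_ge0 //.
have := @Lnorm_bounded_interpolation s%:E 2 B g (ltr0Sn _ _) _ B0 mg gB.
rewrite lee_fin => /(_ s2); rewrite /= invrK mulrBr mulr1.
by rewrite (_ : 1 - (2 - 2 / r) = 2 / r - 1) //; ring.
Qed.

End Lnorm_inequalities.

Section Lnorm_probability.
Context d (T : measurableType d) (R : realType) (mu : {measure set T -> \bar R}).
Hypothesis mu1 : mu setT = 1%E.
Implicit Types (p q : \bar R) (f : T -> R).

Lemma Lnorm_fin_le (r s : R) f : 0 < r -> r < s -> measurable_fun [set: T] f ->
  (Lnorm mu r%:E (EFin \o f) <= Lnorm mu s%:E (EFin \o f))%E.
Proof.
move=> r0 rs mf; have s0 : 0 < s by exact: lt_trans rs.
pose t := s / r; have t0 : 0 < t by rewrite divr_gt0.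
have tV_lt1 : t^-1 < 1 by rewrite invf_div ltr_pdivrMr // mul1r.
have mfr : measurable_fun [set: T] (fun x => `|f x| `^ r).
  by apply/measurable_EFinP; exact: measurable_normr_powR.
have := @hoelder _ _ _ mu _ (cst 1) t (1 - t^-1)^-1 mfr (measurable_cst _) t0.
rewrite invr_gt0 subr_gt0 invrK subrKC => /(_ tV_lt1 erefl).
rewrite Lnorm_cst1 [X in (_ <= _ * X)%E](_ : _ = 1%E); last by rewrite mu1 poweR_EFin powR1.
rewrite mule1 Lnorm1; under eq_integral do rewrite /= mulr1 ger0_norm ?powR_ge0 //.
rewrite Lnorm_EFinE => hoelder_one; apply: Lnorm_le_integral => //.
  exact: Lnorm_ge0.
apply: le_trans hoelder_one _; rewrite Lnorm_EFinE -poweRrM invf_div mulrC.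
under eq_integral do rewrite ger0_norm ?powR_ge0 // -powRrM mulrCA divff ?gt_eqF // mulr1.
exact: lexx.
Qed.

Lemma Lnorm_nondecreasing p q f : (1 <= p)%E -> (p <= q)%E -> measurable_fun [set: T] f ->
  (Lnorm mu p (EFin \o f) <= Lnorm mu q (EFin \o f))%E.
Proof.
move=> p1; rewrite le_eqVlt => /predU1P[-> //|pq] mf.
case: p q p1 pq => [r| |//] [s| |] //; rewrite lee_fin => r1.
  by rewrite lte_fin => rs; apply: Lnorm_fin_le => //; exact: lt_le_trans r1.
move=> _; have r0 : 0 < r by exact: lt_le_trans r1.
have := Lnorm_ge0 mu +oo%E (EFin \o f); have mu0 : (0 < mu setT)%E by rewrite mu1.
case N : (Lnorm mu +oo%E (EFin \o f)) => [M| |//]; last by move=> _; exact: leey.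
rewrite lee_fin => M0; have f_le : \forall x \ae mu, ((abse \o (EFin \o f)) x <= M%:E)%E.
  by apply/ess_supP; move: N; rewrite unlock mu0 => ->.
apply: Lnorm_le_integral; rewrite ?lee_fin //.
have -> : (M%:E `^ r = \int[mu]_x (M `^ r)%:E)%E by rewrite integral_cst // mu1 mule1.
apply: ae_ge0_le_integral => //; first exact: measurable_normr_powR.
  by move=> x _; rewrite lee_fin powR_ge0.
apply: filterS f_le => x /=; rewrite !lee_fin => fx _.
by rewrite ge0_ler_powR ?nnegrE ?(ltW r0).
Qed.

End Lnorm_probability.

(** * Integration on the torus *)

Section torus_integral.
Variable R : realType.
Local Notation leb := (@lebesgue_measure R).
Local Notation mu := (@torus_measure R).
Local Notation fundamental_domain := (`[0%R, (2 * pi)%R[%classic : set R).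
Implicit Types (g : R -> \bar R) (a x : R).

Lemma two_pi_gt0 : 0 < 2 * pi :> R.
Proof. by rewrite mulr_gt0 ?pi_gt0. Qed.

Lemma lebesgue_measure_translate a (A : set R) : measurable A ->
  pushforward leb (fun x : R => x + a : measurableTypeR R) A = leb A.
Proof.
move=> mA; apply/esym/lebesgue_measure_unique => //=.
  exact: measurable_funD.
move=> _ _ [[u v]] _ <-; rewrite /pushforward.
have -> : (fun x : R => x + a) @^-1` `]u, v] = `](u - a), (v - a)]%classic.
  by apply/seteqP; split => x /=; rewrite !in_itv /= lerBrDr ltrBlDr.
rewrite !lebesgue_measure_itv /= !lte_fin ltrD2r.
by case: ifP => // _; congr (_%:E); rewrite opprB addrC addrA subrK addrC.
Qed.

Lemma ge0_integral_preserving (phi : R -> R) (D : set R) g :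
  measurable_fun setT (phi : measurableTypeR R -> measurableTypeR R) ->
  (forall A, measurable A -> pushforward leb (phi : R -> measurableTypeR R) A = leb A) ->
  measurable D -> measurable_fun setT g -> (forall x, 0 <= g x)%E ->
  (\int[leb]_(x in D) g x = \int[leb]_(x in phi @^-1` D) g (phi x))%E.
Proof.
move=> mphi phi_leb mD mg g0; have mgD : measurable_fun D g by exact: measurable_funTS.
rewrite -[RHS](ge0_integral_pushforward mphi leb mD mgD (fun y _ => g0 y)).
by apply: eq_measure_integral => //= A mA _; exact/esym/phi_leb.
Qed.

Lemma ge0_integral_translate a (D : set R) g :
  measurable D -> measurable_fun setT g -> (forall x, 0 <= g x)%E ->
  (\int[leb]_(x in D) g x = \int[leb]_(x in (fun x => x + a)%R @^-1` D) g (x + a)%R)%E.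
Proof.
apply: ge0_integral_preserving; first exact: measurable_funD.
exact: lebesgue_measure_translate.
Qed.

Lemma ge0_integral_opp (D : set R) g :
  measurable D -> measurable_fun setT g -> (forall x, 0 <= g x)%E ->
  (\int[leb]_(x in D) g x = \int[leb]_(x in (-%R : R -> R) @^-1` D) g (- x)%R)%E.
Proof.
apply: (@ge0_integral_preserving -%R); first exact: oppr_measurable.
exact: lebesgue_measureN.
Qed.

Lemma ge0_integral_mrestr (D : set R) (mD : measurable D) g :
  measurable_fun setT g -> (forall x, 0 <= g x)%E ->
  (\int[mrestr leb mD]_x g x = \int[leb]_(x in D) g x)%E.
Proof.
move=> mg g0; have mDC : measurable (~` D) by exact: measurableC.
have mgD : measurable_fun (D `|` ~` D) (g : measurableTypeR R -> \bar R).
  exact: measurable_funTS.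
rewrite -(setUv D) (@ge0_integral_setU _ (measurableTypeR R) _ (mrestr leb mD) _ _ mD mDC _ mgD) //;
  last exact/disj_setPCl.
rewrite [X in (_ + X)%E](_ : _ = 0%E) ?adde0; last first.
  apply: null_set_integral => //; first exact: measurable_funTS.
  by rewrite /= /mrestr setICl measure0.
by apply: eq_measure_integral => A mA AD; rewrite /= /mrestr setIidl.
Qed.

Lemma ge0_integral_torus g : measurable_fun setT g -> (forall x, 0 <= g x)%E ->
  (\int[mu]_x g x = ((2 * pi)^-1)%:E * \int[leb]_(x in fundamental_domain) g x)%E.
Proof.
by move=> mg g0; rewrite /torus_measure ge0_integral_mscale //= ge0_integral_mrestr.
Qed.

Lemma torus_measureT : mu setT = 1%E.
Proof.
rewrite /torus_measure /mscale /= /mrestr setTI lebesgue_measure_itv /= lte_fin two_pi_gt0.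
by rewrite oppr0 adde0 -EFinM mulVf // gt_eqF // two_pi_gt0.
Qed.

Lemma torus_measure_gt0 : (0 < mu setT)%E.
Proof. by rewrite torus_measureT lte01. Qed.

Lemma integral_torus_cst (a : R) : (\int[mu]_x a%:E = a%:E)%E.
Proof.
rewrite integral_cst // [X in (_ * X)%E](_ : _ = 1%E) ?mule1 //.
exact: torus_measureT.
Qed.

Lemma Rintegral_torus_cst (a : R) : Rintegral mu setT (fun=> a) = a.
Proof. by rewrite /Rintegral integral_torus_cst. Qed.

Definition torus_periodic (V : Type) (g : R -> V) := forall x, g (x + 2 * pi) = g x.

Lemma torus_periodic_int (V : Type) (g : R -> V) (k : int) x :
  torus_periodic g -> g (x + 2 * pi * k%:~R) = g x.
Proof.
move=> gp; have nat_case (n : nat) y : g (y + 2 * pi * n%:R) = g y.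
  elim: n y => [|n ih] y; first by rewrite mulr0 addr0.
  by rewrite -[n.+1%:R]natr1 mulrDr mulr1 addrA gp ih.
case: k => n; first exact: nat_case.
by rewrite NegzE intrN mulrN -pmulrn -[LHS](nat_case n.+1) subrK.
Qed.

Lemma ge0_integral_itv_cat g (a b c : R) : a <= b -> b <= c ->
  measurable_fun setT g -> (forall x, 0 <= g x)%E ->
  (\int[leb]_(x in `[a, c[) g x =
   \int[leb]_(x in `[a, b[) g x + \int[leb]_(x in `[b, c[) g x)%E.
Proof.
move=> ab bc mg g0; rewrite (@itv_bndbnd_setU _ _ (BLeft a) (BLeft b)) //.
rewrite ge0_integral_setU //; first exact: measurable_funTS.
apply/disj_setPS => x [] /=; rewrite !in_itv /= => /andP[_ xb] /andP[bx _].
by move: (lt_le_trans xb bx); rewrite ltxx.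
Qed.

Lemma preimage_translate_itv (a b c : R) :
  (fun x : R => x + c) @^-1` `[a, b[ = `[a - c, b - c[%classic.
Proof. by apply/seteqP; split => x /=; rewrite !in_itv /= lerBlDr ltrBrDr. Qed.

Lemma ge0_integral_period_nonneg g a : torus_periodic g -> measurable_fun setT g ->
  (forall x, 0 <= g x)%E -> 0 <= a < 2 * pi ->
  (\int[leb]_(x in `[a, (a + 2 * pi)%R[) g x = \int[leb]_(x in fundamental_domain) g x)%E.
Proof.
move=> gp mg g0 /andP[a0 a2].
rewrite (@ge0_integral_itv_cat g a (2 * pi)) ?(ltW a2) ?lerDr //.
rewrite [RHS](@ge0_integral_itv_cat g 0 a) ?(ltW a2) // addeC; congr (_ + _)%E.
rewrite (@ge0_integral_translate (2 * pi)) // preimage_translate_itv subrr addrK.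
by apply: eq_integral => x _; rewrite gp.
Qed.

Lemma ge0_integral_period g a : torus_periodic g -> measurable_fun setT g ->
  (forall x, 0 <= g x)%E ->
  (\int[leb]_(x in `[a, (a + 2 * pi)%R[) g x = \int[leb]_(x in fundamental_domain) g x)%E.
Proof.
move=> gp mg g0; pose k := Num.floor (a / (2 * pi)); pose b := a - 2 * pi * k%:~R.
rewrite -(@ge0_integral_period_nonneg g b) //; last first.
  have := floor_itv (a / (2 * pi)).
  rewrite -/k ler_pdivlMr ?two_pi_gt0 // ltr_pdivrMr ?two_pi_gt0 // intrD /b.
  move: two_pi_gt0; move: (2 * pi) (k%:~R) => p l p0 /andP[lp pl].
  by apply/andP; split; nra.
rewrite (@ge0_integral_translate (2 * pi * k%:~R)) // preimage_translate_itv.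
rewrite [a + 2 * pi - _]addrAC; apply: eq_integral => x _.
exact: torus_periodic_int.
Qed.

Definition torus_invariant (phi : R -> R) := forall g, torus_periodic g ->
  measurable_fun setT g -> (forall x, 0 <= g x)%E ->
  (\int[mu]_x g (phi x) = \int[mu]_x g x)%E.

Lemma torus_invariant_translate a : torus_invariant (fun x => x + a).
Proof.
move=> g gp mg g0; rewrite !ge0_integral_torus //; last first.
  by apply: measurableT_comp => //; exact: measurable_funD.
congr (_ * _)%E; rewrite -(ge0_integral_period a gp mg g0) [RHS](ge0_integral_translate a) //.
by rewrite preimage_translate_itv subrr addrAC subrr add0r.
Qed.

Lemma torus_invariant_opp : torus_invariant -%R.
Proof.
move=> g gp mg g0; rewrite !ge0_integral_torus //; last first.
  by apply: measurableT_comp => //; exact: oppr_measurable.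
congr (_ * _)%E; rewrite -(ge0_integral_period (- (2 * pi)) gp mg g0) addNr.
rewrite [RHS]integral_itv_bndo_bndc; last exact: measurable_funTS.
rewrite -[RHS]integral_itv_obnd_cbnd; last exact: measurable_funTS.
rewrite [RHS]ge0_integral_opp // [X in (_ = \int[_]_(x in X) _)%E](_ : _ = fundamental_domain) //.
by apply/seteqP; split => x /=; rewrite !in_itv /= oppr_le0 ltrN2 andbC.
Qed.

Lemma Rintegral_torus_invariant (phi f : R -> R) : torus_invariant phi ->
  torus_periodic f -> measurable_fun setT f ->
  Rintegral mu setT (fun x => f (phi x)) = Rintegral mu setT f.
Proof.
move=> phi_inv fp mf; rewrite /Rintegral; congr fine; rewrite [LHS]integralE [RHS]integralE.
have mfE : measurable_fun setT (EFin \o f) by exact/measurable_EFinP.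
rewrite -(phi_inv (EFin \o f)^\+%E) ?funepos_ge0 //; last 2 first.
- by move=> x; rewrite !funeposE /= fp.
- exact: measurable_funepos.
rewrite -(phi_inv (EFin \o f)^\-%E) ?funeneg_ge0 //; last 2 first.
- by move=> x; rewrite !funenegE /= fp.
- exact: measurable_funeneg.
by congr (_ - _)%E; apply: eq_integral => x _; rewrite ?funeposE ?funenegE.
Qed.

Lemma integral_torus_le_grid_mean M (g : R -> R) (B : R) : (0 < M)%N ->
  torus_periodic g -> measurable_fun setT g -> (forall x, 0 <= g x) ->
  (forall x, grid_mean M g x <= B) -> (\int[mu]_x (g x)%:E <= B%:E)%E.
Proof.
move=> M0 gp mg g0 gB; have MR : (0 : R) < M%:R by rewrite ltr0n.
have mE : measurable_fun setT (EFin \o g) by exact/measurable_EFinP.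
have mgj (j : nat) : measurable_fun setT (fun x : R => (g (x - grid M j))%:E).
  by apply: (measurableT_comp mE); exact: measurable_funD.
have shift_eq (j : nat) : (\int[mu]_x (g (x - grid M j))%:E = \int[mu]_x (g x)%:E)%E.
  apply: (@torus_invariant_translate (- grid M j) (EFin \o g)) => // x.
  by rewrite /= gp.
have : (\int[mu]_x (\sum_(j < M) (g (x - grid M j))%:E) <= (M%:R * B)%:E)%E.
  rewrite -integral_torus_cst; apply: ge0_le_integral => //.
  - by move=> x _; apply: sume_ge0 => j _; rewrite lee_fin.
  - by apply: emeasurable_sum => j; exact: mgj.
  - by move=> x _; rewrite sumEFin lee_fin -ler_pdivrMl // gB.
rewrite ge0_integral_sum //; [|by move=> j; exact: mgj|by move=> j x _; rewrite lee_fin].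
rewrite (eq_bigr (fun=> \int[mu]_x (g x)%:E)%E) => [|j _]; last exact: shift_eq.
have : (0 <= \int[mu]_x (g x)%:E)%E by apply: integral_ge0 => x _; rewrite lee_fin.
case: (integral _ _ _) => [I| |//] _.
  by rewrite sumEFin !lee_fin sumr_const card_ord -[leLHS]mulr_natl ler_pM2l.
case: M M0 {MR mgj shift_eq gB} => // M _; rewrite big_ord_recl addye ?leye_eq //.
by rewrite -ltNye (lt_le_trans (ltNyr 0)) // sume_ge0.
Qed.

End torus_integral.

Section complex_measurability.
Variable R : realType.
Local Notation C := R[i].
Implicit Types (f g : R -> C).

Lemma measurable_normc f : cmeasurable f -> measurable_fun setT (fun x => normc (f x)).
Proof.
move=> [mRe mIm].
have -> : (fun x => normc (f x)) = (fun x => Num.sqrt (Re (f x) ^+ 2 + Im (f x) ^+ 2)).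
  by apply/funext => x; case: (f x).
apply: measurableT_comp; first exact: (continuous_measurable_fun (@sqrt_continuous R)).
by apply: measurable_funD; exact: measurable_funX.
Qed.

Lemma cmeasurableM f g : cmeasurable f -> cmeasurable g -> cmeasurable (fun x => f x * g x).
Proof.
move=> [fRe fIm] [gRe gIm]; split.
  have -> : (fun x => Re (f x * g x)) = (fun x => Re (f x) * Re (g x) - Im (f x) * Im (g x)).
    by apply/funext => x; case: (f x) => ? ?; case: (g x).
  by apply: measurable_funB; exact: measurable_funM.
have -> : (fun x => Im (f x * g x)) = (fun x => Re (f x) * Im (g x) + Im (f x) * Re (g x)).
  by apply/funext => x; case: (f x) => ? ?; case: (g x).
by apply: measurable_funD; exact: measurable_funM.
Qed.

Lemma cmeasurableD f g : cmeasurable f -> cmeasurable g -> cmeasurable (fun x => f x + g x).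
Proof.
move=> [fRe fIm] [gRe gIm]; split.
  have -> : (fun x => Re (f x + g x)) = (fun x => Re (f x) + Re (g x)).
    by apply/funext => x; case: (f x) => ? ?; case: (g x).
  exact: measurable_funD.
have -> : (fun x => Im (f x + g x)) = (fun x => Im (f x) + Im (g x)).
  by apply/funext => x; case: (f x) => ? ?; case: (g x).
exact: measurable_funD.
Qed.

Lemma cmeasurable_cst (a : C) : cmeasurable (fun _ : R => a).
Proof. by split; exact: measurable_cst. Qed.

Lemma cmeasurableZ (a : C) f : cmeasurable f -> cmeasurable (fun x => a * f x).
Proof. by apply: cmeasurableM; exact: cmeasurable_cst. Qed.

Lemma cmeasurable_expi (n : int) : cmeasurable (@expi R n).
Proof.
split; rewrite /expi /=.
  apply: measurableT_comp; first exact: (continuous_measurable_fun (@continuous_cos R)).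
  exact: measurable_funM.
apply: measurableT_comp; first exact: (continuous_measurable_fun (@continuous_sin R)).
exact: measurable_funM.
Qed.

Lemma cmeasurable_trigpoly (D : nat) (c : int -> C) : cmeasurable (trigpoly D c).
Proof.
rewrite /trigpoly; elim: (freqs D) => [|n s ih].
  rewrite (_ : (fun _ => _) = (fun=> 0)); first exact: cmeasurable_cst.
  by apply/funext => x; rewrite big_nil.
rewrite (_ : (fun _ => _) = (fun x => c n * expi n x + \sum_(m <- s) c m * expi m x)).
  by apply: cmeasurableD => //; apply: cmeasurableZ; exact: cmeasurable_expi.
by apply/funext => x; rewrite big_cons.
Qed.

Lemma cmeasurable_translate f (a : R) : cmeasurable f -> cmeasurable (fun x => f (x + a)).
Proof.
have mD : measurable_fun setT (fun x : R => x + a) by exact: measurable_funD.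
by move=> [f1 f2]; split; [exact: (measurableT_comp f1 mD)|exact: (measurableT_comp f2 mD)].
Qed.

End complex_measurability.

Section torus_L1_theory.
Variable R : realType.
Local Notation C := R[i].
Local Notation mu := (@torus_measure R).
Implicit Types (f g : R -> C) (a : C).

Definition torus_L1 f := cmeasurable f /\ mu.-integrable setT (EFin \o (fun x => normc (f x))).

Definition torus_int f : C :=
  Complex (Rintegral mu setT (fun x => Re (f x))) (Rintegral mu setT (fun x => Im (f x))).

Lemma torus_L1_dominates f (h : R -> R) : torus_L1 f -> measurable_fun setT h ->
  (forall x, `|h x| <= normc (f x)) -> mu.-integrable setT (EFin \o h).
Proof.
move=> [mf fi] mh hf; apply: le_integrable fi => //; first exact/measurable_EFinP.
by move=> x _; rewrite /= lee_fin [leRHS]ger0_norm ?normc_ge0.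
Qed.

Lemma torus_L1_Re f : torus_L1 f -> mu.-integrable setT (EFin \o (fun x => Re (f x))).
Proof.
by move=> fi; apply: (torus_L1_dominates fi) => [|x]; [exact: fi.1.1|exact: normr_Re_le].
Qed.

Lemma torus_L1_Im f : torus_L1 f -> mu.-integrable setT (EFin \o (fun x => Im (f x))).
Proof.
by move=> fi; apply: (torus_L1_dominates fi) => [|x]; [exact: fi.1.2|exact: normr_Im_le].
Qed.

Lemma torus_L1D f g : torus_L1 f -> torus_L1 g -> torus_L1 (fun x => f x + g x).
Proof.
move=> [mf fi] [mg gi]; have mfg := cmeasurableD mf mg; split => //.
have fgi : mu.-integrable setT
    ((EFin \o (fun x => normc (f x))) \+ (EFin \o (fun x => normc (g x))))%E.
  exact: integrableD.
apply: le_integrable fgi => //; first by apply/measurable_EFinP; exact: measurable_normc.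
move=> x _; rewrite /= lee_fin !ger0_norm ?normc_ge0 ?addr_ge0 ?normc_ge0 //.
exact: le_normcD.
Qed.

Lemma torus_L1_le f g (B : R) : torus_L1 f -> cmeasurable g ->
  (forall x, normc (g x) <= B * normc (f x)) -> torus_L1 g.
Proof.
move=> [mf fi] mg gf; split => //.
have Bfi : mu.-integrable setT (fun x => B%:E * (normc (f x))%:E)%E by exact: integrableZl.
apply: le_integrable Bfi => //; first by apply/measurable_EFinP; exact: measurable_normc.
move=> x _; rewrite /= lee_fin ger0_norm ?normc_ge0 //.
exact: le_trans (gf x) (ler_norm _).
Qed.

Lemma torus_L1_bounded f (B : R) : cmeasurable f -> (forall x, normc (f x) <= B) -> torus_L1 f.
Proof.
move=> mf fB; split => //.
have Bi : mu.-integrable setT (EFin \o cst B).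
  apply/integrableP; split; first by apply/measurable_EFinP; exact: measurable_cst.
  by rewrite (_ : (fun x => _) = (fun=> `|B|%:E)) // integral_torus_cst ltry.
apply: le_integrable Bi => //; first by apply/measurable_EFinP; exact: measurable_normc.
move=> x _; rewrite /= lee_fin ger0_norm ?normc_ge0 //.
exact: le_trans (fB x) (ler_norm _).
Qed.

Lemma torus_L1_trigpoly D c : torus_L1 (trigpoly D c).
Proof.
apply: torus_L1_bounded (fun x => normc_trigpoly_le D c x).
exact: cmeasurable_trigpoly.
Qed.

Lemma torus_L1_expi n : torus_L1 (@expi R n).
Proof.
by apply: (@torus_L1_bounded _ 1) => [|x]; [exact: cmeasurable_expi|rewrite normc_expi].
Qed.

Lemma torus_L1M_expi f n : torus_L1 f -> torus_L1 (fun x => f x * expi n x).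
Proof.
move=> fi; apply: (@torus_L1_le f _ 1) => // [|x].
  by apply: cmeasurableM; [exact: fi.1|exact: cmeasurable_expi].
by rewrite normcM normc_expi mulr1 mul1r.
Qed.

Lemma torus_L1Z a f : torus_L1 f -> torus_L1 (fun x => a * f x).
Proof.
move=> fi; apply: (@torus_L1_le f _ (normc a)) => // [|x]; last by rewrite normcM.
exact: cmeasurableZ fi.1.
Qed.

Lemma torus_L1_translate f (h : R) : periodic2pi f -> torus_L1 f ->
  torus_L1 (fun x => f (x + h)).
Proof.
move=> fp [mf fi]; have mfh := cmeasurable_translate h mf; split => //.
apply/integrableP; split; first by apply/measurable_EFinP; exact: measurable_normc.
have /integrableP[_] := fi; rewrite -(torus_invariant_translate h) //.
- by move=> x; rewrite /= fp.
- by apply: measurableT_comp => //; apply/measurable_EFinP; exact: measurable_normc.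
Qed.

Lemma eq_torus_int f g : f =1 g -> torus_int f = torus_int g.
Proof. by move=> /funext ->. Qed.

Lemma torus_intD f g : torus_L1 f -> torus_L1 g ->
  torus_int (fun x => f x + g x) = torus_int f + torus_int g.
Proof.
move=> fi gi; rewrite /torus_int; apply/eqP; rewrite eq_complex /=.
rewrite -RintegralD ?torus_L1_Re // -RintegralD ?torus_L1_Im //; apply/andP.
by split; apply/eqP; apply: eq_Rintegral => x _; case: (f x) => ? ?; case: (g x).
Qed.

Lemma torus_intZ a f : torus_L1 f -> torus_int (fun x => a * f x) = a * torus_int f.
Proof.
move=> fi; case: a => u v; rewrite /torus_int; apply/eqP; rewrite eq_complex /=.
have iRe := torus_L1_Re fi; have iIm := torus_L1_Im fi.
have iZ (k : R) h : mu.-integrable setT (EFin \o h) ->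
    mu.-integrable setT (EFin \o (fun x => k * h x)).
  by move=> ih; exact: (integrableZl measurableT k ih).
rewrite -!RintegralZl // -RintegralB ?iZ // -RintegralD ?iZ //.
by apply/andP; split; apply/eqP; apply: eq_Rintegral => x _; case: (f x).
Qed.

Lemma torus_L1_lincomb (I : Type) (s : seq I) (a : I -> C) (f : I -> R -> C) :
  (forall i, torus_L1 (f i)) -> torus_L1 (fun x => \sum_(i <- s) a i * f i x).
Proof.
move=> fi; elim: s => [|i s ih].
  apply: (@torus_L1_bounded _ 0) => [|x]; last by rewrite big_nil normc0.
  by under eq_fun do rewrite big_nil; exact: cmeasurable_cst.
by under eq_fun do rewrite big_cons; apply: torus_L1D => //; exact: torus_L1Z.
Qed.

Lemma torus_int_lincomb (I : Type) (s : seq I) (a : I -> C) (f : I -> R -> C) :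
  (forall i, torus_L1 (f i)) ->
  torus_int (fun x => \sum_(i <- s) a i * f i x) = \sum_(i <- s) a i * torus_int (f i).
Proof.
move=> fi; elim: s => [|i s ih].
  rewrite (@eq_torus_int _ (fun=> 0)) => [|x]; last by rewrite big_nil.
  by rewrite big_nil /torus_int /= Rintegral_torus_cst.
rewrite (@eq_torus_int _ (fun x => a i * f i x + \sum_(j <- s) a j * f j x)).
  rewrite torus_intD ?ih ?torus_intZ ?big_cons //; first exact: torus_L1Z.
  exact: torus_L1_lincomb.
by move=> x; rewrite big_cons.
Qed.

Lemma torus_int_invariant (phi : R -> R) f : torus_invariant phi -> periodic2pi f ->
  cmeasurable f -> torus_int (fun x => f (phi x)) = torus_int f.
Proof.
move=> phi_inv fp [mRe mIm]; rewrite /torus_int.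
rewrite (@Rintegral_torus_invariant _ phi (fun x => Re (f x))) //; last first.
  by move=> x; rewrite fp.
by rewrite (@Rintegral_torus_invariant _ phi (fun x => Im (f x))) // => x; rewrite fp.
Qed.

Lemma torus_int_translate f (h : R) : periodic2pi f -> cmeasurable f ->
  torus_int (fun x => f (x + h)) = torus_int f.
Proof. by apply: torus_int_invariant; exact: torus_invariant_translate. Qed.

Lemma torus_int_reflect f (h : R) : periodic2pi f -> cmeasurable f ->
  torus_int (fun x => f (h - x)) = torus_int f.
Proof.
move=> fp mf; rewrite -(torus_int_translate h fp mf).
rewrite -[RHS](torus_int_invariant (@torus_invariant_opp R)).
- by apply: eq_torus_int => x; rewrite addrC.
- by move=> x; rewrite addrAC fp.
- exact: cmeasurable_translate.
Qed.

Lemma torus_int_expi (n : int) : torus_int (@expi R n) = (n == 0)%:R.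
Proof.
case: eqP => [->|/eqP n0].
  rewrite (@eq_torus_int _ (fun=> 1)) => [|x]; last by rewrite expi0.
  by rewrite /torus_int /= !Rintegral_torus_cst.
have nR : (n%:~R : R) != 0 by rewrite intr_eq0.
have half_turn : expi n (pi / n%:~R) = -1 :> C.
  rewrite /expi mulrC divfK // cospi sinpi; apply/eqP.
  by rewrite eq_complex /= oppr0 !eqxx.
have := torus_int_translate (pi / n%:~R) (@expi_periodic R n) (cmeasurable_expi R n).
under eq_torus_int do rewrite expi_argD mulrC half_turn.
rewrite torus_intZ; last exact: torus_L1_expi.
by move=> /eqP; rewrite mulN1r eq_sym -subr_eq0 opprK -mulr2n mulrn_eq0 /= => /eqP.
Qed.

End torus_L1_theory.

Section fourier_coefficients.
Variable R : realType.
Local Notation C := R[i].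
Local Notation mu := (@torus_measure R).
Implicit Types (f g : R -> C) (n : int) (D k l : nat) (c : int -> C).

Definition fhat f n : C := torus_int (fun t => f t * expi (- n) t).

Lemma VP_trigpoly l f : periodic2pi f -> torus_L1 f ->
  VP l f = trigpoly (2 * l) (fmult (vp_coef l) (fhat f)).
Proof.
move=> fp fi; apply/funext => x; pose F s := f s * vallee_poussin l (x - s).
have FE s : F s = \sum_(n <- freqs (2 * l)) ((vp_coef l n)%:C * expi n x) * (f s * expi (- n) s).
  rewrite /F vallee_poussinE /trigpoly mulr_sumr; apply: eq_bigr => n _.
  by rewrite expi_argD expi_argN; ring.
have -> : VP l f x = torus_int (fun t => F (x - t)).
  by rewrite /VP /conv /torus_int; congr Complex; apply: eq_Rintegral => t _ /=;
    rewrite /F subKr.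
rewrite torus_int_reflect; last 2 first.
- by move=> s; rewrite !FE; apply: eq_bigr => n _; rewrite fp expi_periodic.
- rewrite (funext FE); have fe := fun n => torus_L1M_expi (- n) fi.
  by case: (torus_L1_lincomb (freqs (2 * l)) (fun n => (vp_coef l n)%:C * expi n x) fe).
rewrite (eq_torus_int FE) torus_int_lincomb; last by move=> n; exact: torus_L1M_expi.
by apply: eq_bigr => n _; rewrite -/(fhat f n) /fmult; ring.
Qed.

Lemma fhatZ (a : C) f n : torus_L1 f -> fhat (fun x => a * f x) n = a * fhat f n.
Proof.
move=> fi; rewrite /fhat -torus_intZ; last exact: torus_L1M_expi.
by apply: eq_torus_int => t; rewrite mulrA.
Qed.

Lemma fhatD f g n : torus_L1 f -> torus_L1 g ->
  fhat (fun x => f x + g x) n = fhat f n + fhat g n.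
Proof.
move=> fi gi; rewrite /fhat -torus_intD; [|exact: torus_L1M_expi..].
by apply: eq_torus_int => t; rewrite mulrDl.
Qed.

Lemma fhat_trigpoly D c n : bandlimited D c -> fhat (trigpoly D c) n = c n.
Proof.
move=> cD; rewrite /fhat.
rewrite (@eq_torus_int _ _ (fun t => \sum_(k <- freqs D) c k * expi (k - n) t)).
  rewrite torus_int_lincomb; last by move=> k; exact: torus_L1_expi.
  under eq_bigr do rewrite torus_int_expi subr_eq0.
  rewrite (@sum_freqs_single _ _ _ n) ?eqxx ?mulr1 // => k; first by move/cD ->; rewrite mul0r.
  by move/negbTE ->; rewrite mulr0.
by move=> t; rewrite /trigpoly mulr_suml; apply: eq_bigr => k _; rewrite expiD mulrA.
Qed.

Lemma fhatB_trigpoly f D c n : torus_L1 f -> bandlimited D c ->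
  fhat (fun x => f x - trigpoly D c x) n = fhat f n - c n.
Proof.
move=> fi cD; have -> : (fun x => f x - trigpoly D c x) = (fun x => f x + -1 * trigpoly D c x).
  by apply/funext => x; rewrite mulN1r.
rewrite fhatD ?fhatZ ?fhat_trigpoly ?mulN1r //; first exact: torus_L1_trigpoly.
by apply: torus_L1Z; exact: torus_L1_trigpoly.
Qed.

Lemma periodic2piB f g : periodic2pi f -> periodic2pi g -> periodic2pi (fun x => f x - g x).
Proof. by move=> fp gp x; rewrite fp gp. Qed.

Lemma torus_L1B f g : torus_L1 f -> torus_L1 g -> torus_L1 (fun x => f x - g x).
Proof.
move=> fi gi; have -> : (fun x => f x - g x) = (fun x => f x + -1 * g x).
  by apply/funext => x; rewrite mulN1r.
by apply: torus_L1D => //; exact: torus_L1Z.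
Qed.

Lemma Deltak_periodic k (h : R) f : periodic2pi f -> periodic2pi (Deltak k h f).
Proof.
move=> fp; elim: k => //= k ih.
by apply: periodic2piB => // x; rewrite addrAC ih.
Qed.

Lemma torus_L1_Deltak k (h : R) f : periodic2pi f -> torus_L1 f -> torus_L1 (Deltak k h f).
Proof.
move=> fp fi; elim: k => //= k ih; apply: torus_L1B => //.
by apply: torus_L1_translate => //; exact: Deltak_periodic.
Qed.

Lemma fhat_translate f (h : R) n : periodic2pi f -> torus_L1 f ->
  fhat (fun x => f (x + h)) n = expi n h * fhat f n.
Proof.
move=> fp fi; have fe := torus_L1M_expi (- n) fi; rewrite /fhat.
have fep : periodic2pi (fun t => f t * expi (- n) t) by move=> t; rewrite fp expi_periodic.
rewrite -(torus_int_translate h fep fe.1) -torus_intZ; last exact: torus_L1_translate fep fe.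
apply: eq_torus_int => t; rewrite expi_argD.
by rewrite -[LHS]mul1r -(expi_mulN n h); ring.
Qed.

Lemma fhat_Deltak k (h : R) f n : periodic2pi f -> torus_L1 f ->
  fhat (Deltak k h f) n = (expi n h - 1) ^+ k * fhat f n.
Proof.
move=> fp fi; elim: k => [|k ih]; first by rewrite expr0 mul1r.
have ip := Deltak_periodic k h fp; have ii := torus_L1_Deltak k h fp fi.
have -> : Deltak k.+1 h f = (fun x => Deltak k h f (x + h) + -1 * Deltak k h f x).
  by apply/funext => x; rewrite mulN1r.
rewrite fhatD ?fhatZ ?fhat_translate // ?ih; [|exact: torus_L1_translate|exact: torus_L1Z].
by rewrite exprS; ring.
Qed.

Lemma mul_conj_trigpolyE g D c t : g t * (trigpoly D c t)^*%C =
  \sum_(n <- freqs D) (c n)^*%C * (g t * expi (- n) t).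
Proof. by rewrite conj_trigpoly mulr_sumr; apply: eq_bigr => n _; rewrite mulrCA. Qed.

Lemma torus_L1_mul_conj_trigpoly g D c : torus_L1 g ->
  torus_L1 (fun t => g t * (trigpoly D c t)^*%C).
Proof.
move=> gi; rewrite (funext (mul_conj_trigpolyE g D c)).
by apply: torus_L1_lincomb => n; exact: torus_L1M_expi.
Qed.

Lemma torus_int_mul_conj_trigpoly g D c : torus_L1 g ->
  torus_int (fun t => g t * (trigpoly D c t)^*%C) =
  \sum_(n <- freqs D) (c n)^*%C * fhat g n.
Proof.
move=> gi; rewrite (eq_torus_int (mul_conj_trigpolyE g D c)) torus_int_lincomb // => n.
exact: torus_L1M_expi.
Qed.

Lemma energy_fhatE g D : torus_L1 g ->
  ((energy D (fhat g))%:E = \int[mu]_x (Re (g x * (trigpoly D (fhat g) x)^*%C))%:E)%E.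
Proof.
move=> gi; set T := trigpoly D (fhat g).
transitivity (Rintegral mu setT (fun x => Re (g x * (T x)^*%C)))%:E; last first.
  rewrite /Rintegral fineK //; apply: integrable_fin_num => //.
  exact/torus_L1_Re/torus_L1_mul_conj_trigpoly.
congr (_%:E); rewrite -[RHS]/(Re (torus_int (fun x => g x * (T x)^*%C))).
rewrite torus_int_mul_conj_trigpoly // -[LHS]/(Re (energy D (fhat g))%:C).
rewrite /energy (rmorph_sum (real_complex R)); congr Re.
by apply: eq_bigr => n _; rewrite -[RHS]mulrC -sqr_normc_conj.
Qed.

End fourier_coefficients.

Section torus_norms.
Variable R : realType.
Local Notation C := R[i].
Local Notation mu := (@torus_measure R).
Implicit Types (p q : \bar R) (f g : R -> C) (D : nat) (c : int -> C).

Lemma TnormE p g : Tnorm p g = Lnorm mu p (EFin \o (fun x => normc (g x))).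
Proof. by []. Qed.

Lemma Tnorm_ge0 p g : (0 <= Tnorm p g)%E.
Proof. exact: Lnorm_ge0. Qed.

Lemma Tnorm1E g : Tnorm 1 g = (\int[mu]_x (normc (g x))%:E)%E.
Proof.
by rewrite TnormE Lnorm1; apply: eq_integral => x _; rewrite /= ger0_norm ?normc_ge0.
Qed.

Lemma Tnorm_oo_le g (B : R) : (forall x, normc (g x) <= B) -> (Tnorm +oo%E g <= B%:E)%E.
Proof.
move=> gB; rewrite TnormE unlock torus_measure_gt0; apply/ess_supP; apply: nearW => x.
by rewrite /= lee_fin ger0_norm ?normc_ge0.
Qed.

Lemma Tnorm_nondecreasing p q g : (1 <= p)%E -> (p <= q)%E -> cmeasurable g ->
  (Tnorm p g <= Tnorm q g)%E.
Proof.
move=> p1 pq mg; apply: Lnorm_nondecreasing => //; first exact: torus_measureT.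
exact: measurable_normc.
Qed.

Lemma Tnorm_le_bounded p g (B : R) : (1 <= p)%E -> cmeasurable g ->
  (forall x, normc (g x) <= B) -> (Tnorm p g <= B%:E)%E.
Proof.
by move=> p1 mg gB; apply: le_trans (Tnorm_oo_le gB); apply: Tnorm_nondecreasing; rewrite ?leey.
Qed.

Lemma Tnorm_pZl p (a : R) g : (1 <= p)%E -> 0 <= a -> cmeasurable g ->
  (Tnorm p (fun x => (a%:C * g x)%R) = a%:E * Tnorm p g)%E.
Proof.
move=> p1 a0 mg; rewrite !TnormE -Lnorm_pZl ?torus_measure_gt0 //; last exact: measurable_normc.
by apply: eq_Lnorm => x /=; rewrite normcM normc_real ger0_norm.
Qed.

Lemma Tnorm_L1_bounded_le p g (B J : R) : (1 <= p)%E -> cmeasurable g -> 0 < B -> 0 <= J ->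
  (forall x, normc (g x) <= B) -> (Tnorm 1 g <= J%:E)%E ->
  (Tnorm p g <= (B `^ (1 - einv p) * J `^ einv p)%:E)%E.
Proof.
move=> p1 mg B0 J0 gB gJ.
have e0 : 0 <= einv p by case: p p1 => //= r; rewrite lee_fin invr_ge0; apply: le_trans.
have := @Lnorm_bounded_interpolation _ _ _ mu p 1 B (fun x => normc (g x)) ltr01 p1 B0.
rewrite mul1r EFinM -[(J `^ _)%:E]poweR_EFin => /(_ (measurable_normc mg)) interpolation.
apply: le_trans (interpolation _) _ => [x|]; first by rewrite ger0_norm ?normc_ge0.
by rewrite lee_wpmul2l ?lee_fin ?powR_ge0 // le_poweR // Tnorm_ge0.
Qed.

Lemma Tnorm2_trigpoly D c : Tnorm 2%:E (trigpoly D c) = (Num.sqrt (energy D c))%:E.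
Proof.
pose d n := if (`|n| <= D)%N then c n else 0.
have dD : bandlimited D d by move=> n nD; rewrite /d leqNgt nD.
have cd n : (`|n| <= D)%N -> d n = c n by rewrite /d => ->.
have -> : trigpoly D c = trigpoly D d by apply/funext => x; apply: eq_trigpoly => n /cd.
have -> : energy D c = energy D d by apply: eq_sum_freqs => n /cd ->.
have fd : fhat (trigpoly D d) = d by apply/funext => n; exact: fhat_trigpoly.
have := energy_fhatE D (@torus_L1_trigpoly R D d); rewrite fd => energyE.
rewrite TnormE Lnorm_EFinE (_ : integral _ _ _ = (energy D d)%:E).
  by rewrite poweR_EFin powR12_sqrt // energy_ge0.
rewrite energyE; apply: eq_integral => x _.
by rewrite ger0_norm ?normc_ge0 // powR_mulrn ?normc_ge0 // -sqr_normc_conj.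
Qed.

Lemma in_Lp_torus_L1 p f : (1 <= p)%E -> in_Lp p f -> torus_L1 f.
Proof.
move=> p1 [_ [mf f_fin]]; split => //; apply/integrableP; split.
  by apply/measurable_EFinP; exact: measurable_normc.
apply: le_lt_trans f_fin; apply: le_trans (Tnorm_nondecreasing (lexx _) p1 mf).
by rewrite TnormE Lnorm1.
Qed.

Lemma energy_le_Tnorm_oo D c (y : R) : 0 <= y -> y ^+ 2 <= energy D c ->
  (y%:E <= Tnorm +oo%E (trigpoly D c))%E.
Proof.
move=> y0 yc; have Tnorm2_le := @Tnorm_nondecreasing 2%:E +oo%E _ _ _ (cmeasurable_trigpoly D c).
apply: le_trans (Tnorm2_le _ _); rewrite ?leey ?lee_fin ?ler1n // Tnorm2_trigpoly lee_fin.
by rewrite -[leLHS](ger0_norm y0) -sqrtr_sqr ler_wsqrtr.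
Qed.

End torus_norms.

Section bessel_inequality.
Variable R : realType.
Local Notation C := R[i].
Local Notation mu := (@torus_measure R).
Implicit Types (p : \bar R) (g : R -> C) (D : nat).

Definition l2_loss p : R := Num.max (einv p - 2^-1) 0.

Lemma l2_loss_ge0 p : 0 <= l2_loss p.
Proof. by rewrite /l2_loss le_max lexx orbT. Qed.

Lemma energy_fhat_le_L1 g D : torus_L1 g -> ((energy D (fhat g))%:E <=
  Lnorm mu 1 (EFin \o ((fun x => normc (g x)) \* (fun x => normc (trigpoly D (fhat g) x)))%R))%E.
Proof.
move=> gi; have gTi := torus_L1_mul_conj_trigpoly D (fhat g) gi.
rewrite energy_fhatE // Lnorm1; apply: le_integral => //; first exact: torus_L1_Re.
  apply/integrableP; split; last first.
    have /integrableP[_] := gTi.2; congr (_ < _)%E; apply: eq_integral => x _ /=.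
    by rewrite normcM normc_conj !normr_id.
  apply/measurable_EFinP; apply: measurableT_comp => //.
  apply: measurable_funM; first exact: measurable_normc gi.1.
  by apply: measurable_normc; exact: cmeasurable_trigpoly.
move=> x _; rewrite /= lee_fin -[normc (trigpoly _ _ _)]normc_conj -normcM.
by apply: le_trans (ler_norm _) _; apply: le_trans (normr_Re_le _) _; exact: ler_norm.
Qed.

Lemma energy_fhat_le_Tnorm_low (r : R) g D (W : R) : 1 <= r <= 2 -> torus_L1 g -> 0 <= W ->
  (Tnorm r%:E g <= W%:E)%E ->
  energy D (fhat g) <= ((2 * D).+1%:R `^ l2_loss r%:E * W) ^+ 2.
Proof.
move=> /andP[r1 r2] gi W0 gW; set X := energy D (fhat g); set N : R := (2 * D).+1%:R.
have [X0|Xn] := eqVneq X 0; first by rewrite X0 sqr_ge0.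
have Xp : 0 < X by rewrite lt_neqAle eq_sym Xn energy_ge0.
have N0 : 0 < N by rewrite ltr0n.
have sN : 0 < Num.sqrt N by rewrite sqrtr_gt0.
pose y := Num.sqrt X; have y0 : 0 < y by rewrite sqrtr_gt0.
have yX : y ^+ 2 = X by rewrite sqr_sqrtr // ltW.
have T_le x : `|normc (trigpoly D (fhat g) x)| <= Num.sqrt N * y.
  rewrite ger0_norm ?normc_ge0 //; apply: le_trans (normc_trigpoly_le _ _ _) _.
  rewrite -ler_sqr ?nnegrE ?l1norm_ge0 ?mulr_ge0 ?(ltW sN) ?(ltW y0) //.
  rewrite exprMn yX sqr_sqrtr ?(ltW N0) //.
  exact: sqr_l1norm_le.
have mT := measurable_normc (cmeasurable_trigpoly D (fhat g)).
have r12 : 1 <= r <= 2 by rewrite r1.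
have := Lnorm1M_le_interpolation mu r12 (mulr_gt0 sN y0) (measurable_normc gi.1) mT T_le.
move=> /(le_trans (energy_fhat_le_L1 D gi)); rewrite -!TnormE Tnorm2_trigpoly -/X -/y.
move=> /le_trans/(_ (lee_wpmul2r _ gW)); rewrite poweR_EFin -!EFinM !lee_fin.
rewrite mulr_ge0 ?powR_ge0 // powRM ?(ltW sN) ?(ltW y0) // => /(_ isT).
have -> : W * (Num.sqrt N `^ (2 / r - 1) * y `^ (2 / r - 1) * y `^ (2 - 2 / r)) =
    N `^ l2_loss r%:E * W * y.
  rewrite -mulrA -powRD_gt0 // (_ : 2 / r - 1 + (2 - 2 / r) = 1); last by ring.
  rewrite powRr1 ?(ltW y0) // -powR12_sqrt ?(ltW N0) // -powRrM.
  rewrite /l2_loss /= max_l; last by rewrite subr_ge0 lef_pV2 ?posrE // (lt_le_trans ltr01).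
  rewrite (_ : 2^-1 * (2 / r - 1) = r^-1 - 2^-1); first by ring.
  by field; rewrite gt_eqF ?(lt_le_trans ltr01).
rewrite -yX expr2 ler_pM2r // => y_le.
by rewrite -expr2 lerXn2r ?nnegrE ?(ltW y0) ?mulr_ge0 ?powR_ge0.
Qed.

Lemma energy_fhat_le_Tnorm p g D (W : R) : (1 <= p)%E -> torus_L1 g -> 0 <= W ->
  (Tnorm p g <= W%:E)%E ->
  energy D (fhat g) <= ((2 * D).+1%:R `^ l2_loss p * W) ^+ 2.
Proof.
move=> p1 gi W0 gW; have [p2|/ltW p2] := leP p 2%:E.
  case: p p1 p2 gW => [r| |//]; last by rewrite leye_eq.
  rewrite !lee_fin => r1 r2 gW.
  by apply: energy_fhat_le_Tnorm_low; rewrite ?r1.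
have loss2 : l2_loss p = l2_loss 2%:E.
  rewrite /l2_loss /= subrr maxxx max_r // subr_le0.
  case: p p1 p2 {gW} => [r| |//] //= _; rewrite lee_fin => r2.
  by rewrite lef_pV2 ?posrE // (lt_le_trans _ r2).
rewrite loss2; apply: energy_fhat_le_Tnorm_low => //; first by rewrite ler1n lexx.
by apply: le_trans gW; apply: Tnorm_nondecreasing gi.1; rewrite ?lee_fin ?ler1n.
Qed.

End bessel_inequality.

(** * Besov classes *)

Section besov_modulus.
Variable R : realType.
Local Notation C := R[i].
Local Notation leb := (@lebesgue_measure R).
Implicit Types (k : nat) (r s t th : R) (p theta : \bar R) (f : R -> C).

Lemma nondecreasing_emeasurable (F : R -> \bar R) :
  (forall s t, s <= t -> (F s <= F t)%E) -> measurable_fun setT F.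
Proof.
move=> Fnd mD; apply: (measurability _ (ErealGenOInfty.measurableE R)) => //.
move=> /= _ [_ [a ->] <-]; rewrite setTI; apply: is_interval_measurable => s t /=.
rewrite !in_itv /= !andbT => as_ at_ u /andP[su _].
by rewrite in_itv /= andbT; exact: lt_le_trans as_ (Fnd _ _ su).
Qed.

Lemma le_omega k p f s t : s <= t -> (omega k p f s <= omega k p f t)%E.
Proof.
move=> st; apply: ub_ereal_sup => _ [h hs <-]; apply: ereal_sup_ubound.
by exists h => //=; exact: le_trans hs st.
Qed.

Lemma Tnorm_Deltak_le_omega k p f h t : `|h| <= t ->
  (Tnorm p (Deltak k h f) <= omega k p f t)%E.
Proof. by move=> ht; apply: ereal_sup_ubound; exists h. Qed.

Lemma omega_ge0 k p f t : 0 <= t -> (0 <= omega k p f t)%E.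
Proof.
move=> t0; apply: le_trans (@Tnorm_Deltak_le_omega k p f 0 t _); first exact: Tnorm_ge0.
by rewrite normr0.
Qed.

Definition besov_integrand k r p th f t : \bar R :=
  (((t `^ (- r))%:E * omega k p f t) `^ th * (t^-1)%:E)%E.

Definition besov_seminorm k r p theta f : \bar R :=
  match theta with
  | th%:E => (\int[leb]_(t in `]0%R, +oo[) besov_integrand k r p th f t) `^ th^-1
  | +oo => ereal_sup [set ((t `^ (- r))%:E * omega k p f t) | t in `]0%R, +oo[]
  | -oo => 0
  end%E.

Lemma besov_normE k r p theta f :
  besov_norm k r p theta f = (Tnorm p f + besov_seminorm k r p theta f)%E.
Proof. by []. Qed.

Lemma measurable_besov_integrand k r p th f :
  measurable_fun (`]0%R, +oo[%classic : set R) (besov_integrand k r p th f).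
Proof.
apply: emeasurable_funM.
  apply: (measurableT_comp (measurable_poweR th)); apply: emeasurable_funM.
    by apply/measurable_EFinP; apply: measurable_funTS; exact: measurable_powR.
  by apply: measurable_funTS; apply: nondecreasing_emeasurable => s t; exact: le_omega.
apply/measurable_EFinP.
apply: (eq_measurable_fun (fun t : R => t `^ (- 1))) => [t|].
  by rewrite inE /= in_itv /= andbT => t0; rewrite powR_inv1 // ltW.
by apply: measurable_funTS; exact: measurable_powR.
Qed.

Lemma scaled_omega_ge0 k r p f t : 0 < t -> (0 <= (t `^ (- r))%:E * omega k p f t)%E.
Proof. by move=> t0; rewrite mule_ge0 ?lee_fin ?powR_ge0 // omega_ge0 // ltW. Qed.

Lemma besov_integrand_ge0 k r p th f t : 0 < t -> (0 <= besov_integrand k r p th f t)%E.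
Proof. by move=> t0; rewrite mule_ge0 ?poweR_ge0 // lee_fin invr_ge0 ltW. Qed.

Lemma besov_integral_ge0 k r p th f :
  (0 <= \int[leb]_(t in `]0%R, +oo[) besov_integrand k r p th f t)%E.
Proof.
by apply: integral_ge0 => t; rewrite /= in_itv /= andbT; exact: besov_integrand_ge0.
Qed.

Lemma besov_seminorm_ge0 k r p theta f : (0 <= besov_seminorm k r p theta f)%E.
Proof.
case: theta => [th| |] //=; first exact: poweR_ge0.
apply: le_trans (scaled_omega_ge0 k r p f ltr01) _.
by apply: ereal_sup_ubound; exists 1 => //=; rewrite in_itv /= andbT.
Qed.

Lemma besov_integrand_ge k r p th f t s : 0 <= r -> 0 <= th -> 0 < t -> t <= s <= 2 * t ->
  ((((2 * t) `^ (- r))%:E * omega k p f t) `^ th * ((2 * t)^-1)%:E <=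
   besov_integrand k r p th f s)%E.
Proof.
move=> r0 th0 t0 /andP[ts st]; have s0 : 0 < s by exact: lt_le_trans ts.
have t20 : 0 < 2 * t by rewrite mulr_gt0.
apply: lee_pmul; rewrite ?poweR_ge0 ?lee_fin ?invr_ge0 ?(ltW t20) ?lef_pV2 ?posrE //.
have w0 := omega_ge0 k p f (ltW t0).
apply: le_poweR => //; first by rewrite mule_ge0 // lee_fin powR_ge0.
apply: lee_pmul; rewrite ?lee_fin ?powR_ge0 //; last exact: le_omega.
by rewrite !powRN lef_pV2 ?posrE ?powR_gt0 // ge0_ler_powR ?nnegrE ?(ltW s0) ?(ltW t20).
Qed.

Lemma omega_poweR_le_besov_integral k r p th f t : 0 <= r -> 0 <= th -> 0 < t ->
  ((((2 * t) `^ (- r))%:E * omega k p f t) `^ th <=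
   2%:E * \int[leb]_(s in `]0%R, +oo[) besov_integrand k r p th f s)%E.
Proof.
move=> r0 th0 t0; set b := (_ `^ th)%E; have b0 : (0 <= b)%E by exact: poweR_ge0.
have pos s : `[t, (2 * t)%R]%classic s -> 0 < s.
  by rewrite /= in_itv /= => /andP[ts _]; exact: lt_le_trans ts.
have mint := @measurable_besov_integrand k r p th f.
have itv_length : leb `[t, (2 * t)%R]%classic = t%:E.
  rewrite lebesgue_measure_itv /= lte_fin ifT; last lra.
  by rewrite -?EFinN -?EFinD; congr (_%:E); lra.
have -> : b = (2%:E * \int[leb]_(s in `[t, (2 * t)%R]) (b * ((2 * t)^-1)%:E))%E.
  rewrite integral_cst // [X in (_ = 2%:E * (_ * X))%E](_ : _ = t%:E); last exact: itv_length.
  rewrite -muleA [RHS]muleCA -!EFinM (_ : 2 * ((2 * t)^-1 * t) = 1) ?mule1 //.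
  by field; rewrite gt_eqF.
rewrite lee_wpmul2l //; apply: (@le_trans _ _
    (\int[leb]_(s in `[t, (2 * t)%R]) besov_integrand k r p th f s)%E).
  apply: ge0_le_integral => //.
  - by move=> s _; rewrite mule_ge0 // lee_fin invr_ge0 mulr_ge0 // ltW.
  - by apply: measurable_funS mint => // s /pos; rewrite /= in_itv /= andbT.
  - by move=> s /=; rewrite in_itv /=; exact: besov_integrand_ge.
apply: ge0_subset_integral => //.
- by move=> s /=; rewrite in_itv /= andbT; exact: besov_integrand_ge0.
- by move=> s /pos; rewrite /= in_itv /= andbT.
Qed.

Lemma scaled_omega_le_besov_seminorm k r p theta f t : 0 <= r -> (1 <= theta)%E -> 0 < t ->
  (((2 * t) `^ (- r))%:E * omega k p f t <= 2%:E * besov_seminorm k r p theta f)%E.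
Proof.
move=> r0 th1 t0; have t20 : 0 < 2 * t by rewrite mulr_gt0.
have w0 := omega_ge0 k p f (ltW t0); case: theta th1 => [th| |//] th1; last first.
  apply: (@le_trans _ _ (besov_seminorm k r p +oo%E f)); last first.
    by rewrite -[leLHS]mul1e lee_wpmul2r ?besov_seminorm_ge0 // lee_fin ler1n.
  apply: (@le_trans _ _ ((t `^ (- r))%:E * omega k p f t)%E).
    rewrite lee_wpmul2r // lee_fin !powRN lef_pV2 ?posrE ?powR_gt0 //.
    by rewrite ge0_ler_powR ?nnegrE ?(ltW t0) ?(ltW t20) //; lra.
  by apply: ereal_sup_ubound; exists t => //=; rewrite in_itv /= andbT.
rewrite lee_fin in th1; have th0 : 0 < th by exact: lt_le_trans th1.
have wt0 : (0 <= ((2 * t) `^ (- r))%:E * omega k p f t)%E by rewrite mule_ge0 // lee_fin powR_ge0.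
rewrite -[leLHS](poweRK wt0 (invr_neq0 (lt0r_neq0 th0))) invrK.
have omega_le := omega_poweR_le_besov_integral k p f r0 (ltW th0) t0.
apply: le_trans (le_poweR _ (poweR_ge0 _ _) omega_le) _.
  by rewrite invr_ge0 ltW.
rewrite poweRM ?besov_integral_ge0 // poweR_EFin lee_wpmul2r ?poweR_ge0 // lee_fin.
by rewrite -[leRHS]powRr1 // ler_powR ?ler1n // invf_le1.
Qed.

Lemma omega_le_besov_seminorm k r p theta f t : 0 <= r -> (1 <= theta)%E -> 0 < t ->
  (omega k p f t <= (2 * (2 * t) `^ r)%:E * besov_seminorm k r p theta f)%E.
Proof.
move=> r0 th1 t0; have t2r : 0 < (2 * t) `^ r by rewrite powR_gt0 // mulr_gt0.
rewrite -[leLHS]mul1e -[X in (X%:E * _)%E](divff (lt0r_neq0 t2r)) EFinM -muleA.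
rewrite [2 * (_ `^ _)]mulrC EFinM -muleA lee_wpmul2l ?lee_fin ?(ltW t2r) //.
by rewrite -powRN; exact: scaled_omega_le_besov_seminorm.
Qed.

Lemma besov_class_Tnorm_le1 k r p theta f : besov_class k r p theta f -> (Tnorm p f <= 1)%E.
Proof.
by move=> [_]; rewrite besov_normE; apply: le_trans; rewrite leeDl // besov_seminorm_ge0.
Qed.

Lemma besov_class_Deltak_le k r p theta f h : 0 <= r -> (1 <= theta)%E -> 0 < h ->
  besov_class k r p theta f -> (Tnorm p (Deltak k h f) <= (2 * (2 * h) `^ r)%:E)%E.
Proof.
move=> r0 th1 h0 [_ fB].
apply: le_trans (@Tnorm_Deltak_le_omega k p f h h _) _; first by rewrite ger0_norm // ltW.
apply: le_trans (omega_le_besov_seminorm k p f r0 th1 h0) _.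
rewrite -[leRHS]mule1 lee_wpmul2l ?lee_fin ?mulr_ge0 ?powR_ge0 //.
by apply: le_trans fB; rewrite besov_normE leeDr // Tnorm_ge0.
Qed.

End besov_modulus.

Section block_energy.
Variable R : realType.
Local Notation C := R[i].
Implicit Types (f : R -> C) (s k : nat).

Definition dyadic_decay (A rr : R) s : R := A * 2 `^ (- (s%:R * rr)).

Lemma dyadic_decay_ge0 (A rr : R) s : 0 <= A -> 0 <= dyadic_decay A rr s.
Proof. by move=> A0; rewrite mulr_ge0 ?powR_ge0. Qed.

Definition decaying_blocks (A rr : R) f := forall s,
  energy (2 ^ s.+1) (fmult (sigma_coef s) (fhat f)) <= dyadic_decay A rr s ^+ 2.

(* The value of [|e^(i h n) - 1| ^ 2] at [h n = 1 / 4], its minimum over a dyadic block. *)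
Definition symbol_gap : R := 2 - 2 * cos 4^-1.

Lemma symbol_gap_gt0 : 0 < symbol_gap.
Proof.
have pi2 := pi_ge2 R; suff : cos (4^-1 : R) < 1 by rewrite /symbol_gap; lra.
by apply: cos_lt1; apply/andP; split; lra.
Qed.

Lemma sqrt_symbol_gapX_gt0 k : 0 < Num.sqrt symbol_gap ^+ k.
Proof. by rewrite exprn_gt0 // sqrtr_gt0 symbol_gap_gt0. Qed.

Lemma symbol_lower_bound s k (n : int) : (2 ^ s < `|n| < 2 ^ s.+2)%N ->
  Num.sqrt symbol_gap ^+ k <= normc ((expi n (2 ^ s.+2)%:R^-1 - 1) ^+ k).
Proof.
move=> /andP[sn ns]; rewrite normcX lerXn2r ?nnegrE ?sqrtr_ge0 ?normc_ge0 //.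
rewrite -ler_sqr ?nnegrE ?sqrtr_ge0 ?normc_ge0 // sqr_sqrtr ?(ltW symbol_gap_gt0) //.
apply: expiB1_lower_bound; rewrite ler_pdivlMr ?ler_pdivrMr ?ltr0n ?expn_gt0 // mul1r.
rewrite ler_nat (ltnW ns) andbT.
have : ((2 ^ s)%:R : R) <= `|n|%:R by rewrite ler_nat ltnW.
by rewrite !expnS !natrM; lra.
Qed.

Lemma energy_sigma_le_Deltak f s k : periodic2pi f -> torus_L1 f ->
  energy (2 ^ s.+2) (fmult (sigma_coef s.+1) (fhat f)) <=
  (Num.sqrt symbol_gap ^+ k) ^- 2 *
  energy (2 ^ s.+2) (fhat (Deltak k (2 ^ s.+2)%:R^-1 f)).
Proof.
move=> fp fi; have gap0 := sqrt_symbol_gapX_gt0 k.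
rewrite -exprVn -energyZ; apply: le_energy => n _; rewrite fhat_Deltak // !normcM !normc_real.
have [ns|sn] := leqP `|n| (2 ^ s).
  by rewrite sigma_coef_eq0_low // normr0 mul0r !mulr_ge0 ?normc_ge0.
have [sn2|ns2] := leqP (2 ^ s.+2) `|n|.
  by rewrite sigma_coef_eq0_high // normr0 mul0r !mulr_ge0 ?normc_ge0.
rewrite mulrA ler_wpM2r ?normc_ge0 //; apply: le_trans (normr_sigma_coef_le1 _ _ _) _.
rewrite ger0_norm ?invr_ge0 ?(ltW gap0) // mulrC ler_pdivlMr // mul1r.
by apply: symbol_lower_bound; rewrite sn.
Qed.

Lemma powR_card_freqs_le s (g : R) : 0 <= g ->
  (2 * 2 ^ s.+2).+1%:R `^ g <= 8 `^ g * 2 `^ (s.+1%:R * g) :> R.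
Proof.
move=> g0; rewrite powRrM powR2_nat -powRM // -natrM ge0_ler_powR ?nnegrE // ler_nat.
by rewrite !expnS; have := expn_gt0 2 s; lia.
Qed.

Lemma block_energy_low (p theta : \bar R) (r : R) k f : (1 <= p)%E ->
  besov_class k r p theta f ->
  energy (2 ^ 1) (fmult (sigma_coef 0) (fhat f)) <= (5 `^ l2_loss p) ^+ 2.
Proof.
move=> p1 fB; have fi := in_Lp_torus_L1 p1 fB.1.
apply: le_trans (_ : energy (2 ^ 1) (fhat f) <= _).
  by apply: le_energy => n _; rewrite normcM normc_real ler_piMl ?normc_ge0 ?normr_sigma_coef_le1.
rewrite -[X in X ^+ 2]mulr1.
exact: (energy_fhat_le_Tnorm (2 ^ 1) p1 fi ler01 (besov_class_Tnorm_le1 fB)).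
Qed.

Lemma block_energy_high (p theta : \bar R) (r : R) k f s : (1 <= p)%E -> (1 <= theta)%E ->
  0 <= r -> besov_class k r p theta f ->
  energy (2 ^ s.+2) (fmult (sigma_coef s.+1) (fhat f)) <=
  dyadic_decay (2 * 8 `^ l2_loss p / Num.sqrt symbol_gap ^+ k) (r - l2_loss p) s.+1 ^+ 2.
Proof.
move=> p1 th1 r0 fB; have fi := in_Lp_torus_L1 p1 fB.1; have fp := fB.1.1.
set g := l2_loss p; pose h : R := (2 ^ s.+2)%:R^-1.
have h0 : 0 < h by rewrite invr_gt0 ltr0n expn_gt0.
have gap0 := sqrt_symbol_gapX_gt0 k.
have W0 : 0 <= 2 * (2 * h) `^ r by rewrite mulr_ge0 ?powR_ge0.
apply: le_trans (energy_sigma_le_Deltak s k fp fi) _.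
have Delta_energy := energy_fhat_le_Tnorm (2 ^ s.+2) p1 (torus_L1_Deltak k h fp fi) W0
  (besov_class_Deltak_le r0 th1 h0 fB).
apply: le_trans (ler_wpM2l _ Delta_energy) _; first by rewrite invr_ge0 sqr_ge0.
rewrite -exprVn -exprMn lerXn2r ?nnegrE ?dyadic_decay_ge0 ?mulr_ge0 //
  ?invr_ge0 ?powR_ge0 ?(ltW gap0) //.
have -> : (2 * h) `^ r = 2 `^ (- (s.+1%:R * r)).
  rewrite -mulNr powRrM powRN powR2_nat /h; congr (_ `^ _).
  by rewrite expnS natrM invfM mulrA divff ?mul1r.
rewrite /dyadic_decay (_ : - (s.+1%:R * (r - g)) = s.+1%:R * g + - (s.+1%:R * r)); last by ring.
rewrite powRD_gt0 //; have := powR_card_freqs_le s (l2_loss_ge0 p).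
have := powR_ge0 (2 : R) (- (s.+1%:R * r)); have : 0 <= (Num.sqrt symbol_gap ^+ k)^-1.
  by rewrite invr_ge0 ltW.
rewrite -/g; move: (_^-1) (_.+1%:R `^ g) (8 `^ g) (2 `^ (s.+1%:R * g)) (2 `^ (- _)).
move=> a N e x y a0 y0 Nx.
rewrite (_ : 2 * e * a * (x * y) = a * (e * x * (2 * y))); last by ring.
by rewrite ler_wpM2l // ler_wpM2r // mulr_ge0.
Qed.

Lemma besov_class_decaying_blocks (p theta : \bar R) (r : R) k : (1 <= p)%E -> (1 <= theta)%E ->
  0 <= r -> exists2 A : R, 0 < A &
    forall f, besov_class k r p theta f -> decaying_blocks A (r - l2_loss p) f.
Proof.
move=> p1 th1 r0; pose A1 : R := 5 `^ l2_loss p.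
pose A2 : R := 2 * 8 `^ l2_loss p / Num.sqrt symbol_gap ^+ k.
have A10 : 0 < A1 by rewrite powR_gt0.
have A20 : 0 < A2.
  by rewrite divr_gt0 ?mulr_gt0 ?powR_gt0 // sqrt_symbol_gapX_gt0.
exists (A1 + A2) => [|f fB [|s]]; first by rewrite addr_gt0.
  apply: le_trans (block_energy_low p1 fB) _; rewrite lerXn2r ?nnegrE ?powR_ge0 //.
    by rewrite dyadic_decay_ge0 // addr_ge0 ?ltW.
  by rewrite /dyadic_decay mul0r oppr0 powRr0 mulr1 lerDl ltW.
apply: le_trans (block_energy_high s p1 th1 r0 fB) _; rewrite lerXn2r ?nnegrE //.
- by rewrite dyadic_decay_ge0 // ltW.
- by rewrite dyadic_decay_ge0 // addr_ge0 ?ltW.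
by rewrite ler_wpM2r ?powR_ge0 // lerDr ltW.
Qed.

End block_energy.

(** * Upper bound *)

Section best_approximation.
Variable R : realType.
Local Notation C := R[i].
Implicit Types (f g : R -> C) (s m E : nat) (Q : int -> C).

Lemma Binf1_norm_le g (K : R) :
  (forall N, (\sum_(s < N) Tnorm +oo%E (sigma_blk s g) <= K%:E)%E) ->
  (Binf1_norm g <= K%:E)%E.
Proof.
move=> gK; apply: lime_le; first by apply: is_cvg_nneseries => s _ _; exact: Tnorm_ge0.
by apply: nearW => N; rewrite /= big_mkord.
Qed.

Lemma Tnorm_sigma_blk_le_Binf1 g s : (Tnorm +oo%E (sigma_blk s g) <= Binf1_norm g)%E.
Proof.
apply: le_trans (nneseries_lim_ge s.+1 _) => [|s' _ _]; last exact: Tnorm_ge0.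
by rewrite big_nat_recr //= leeDr // sume_ge0 // => i _; exact: Tnorm_ge0.
Qed.

Lemma sigma_blk_trigpoly s f : periodic2pi f -> torus_L1 f ->
  sigma_blk s f = trigpoly (2 ^ s.+1) (fmult (sigma_coef s) (fhat f)).
Proof.
move=> fp fi; apply/funext => x; case: s => [|s]; rewrite /sigma_blk; first by rewrite VP_trigpoly.
rewrite !VP_trigpoly // -!expnS trigpoly_fmultB; congr (_ - _).
rewrite (@trigpoly_widen _ (2 ^ s.+1) (2 ^ s.+2)) ?leq_exp2l // expnS.
exact: bandlimited_fmult_vp.
Qed.

Lemma sigma_blkB_trigpoly s f E Q : periodic2pi f -> torus_L1 f -> bandlimited E Q ->
  sigma_blk s (fun x => f x - trigpoly E Q x) =
  trigpoly (2 ^ s.+1) (fmult (sigma_coef s) (fun n => fhat f n - Q n)).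
Proof.
move=> fp fi QE; rewrite sigma_blk_trigpoly; last 2 first.
- by apply: periodic2piB => //; exact: trigpoly_periodic.
- by apply: torus_L1B => //; exact: torus_L1_trigpoly.
by congr (trigpoly _ (fmult _ _)); apply/funext => n; rewrite fhatB_trigpoly.
Qed.

Lemma exists_uniq_superset (s : seq int) m : (size s <= m)%N ->
  exists Th : seq int, [/\ uniq Th, size Th = m & {subset s <= Th}].
Proof.
move=> sm; pose N := (\max_(n <- s) absz n).+1.
pose fresh := [seq (N + i)%:Z | i <- iota 0 (m - size (undup s))].
have us : (size (undup s) <= m)%N := leq_trans (size_undup s) sm.
exists (undup s ++ fresh); split.
- rewrite cat_uniq undup_uniq /= map_inj_uniq ?iota_uniq; last by move=> i j; lia.
  rewrite andbT; apply/hasPn => _ /mapP[i _ ->]; rewrite mem_undup; apply/negP => Ns.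
  have : (absz (N + i)%:Z <= \max_(n <- s) absz n)%N by exact: leq_bigmax_seq.
  by rewrite /N /=; lia.
- by rewrite size_cat size_map size_iota subnKC.
- by move=> n ns; rewrite mem_cat mem_undup ns.
Qed.

Lemma trigpoly_support (s : seq int) E Q x : uniq s -> bandlimited E Q ->
  (forall n, n \notin s -> Q n = 0) -> trigpoly E Q x = \sum_(n <- s) Q n * expi n x.
Proof.
move=> us QE Qs; pose U := undup (freqs E ++ s).
have EU : {subset freqs E <= U} by move=> n nE; rewrite mem_undup mem_cat nE.
have sU : {subset s <= U} by move=> n ns; rewrite mem_undup mem_cat ns orbT.
have uU : uniq U := undup_uniq _.
rewrite /trigpoly -(sum_uniq_subset (freqs_uniq E) uU EU) => [|n _]; last first.
  by rewrite mem_freqs -ltnNge => /QE ->; rewrite mul0r.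
by rewrite (sum_uniq_subset us uU sU) // => n _ /Qs ->; rewrite mul0r.
Qed.

Lemma em_fun_le f m Q (Th : seq int) E : bandlimited E Q ->
  (forall n, n \notin Th -> Q n = 0) -> (size Th <= m)%N ->
  (em_fun m f <= Binf1_norm (fun x => (f x - trigpoly E Q x)%R))%E.
Proof.
move=> QE QTh Thm; have [Th' [uTh' Th'm ThTh']] := exists_uniq_superset Thm.
apply: ereal_inf_lbound; exists Th', Q; split; [exact: uTh'|exact: Th'm|].
congr Binf1_norm; apply/funext => x; rewrite (trigpoly_support x uTh' QE) // => n nTh'.
by apply: QTh; apply: contra nTh'; exact: ThTh'.
Qed.

Lemma em_fun_le_Binf1_norm f m : (em_fun m f <= Binf1_norm f)%E.
Proof.
have zero_band : bandlimited 0 (fun=> 0 : C) by [].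
rewrite -[X in (_ <= Binf1_norm X)%E](_ : (fun x => (f x - trigpoly 0 (fun=> 0) x)%R) = f).
  by apply: (em_fun_le f zero_band (Th := [::])).
by apply/funext => x; rewrite trigpoly0 subr0.
Qed.

Lemma em_fun_le_dyadic f (a : nat -> R) (v : nat -> nat) (n S m : nat) (K : R) :
  periodic2pi f -> torus_L1 f -> (1 < n)%N -> (n < S)%N ->
  (forall u, (S <= u)%N -> (u.+1 < v u)%N) -> (forall u, 0 <= a u) ->
  (forall u, energy (2 ^ u.+1) (fmult (sigma_coef u) (fhat f)) <= a u ^+ 2) ->
  ((2 ^ n.+2).+1 + \sum_(n.+1 <= u < S) level_size u.+1 (v u) <= m)%N ->
  (forall N, \sum_(n.+1 <= u < N) sparse_error (v u) (a u) <= K) ->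
  (em_fun m f <= (180 * K)%:E)%E.
Proof.
move=> fp fi n1 nS vS a0 fa size_m errK.
have [Q [Th [E [QE QTh Th_size Q_near]]]] := sparse_dyadic_approx n1 nS vS a0 fa.
apply: le_trans (em_fun_le f QE QTh (leq_trans Th_size size_m)) _.
pose e u := 36 * sparse_error (v u) (a u).
have e0 u : 0 <= e u by rewrite mulr_ge0 ?sparse_error_ge0.
apply: Binf1_norm_le => N.
apply: (@le_trans _ _ (\sum_(s < N) (\sum_(n.+1 <= u < N + 3 | near_block s u) e u)%:E)%E).
  apply: lee_sum => s _; apply: Tnorm_oo_le => x; rewrite sigma_blkB_trigpoly //.
  by apply: Q_near; rewrite leq_add2r ltnW.
rewrite sumEFin lee_fin; apply: le_trans (sum_near_block_le _ _ _ e0) _.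
rewrite /e -mulr_sumr (_ : 180 * K = 5 * (36 * K)); last by ring.
by rewrite !ler_wpM2l ?errK.
Qed.

End best_approximation.

Section geometric_bounds.
Variable R : realType.
Implicit Types (A rr x : R) (q n u d : nat).

Lemma sum_geom_le x N : 0 < x < 1 -> \sum_(0 <= s < N) x ^+ s <= (1 - x)^-1.
Proof.
move=> /andP[x0 x1]; have := @geometric_le_lim R N 1 x ler01 x0.
rewrite ger0_norm ?(ltW x0) // mul1r => /(_ x1); congr (_ <= _).
by rewrite /series /=; apply: eq_bigr => s _; rewrite /geometric /= mul1r.
Qed.

Lemma sum_geom_shift_le x n N : 0 < x < 1 ->
  \sum_(n.+1 <= u < N) x ^+ (u - n) <= (1 - x)^-1.
Proof.
move=> x01; have /andP[x0 x1] := x01; apply: le_trans (sum_geom_le (N - n.+1) x01).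
rewrite -{1}[n.+1]add0n big_addn; apply: ler_sum => i _.
by apply: ler_wiXn2l; rewrite ?(ltW x0) ?(ltW x1) //; lia.
Qed.

Lemma linear_le_exponential (lam : R) : 0 < lam ->
  exists2 K : R, 0 <= K & forall d, 1 + 2 * d%:R <= K * 2 `^ (lam * d%:R).
Proof.
move=> lam0; pose L : R := lam * ln 2.
have L0 : 0 < L by rewrite mulr_gt0 // ln_gt0 // ltr1n.
have K0 : 0 < 1 + 2 / L by rewrite addr_gt0 // divr_gt0.
exists (1 + 2 / L) => [|d]; first exact: ltW.
have -> : 2 `^ (lam * d%:R) = expR (L * d%:R) :> R.
  by rewrite /powR pnatr_eq0 /= /L mulrAC.
apply: le_trans (ler_wpM2l (ltW K0) (expR_ge1Dx _)); have d0 : (0 : R) <= d%:R by [].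
have -> : (1 + 2 / L) * (1 + L * d%:R) = 1 + 2 * d%:R + (L * d%:R + 2 / L).
  by field; rewrite gt_eqF.
by rewrite lerDl; apply: addr_ge0; [apply: mulr_ge0|apply: divr_ge0] => //; exact: ltW.
Qed.

(* With [d = u - n] the level is [d + d / q]; the gain [2 ^ (- d rr)] beats the loss
   [sqrt 2 ^ level] as soon as [1 / q < 2 rr - 1]. *)
Lemma block_level_exponent_le (kap rr : R) q n u : (0 < q)%N -> (n <= u)%N ->
  kap <= rr - (1 + q%:R^-1) / 2 ->
  (block_level q n u)%:R / 2 - u%:R * rr <= - (n%:R * rr) - (u - n)%:R * kap.
Proof.
move=> q0 nu kap_le; rewrite /block_level; set d := (u - n)%N; rewrite -(subnKC nu) -/d !natrD.
have : ((d %/ q)%:R : R) <= d%:R / q%:R.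
  by rewrite ler_pdivlMr ?ltr0n // -natrM ler_nat leq_trunc_div.
have : (0 : R) <= d%:R by []; move: kap_le.
move: ((d %/ q)%:R) (d%:R) (n%:R) (q%:R^-1) => a b c e; nra.
Qed.

Lemma sparse_error_decay_le A rr : 0 <= A -> 2^-1 < rr -> exists (q : nat) (x B : R),
  [/\ (0 < q)%N, 0 < x < 1, 0 <= B & forall n u, (n <= u)%N ->
     sparse_error (block_level q n u) (dyadic_decay A rr u) <=
     B * 2 `^ (- (n%:R * rr)) * x ^+ (u - n)].
Proof.
move=> A0 rr2; have [k] : exists k, 0 + k.+1%:R^-1 < 2 * rr - 1.
  by apply: ltr_add_invr; lra.
rewrite add0r; set q := k.+1 => q_small; pose kap : R := (rr - (1 + q%:R^-1) / 2) / 2.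
have kap0 : 0 < kap by rewrite /kap; lra.
have [K K0 K_le] := linear_le_exponential kap0.
have c0 : (0 : R) <= 64 ^+ 2 by exact: sqr_ge0.
exists q, (2 `^ (- kap)), (64 ^+ 2 * A * K); split => //.
- by apply: powR2_bounds; rewrite oppr_lt0.
- by rewrite !mulr_ge0.
move=> n u nu; set d := (u - n)%N; rewrite /sparse_error /dyadic_decay sqrt2X_powR.
set v := block_level q n u; have v_le : (1 + v%:R : R) <= 1 + 2 * d%:R.
  by rewrite lerD2l -natrM ler_nat /v /block_level -/d mul2n -addnn leq_add2l leq_div.
have decay : 2 `^ (v%:R / 2) * 2 `^ (- (u%:R * rr)) <=
    2 `^ (- (n%:R * rr)) * 2 `^ (- (d%:R * (2 * kap))) :> R.
  rewrite -!powRD_gt0 // ler_powR ?ler1n //; apply: block_level_exponent_le => //.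
  by rewrite /kap; lra.
have growth : (1 + v%:R) * (2 `^ (v%:R / 2) * 2 `^ (- (u%:R * rr))) <=
    K * 2 `^ (kap * d%:R) * (2 `^ (- (n%:R * rr)) * 2 `^ (- (d%:R * (2 * kap)))) :> R.
  apply: ler_pM; rewrite ?mulr_ge0 ?powR_ge0 ?addr_ge0 //.
  exact: le_trans v_le (K_le d).
have -> : (2 `^ (- kap)) ^+ d = 2 `^ (kap * d%:R) * 2 `^ (- (d%:R * (2 * kap))) :> R.
  by rewrite -powR_mulrn ?powR_ge0 // -powRrM -powRD_gt0 //; congr (_ `^ _); ring.
have -> : 64 ^+ 2 * (1 + v%:R) * 2 `^ (v%:R / 2) * (A * 2 `^ (- (u%:R * rr))) =
    64 ^+ 2 * A * ((1 + v%:R) * (2 `^ (v%:R / 2) * 2 `^ (- (u%:R * rr)))) by ring.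
apply: le_trans (ler_wpM2l (mulr_ge0 c0 A0) growth) _.
by rewrite le_eqVlt; apply/orP; left; apply/eqP; ring.
Qed.

Lemma sum_sparse_error_decay_le A rr : 0 <= A -> 2^-1 < rr -> exists (q : nat) (B : R),
  [/\ (0 < q)%N, 0 <= B & forall n N,
     \sum_(n.+1 <= u < N) sparse_error (block_level q n u) (dyadic_decay A rr u) <=
     B * 2 `^ (- (n%:R * rr))].
Proof.
move=> A0 rr2; have [q [x [B [q0 x01 B0 err_le]]]] := sparse_error_decay_le A0 rr2.
have /andP[_ x1] := x01; have geom0 : 0 <= (1 - x)^-1 by rewrite invr_ge0 subr_ge0 ltW.
exists q, (B / (1 - x)); split=> [||n N] //; first by rewrite mulr_ge0.
apply: (@le_trans _ _ (\sum_(n.+1 <= u < N) B * 2 `^ (- (n%:R * rr)) * x ^+ (u - n))).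
  rewrite big_nat [leRHS]big_nat; apply: ler_sum => u /andP[/ltnW nu _].
  exact: err_le.
rewrite -mulr_sumr [leRHS]mulrAC; apply: ler_wpM2l; first by rewrite mulr_ge0 ?powR_ge0.
exact: sum_geom_shift_le.
Qed.

Lemma exists_dyadic_scale (b m : nat) : (0 < b)%N -> (b * 4 <= m)%N ->
  exists n, [/\ (1 < n)%N, (b * 2 ^ n <= m)%N & (m <= b * 2 ^ n.+1)%N].
Proof.
move=> b0 bm; pose j := (m %/ b)%N; have j4 : (4 <= j)%N by rewrite leq_divRL // mulnC.
have /andP[nj jn] := trunc_log_bounds (ltnSn 1) (leq_trans (isT : (0 < 4)%N) j4).
exists (trunc_log 2 j); split.
- by have := leq_ltn_trans j4 jn; rewrite -[4%N]/(2 ^ 2)%N ltn_exp2l // ltnS.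
- by rewrite mulnC -leq_divRL.
- by apply: ltnW; rewrite mulnC -ltn_divLR.
Qed.

End geometric_bounds.

Section upper_estimate.
Variable R : realType.
Local Notation C := R[i].
Local Notation sqrt2 := (Num.sqrt 2 : R).
Implicit Types (f : R -> C) (A rr : R).

Lemma Binf1_norm_decay_le f A rr : periodic2pi f -> torus_L1 f -> 0 <= A -> 2^-1 < rr ->
  decaying_blocks A rr f ->
  (Binf1_norm f <= (2 * sqrt2 * A / (1 - 2 `^ (2^-1 - rr)))%:E)%E.
Proof.
move=> fp fi A0 rr2 f_decay; pose z : R := 2 `^ (2^-1 - rr).
have z01 : 0 < z < 1 by apply: powR2_bounds; rewrite subr_lt0.
apply: Binf1_norm_le => N.
apply: (@le_trans _ _ (\sum_(s < N) (2 * sqrt2 * A * z ^+ s)%:E)%E).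
  apply: lee_sum => s _; apply: Tnorm_oo_le => x; rewrite sigma_blk_trigpoly //.
  apply: le_trans (normc_trigpoly_le _ _ _) _.
  apply: le_trans (l1norm_le_energy (dyadic_decay_ge0 rr s A0) (f_decay s)) _.
  rewrite exprS /dyadic_decay (_ : z ^+ s = sqrt2 ^+ s * 2 `^ (- (s%:R * rr))).
    by rewrite (_ : _ * _ * _ = 2 * sqrt2 * A * (sqrt2 ^+ s * 2 `^ (- (s%:R * rr)))) //; ring.
  rewrite /z -powR_mulrn ?powR_ge0 // -powRrM sqrt2X_powR -powRD_gt0 //.
  by congr (_ `^ _); ring.
rewrite sumEFin lee_fin -mulr_sumr ler_wpM2l //; first by rewrite !mulr_ge0 ?sqrtr_ge0.
by rewrite -(big_mkord predT (fun s => z ^+ s)) sum_geom_le.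
Qed.

Lemma em_fun_decay_le f A rr (q n m : nat) (B : R) : periodic2pi f -> torus_L1 f -> 0 <= A ->
  decaying_blocks A rr f ->
  (0 < q)%N -> (1 < n)%N -> (q.+1 * 2 ^ n.+3 <= m)%N ->
  (forall N, \sum_(n.+1 <= u < N) sparse_error (block_level q n u) (dyadic_decay A rr u) <= B) ->
  (em_fun m f <= (180 * B)%:E)%E.
Proof.
move=> fp fi A0 f_decay q0 n1 nm errB; pose S := (n + q * n.+2)%N.
have nS : (n < S)%N by rewrite /S -{1}[n]addn0 ltn_add2l muln_gt0 q0.
apply: (em_fun_le_dyadic fp fi n1 nS _ _ f_decay _ errB).
- by move=> u; exact: block_level_gt.
- by move=> u; exact: dyadic_decay_ge0.
apply: leq_trans nm; rewrite mulSn; apply: leq_add.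
  by rewrite ltn_exp2l.
apply: leq_trans (sum_level_size_le n q0); rewrite -/S [leqRHS]big_ltn //.
exact: leq_addl.
Qed.

Lemma le_mul_powR_div (a b m rr : R) : 0 <= a -> 0 < m -> m <= b -> 0 <= rr ->
  a <= a * b `^ rr * m `^ (- rr).
Proof.
move=> a0 m0 mb rr0; rewrite -mulrA ler_peMr // powRN ler_pdivlMr ?powR_gt0 // mul1r.
by rewrite ge0_ler_powR ?nnegrE ?(ltW m0) // (le_trans (ltW m0)).
Qed.

Lemma em_fun_le_powR A rr : 0 <= A -> 2^-1 < rr -> exists2 K : R, 0 < K &
  forall f m, periodic2pi f -> torus_L1 f ->
  decaying_blocks A rr f -> (0 < m)%N -> (em_fun m f <= (K * m%:R `^ (- rr))%:E)%E.
Proof.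
move=> A0 rr2; have rr0 : 0 <= rr by lra.
have [q [B [q0 B0 err_le]]] := sum_sparse_error_decay_le A0 rr2.
pose b := (q.+1 * 2 ^ 3)%N; have b0 : (0 < b)%N by rewrite muln_gt0 expn_gt0.
pose K1 : R := 2 * sqrt2 * A / (1 - 2 `^ (2^-1 - rr)).
have K10 : 0 <= K1.
  rewrite divr_ge0 ?mulr_ge0 ?sqrtr_ge0 // subr_ge0.
  by have /andP[_ /ltW] : 0 < (2 : R) `^ (2^-1 - rr) < 1 by apply: powR2_bounds; rewrite subr_lt0.
pose Ksmall := K1 * (b * 4)%:R `^ rr; pose Klarge := 180 * B * (b * 2)%:R `^ rr.
have Ksmall0 : 0 <= Ksmall by rewrite mulr_ge0 ?powR_ge0.
have Klarge0 : 0 <= Klarge by rewrite mulr_ge0 ?powR_ge0 ?mulr_ge0.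
exists (Ksmall + Klarge + 1) => [|f m fp fi f_decay m0]; first by rewrite ltr_wpDl // addr_ge0.
have M0 : (0 : R) < m%:R by rewrite ltr0n.
have [bm|mb] := leqP (b * 4) m; last first.
  apply: le_trans (em_fun_le_Binf1_norm f m) _.
  apply: le_trans (Binf1_norm_decay_le fp fi A0 rr2 f_decay) _; rewrite lee_fin.
  apply: le_trans (le_mul_powR_div (b := (b * 4)%:R) K10 M0 _ rr0) _; first by rewrite ler_nat ltnW.
  by rewrite ler_wpM2r ?powR_ge0 // -addrA lerDl addr_ge0.
have [n [n1 nm mn]] := exists_dyadic_scale b0 bm.
apply: le_trans (em_fun_decay_le fp fi A0 f_decay q0 n1 _ (err_le n)) _.
  by rewrite -[n.+3]/(3 + n)%N expnD mulnA.
have -> : 2 `^ (- (n%:R * rr)) = (2 ^ n)%:R `^ (- rr) :> R by rewrite -mulrN powRrM powR2_nat.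
have X0 : (0 : R) < (2 ^ n)%:R by rewrite ltr0n expn_gt0.
rewrite lee_fin mulrA; apply: (@le_trans _ _ (Klarge * m%:R `^ (- rr))).
  rewrite -[leRHS]mulrA; apply: ler_wpM2l; first by rewrite mulr_ge0.
  rewrite !powRN ler_pdivlMr ?powR_gt0 // mulrC ler_pdivrMr ?powR_gt0 //.
  rewrite -powRM // -natrM ge0_ler_powR ?nnegrE // ler_nat.
  by rewrite -mulnA -expnS.
by rewrite ler_wpM2r ?powR_ge0 // addrAC lerDr addr_ge0.
Qed.

Lemma em_class_besov_le (p theta : \bar R) (r : R) (k : nat) : (1 <= p)%E -> (1 <= theta)%E ->
  Num.max (einv p) 2^-1 < r -> exists2 K : R, 0 < K & forall m, (0 < m)%N ->
    (em_class m (besov_class k r p theta) <= (K * m%:R `^ (- (r - l2_loss p)))%:E)%E.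
Proof.
move=> p1 th1; rewrite gt_max => /andP[rp r2].
have rr2 : 2^-1 < r - l2_loss p by rewrite /l2_loss; case: (leP (einv p - 2^-1) 0) => _; lra.
have r0 : 0 <= r by lra.
have [A A0 class_decay] := besov_class_decaying_blocks k p1 th1 r0.
have [K K0 em_le] := em_fun_le_powR (ltW A0) rr2.
exists K => // m m0; apply: ub_ereal_sup => _ [f fB <-].
exact: em_le fB.1.1 (in_Lp_torus_L1 p1 fB.1) (class_decay f fB) m0.
Qed.

End upper_estimate.

(** * Lower bound *)

Section approximation_from_below.
Variable R : realType.
Local Notation C := R[i].
Implicit Types (s m D : nat) (n : int) (c phi : int -> C) (Th : seq int) (H : R).

Lemma size_filter_notin_ge (T : eqType) (s t : seq T) : uniq s ->
  (size s - size t <= size [seq x <- s | x \notin t])%N.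
Proof.
move=> us; rewrite leq_subLR -(count_predC (mem t) s) size_filter leq_add2r -size_filter.
by apply: uniq_leq_size; [exact: filter_uniq|move=> x; rewrite mem_filter => /andP[]].
Qed.

Definition plateau s n : bool := (2 ^ s.+1)%:Z <= n < (2 ^ s.+1 + 2 ^ s)%:Z.

Lemma plateau_energy_ge s c Th H : 0 <= H -> (2 * size Th <= 2 ^ s)%N ->
  (forall n, plateau s n -> n \notin Th -> H <= normc (c n)) ->
  (2 ^ s)%:R * H ^+ 2 / 8 <= energy (2 ^ s.+2) (fmult (sigma_coef s.+1) c).
Proof.
move=> H0 Ths cH; pose L := [seq (2 ^ s.+1 + j)%:Z | j <- iota 0 (2 ^ s)].
have uL : uniq L by rewrite map_inj_uniq ?iota_uniq // => i j; lia.
have L_plateau n : n \in L -> plateau s n.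
  by move=> /mapP[j]; rewrite mem_iota /plateau => js ->; lia.
pose L' := [seq n <- L | n \notin Th].
have L'_size : (2 ^ s)%:R <= 2 * (size L')%:R :> R.
  rewrite -natrM ler_nat; have := size_filter_notin_ge Th uL.
  by rewrite size_map size_iota -/L'; move: (size L') (size Th) (2 ^ s)%N Ths => a b N; lia.
apply: (@le_trans _ _ (\sum_(n <- L') normc (fmult (sigma_coef s.+1) c n) ^+ 2)); last first.
  apply: ler_sum_uniq_subset; rewrite ?filter_uniq ?freqs_uniq //; last by move=> n; exact: sqr_ge0.
  move=> n; rewrite mem_filter mem_freqs => /andP[_ /L_plateau].
  by rewrite /plateau !expnS; lia.
apply: (@le_trans _ _ (\sum_(n <- L') (H / 2) ^+ 2)).
  rewrite big_const_seq count_predT iter_addr_0 -[leRHS]mulr_natl expr_div_n.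
  by have := ler_wpM2r (sqr_ge0 H) L'_size; lra.
rewrite big_seq [leRHS]big_seq; apply: ler_sum => n.
rewrite mem_filter => /andP[nTh /L_plateau ns].
have sigma_ge : (2^-1 : R) <= sigma_coef s.+1 n.
  by apply: sigma_coef_ge_half; move: ns; rewrite /plateau; lia.
rewrite lerXn2r ?nnegrE ?normc_ge0 ?divr_ge0 // normcM normc_real mulrC.
apply: ler_pM; rewrite ?cH //.
exact: le_trans sigma_ge (ler_norm _).
Qed.

Lemma sum_expi_trigpoly Th c : uniq Th -> exists (E : nat) (q : int -> C),
  [/\ bandlimited E q, forall n, n \notin Th -> q n = 0 &
      (fun x => \sum_(n <- Th) c n * expi n x) = trigpoly E q].
Proof.
move=> uTh; pose E := \max_(n <- Th) `|n|%N.
pose q n : C := if n \in Th then c n else 0.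
have qTh n : n \notin Th -> q n = 0 by rewrite /q => /negbTE ->.
have qE : bandlimited E q.
  by move=> n nE; apply: qTh; apply: contraL nE => nTh; rewrite -leqNgt leq_bigmax_seq.
exists E, q; split=> //; apply/funext => x; rewrite (trigpoly_support x uTh qE qTh).
by apply: eq_big_seq => n nTh; rewrite /q nTh.
Qed.

Lemma le_em_fun_trigpoly D phi s m H : bandlimited D phi -> 0 <= H -> (2 * m <= 2 ^ s)%N ->
  (forall n, plateau s n -> H <= normc (phi n)) ->
  ((H * Num.sqrt (2 ^ s)%:R / 4)%:E <= em_fun m (trigpoly D phi))%E.
Proof.
move=> phiD H0 ms phiH; apply: le_ereal_inf_tmp => _ [Th [c [uTh Th_size ->]]].
have [E [q [qE qTh sumE]]] := sum_expi_trigpoly c uTh.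
have -> : (fun x => trigpoly D phi x - \sum_(n <- Th) c n * expi n x) =
    (fun x => trigpoly D phi x - trigpoly E q x) by rewrite -sumE.
apply: le_trans (Tnorm_sigma_blk_le_Binf1 _ s.+1).
rewrite (sigma_blkB_trigpoly _ (@trigpoly_periodic _ _ _) (@torus_L1_trigpoly _ _ _) qE).
apply: energy_le_Tnorm_oo; first by rewrite divr_ge0 // mulr_ge0 ?sqrtr_ge0.
have residual_ge n : plateau s n -> n \notin Th -> H <= normc (fhat (trigpoly D phi) n - q n).
  by move=> ns nTh; rewrite qTh // subr0 fhat_trigpoly // phiH.
have Ths : (2 * size Th <= 2 ^ s)%N by rewrite Th_size.
apply: le_trans (plateau_energy_ge H0 Ths residual_ge).
rewrite expr_div_n exprMn sqr_sqrtr // mulrC.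
by have := mulr_ge0 (ler0n R (2 ^ s)) (sqr_ge0 H); lra.
Qed.

End approximation_from_below.

Section log_logistic_density.
Variable R : realType.
Local Notation leb := (@lebesgue_measure R).
Implicit Types (de w t a b K : R).

Definition log_logistic_pdf de w t : R := w * de * t `^ (de - 1) / (1 + w * t `^ de) ^+ 2.

Lemma log_logistic_den_gt0 de w t : 0 < w -> 0 < 1 + w * t `^ de.
Proof. by move=> w0; rewrite ltr_pwDl // mulr_ge0 ?powR_ge0 // ltW. Qed.

Lemma log_logistic_pdf_ge0 de w t : 0 <= de -> 0 <= w -> 0 <= log_logistic_pdf de w t.
Proof. by move=> de0 w0; rewrite divr_ge0 ?sqr_ge0 // !mulr_ge0 ?powR_ge0. Qed.

Lemma is_derive_log_logistic de w t : 0 < w -> 0 < t ->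
  is_derive t 1 (fun s => - (1 + w * s `^ de)^-1) (log_logistic_pdf de w t).
Proof.
move=> w0 t0; have den0 := log_logistic_den_gt0 de t w0.
have den_derive : is_derive t 1 (fun s => 1 + w * s `^ de) (0 + w *: (de * t `^ (de - 1))).
  exact: (is_deriveD (is_derive_cst (1 : R) t 1) (is_deriveZ w (is_derive1_powR de t0))).
apply: is_derive_eq (is_deriveN (@is_deriveV _ _ t _ 1 (lt0r_neq0 den0) den_derive)) _.
by rewrite add0r /log_logistic_pdf /GRing.scale /=; field; rewrite gt_eqF.
Qed.

Lemma continuous_powR_gt0 (r t : R) : 0 < t -> {for t, continuous (@powR R ^~ r)}.
Proof.
move=> t0; apply: differentiable_continuous; apply/derivable1_diffP.
by apply: derivable_powR; rewrite in_itv /= andbT.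
Qed.

Lemma continuous_log_logistic_pdf de w t : 0 < w -> 0 < t ->
  {for t, continuous (log_logistic_pdf de w)}.
Proof.
move=> w0 t0; have den0 := log_logistic_den_gt0 de t w0.
have den_cont : {for t, continuous (fun s : R => 1 + w * s `^ de)}.
  apply: cvgD; first exact: cvg_cst.
  by apply: cvgM; [exact: cvg_cst|exact: continuous_powR_gt0].
apply: cvgM; first by apply: cvgM; [exact: cvg_cst|exact: continuous_powR_gt0].
by apply: cvgV; [rewrite expf_neq0 // gt_eqF|exact: (cvgM den_cont den_cont)].
Qed.

Lemma integral_log_logistic_pdf_le1 de w a b : 0 < w -> 0 < a -> a < b ->
  (\int[leb]_(t in `[a, b]) (log_logistic_pdf de w t)%:E <= 1)%E.
Proof.
move=> w0 a0 ab; have b0 : 0 < b by exact: lt_trans ab.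
pose F (s : R) := - (1 + w * s `^ de)^-1.
have dF t : 0 < t -> derivable F t 1.
  by move=> t0; have [] := is_derive_log_logistic de w0 t0.
have cF t : 0 < t -> {for t, continuous F}.
  by move=> t0; apply: differentiable_continuous; apply/derivable1_diffP; exact: dF.
rewrite (@continuous_FTC2 _ _ F) //.
- rewrite -EFinB lee_fin /F opprK.
  have : (1 + w * a `^ de)^-1 <= 1.
    by rewrite invf_le1 ?log_logistic_den_gt0 // lerDl mulr_ge0 ?powR_ge0 ?(ltW w0).
  have : 0 < (1 + w * b `^ de)^-1 by rewrite invr_gt0 log_logistic_den_gt0.
  by move: (_^-1) (_^-1) => u v; lra.
- apply: continuous_in_subspaceT => t; rewrite inE /= in_itv /= => /andP[ta _].
  by apply: continuous_log_logistic_pdf => //; exact: lt_le_trans ta.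
- split.
  + by move=> t; rewrite in_itv /= => /andP[ta _]; apply: dF; exact: lt_trans ta.
  + by apply: cvg_at_right_filter; exact: cF.
  + by apply: cvg_at_left_filter; exact: cF.
- move=> t; rewrite in_itv /= => /andP[ta _]; rewrite derive1E.
  by have [] := is_derive_log_logistic de w0 (lt_trans a0 ta).
Qed.

Lemma bigcup_itv_inv_nat :
  `]0%R, +oo[%classic = \bigcup_(i : nat) (`[i.+2%:R^-1, i.+2%:R]%classic : set R).
Proof.
apply/seteqP; split=> [t|t [i _]] /=; rewrite !in_itv /= ?andbT; last first.
  by move=> /andP[+ _]; apply: lt_le_trans; rewrite invr_gt0.
move=> t0; have tV : 0 < t^-1 by rewrite invr_gt0.
exists (Num.truncn (t + t^-1)) => //=; rewrite in_itv /=.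
set N := (Num.truncn _).+2; have tN : t + t^-1 < N%:R.
  by apply: lt_trans (truncnS_gt _) _; rewrite ltr_nat.
apply/andP; split; last by lra.
by rewrite -[leRHS]invrK lef_pV2 ?posrE //; lra.
Qed.

Lemma ge0_integral_pos_axis_le (f : R -> \bar R) K :
  measurable_fun (`]0%R, +oo[ : set R) f -> (forall t, 0 < t -> (0 <= f t)%E) ->
  (forall a b, 0 < a -> a < b -> (\int[leb]_(t in `[a, b]) f t <= K%:E)%E) ->
  (\int[leb]_(t in `]0%R, +oo[) f t <= K%:E)%E.
Proof.
move=> mf f0 fK; pose F (i : nat) : set R := `[i.+2%:R^-1, i.+2%:R]%classic.
have F_gt0 i t : F i t -> 0 < t.
  by rewrite /F /= in_itv /= => /andP[h _]; apply: lt_le_trans h; rewrite invr_gt0.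
rewrite bigcup_itv_inv_nat.
have cvgF : (\int[leb]_(x in F i) f x @[i --> \oo] --> \int[leb]_(x in \bigcup_i F i) f x)%E.
  apply: ge0_nondecreasing_set_cvg_integral.
  - apply/nondecreasing_seqP => i; apply/subsetPset => t.
    rewrite /F /= !in_itv /= => /andP[it ti]; apply/andP; split.
      by apply: le_trans it; rewrite lef_pV2 ?posrE // ler_nat.
    by apply: le_trans ti _; rewrite ler_nat.
  - by move=> i; exact: measurable_itv.
  - by move=> i; apply: measurable_funS mf => // t /F_gt0; rewrite /= in_itv /= andbT.
  - by move=> i t /F_gt0; exact: f0.
rewrite -(cvg_lim _ cvgF) //; apply: lime_le; first by apply/cvg_ex; eexists; exact: cvgF.
apply: nearW => i; apply: fK; rewrite ?invr_gt0 //.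
by rewrite (@lt_trans _ _ 1) ?invf_lt1 ?ltr1n.
Qed.

End log_logistic_density.

Section besov_norm_upper_bound.
Variable R : realType.
Local Notation C := R[i].
Local Notation leb := (@lebesgue_measure R).
Implicit Types (y t : R).

Section kernel.
Variables (k : nat) (r de : R).
Hypotheses (de0 : 0 < de) (der : de <= r) (dek : de <= k%:R - r).

Definition besov_kernel y : R := y `^ (- r) * Num.min 1 y ^+ k.

Lemma besov_kernel_ge0 y : 0 < y -> 0 <= besov_kernel y.
Proof. by move=> y0; rewrite mulr_ge0 ?powR_ge0 // exprn_ge0 // le_min ler01 ltW. Qed.

Lemma besov_kernel_le y : 0 < y -> besov_kernel y <= Num.min (y `^ de) (y `^ de)^-1.
Proof.
move=> y0; rewrite /besov_kernel -powRN; have [y1|/ltW y1] := leP 1 y.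
  rewrite expr1n mulr1 le_min; apply/andP; split; apply: ler_powR => //; move: de0 der; lra.
rewrite -powR_mulrn ?(ltW y0) // -powRD_gt0 // le_min.
by apply/andP; split; apply: ger_powR; rewrite ?y0 //; move: de0 der dek; lra.
Qed.

Lemma min_inv_le (z : R) : 0 < z -> Num.min z z^-1 <= 4 * (z / (1 + z) ^+ 2).
Proof.
move=> z0; have den0 : 0 < (1 + z) ^+ 2 by rewrite exprn_gt0 // addr_gt0.
rewrite mulrA ler_pdivlMr //; have [z1|/ltW z1] := leP z 1.
  apply: (@le_trans _ _ (z * (1 + z) ^+ 2)); first by rewrite ler_wpM2r ?(ltW den0) // ge_min lexx.
  by nra.
apply: (@le_trans _ _ (z^-1 * (1 + z) ^+ 2)).
  by rewrite ler_wpM2r ?(ltW den0) // ge_min lexx orbT.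
by rewrite ler_pdivrMl //; nra.
Qed.

Lemma besov_kernel_le1 y : 0 < y -> besov_kernel y <= 1.
Proof.
move=> y0; apply: le_trans (besov_kernel_le y0) _; have z0 : 0 < y `^ de by exact: powR_gt0.
by rewrite ge_min; have [//|/ltW] := leP (y `^ de) 1; rewrite invf_le1.
Qed.

Lemma besov_kernel_powR_le th y : 1 <= th -> 0 < y ->
  besov_kernel y `^ th <= 4 * (y `^ de / (1 + y `^ de) ^+ 2).
Proof.
move=> th1 y0; have z0 : 0 < y `^ de by exact: powR_gt0.
apply: le_trans (min_inv_le z0); apply: le_trans (besov_kernel_le y0).
have K0 := besov_kernel_ge0 y0; have [->|Kn] := eqVneq (besov_kernel y) 0.
  by rewrite powR0 // gt_eqF // (lt_le_trans ltr01).
rewrite -[leRHS](powRr1 K0) ger_powR // lt_neqAle eq_sym Kn K0.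
exact: besov_kernel_le1.
Qed.

Lemma besov_kernel_log_logistic_le th D t : 1 <= th -> 0 < D -> 0 < t ->
  besov_kernel (D * t) `^ th / t <= 4 / de * log_logistic_pdf de (D `^ de) t.
Proof.
move=> th1 D0 t0; have Dt0 : 0 < D * t by rewrite mulr_gt0.
rewrite ler_pdivrMr //; apply: le_trans (besov_kernel_powR_le th1 Dt0) _.
rewrite powRM ?(ltW D0) ?(ltW t0) // /log_logistic_pdf; have w0 : 0 < D `^ de by exact: powR_gt0.
rewrite -(mulr_powRB1 (ltW t0) de0).
have z0 : 0 < t `^ (de - 1) by exact: powR_gt0.
rewrite le_eqVlt; apply/orP; left; apply/eqP; field.
by rewrite !gt_eqF ?addr_gt0 ?mulr_gt0.
Qed.

Section function.
Variables (p : \bar R) (f : R -> C) (A D : R).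
Hypotheses (A0 : 0 < A) (D0 : 0 < D).
Hypothesis omega_le : forall t, 0 < t ->
  (omega k p f t <= (A * Num.min 1 (D * t) ^+ k)%:E)%E.

Lemma scaled_omega_le_besov_kernel t : 0 < t ->
  ((t `^ (- r))%:E * omega k p f t <= (A * D `^ r * besov_kernel (D * t))%:E)%E.
Proof.
move=> t0; apply: (@le_trans _ _ ((t `^ (- r))%:E * (A * Num.min 1 (D * t) ^+ k)%:E)%E).
  by rewrite lee_wpmul2l ?lee_fin ?powR_ge0 // omega_le.
rewrite -EFinM lee_fin /besov_kernel powRM ?(ltW D0) ?(ltW t0) // [D `^ (- r)]powRN.
rewrite le_eqVlt; apply/orP; left; apply/eqP; field.
by rewrite gt_eqF // powR_gt0.
Qed.

Lemma besov_integrand_le_log_logistic th t : 1 <= th -> 0 < t ->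
  (besov_integrand k r p th f t <=
   ((A * D `^ r) `^ th * (4 / de) * log_logistic_pdf de (D `^ de) t)%:E)%E.
Proof.
move=> th1 t0; have Dt0 : 0 < D * t by rewrite mulr_gt0.
have AD0 : 0 <= A * D `^ r by rewrite mulr_ge0 ?powR_ge0 // ltW.
apply: (@le_trans _ _ ((A * D `^ r * besov_kernel (D * t))%:E `^ th * (t^-1)%:E)%E).
  rewrite lee_wpmul2r ?lee_fin ?invr_ge0 ?(ltW t0) //.
  apply: le_poweR; rewrite ?scaled_omega_ge0 ?scaled_omega_le_besov_kernel //.
  exact: le_trans th1.
rewrite poweR_EFin -EFinM lee_fin powRM ?besov_kernel_ge0 // -!mulrA ler_wpM2l ?powR_ge0 //.
by rewrite [leRHS]mulrA besov_kernel_log_logistic_le.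
Qed.

Lemma besov_integral_le th : 1 <= th ->
  (\int[leb]_(t in `]0%R, +oo[) besov_integrand k r p th f t <=
   ((A * D `^ r) `^ th * (4 / de))%:E)%E.
Proof.
move=> th1; set K := _ * _; have w0 : 0 < D `^ de by exact: powR_gt0.
have K0 : 0 <= K by rewrite mulr_ge0 ?powR_ge0 // divr_ge0 // ltW.
apply: ge0_integral_pos_axis_le; first exact: measurable_besov_integrand.
  by move=> t; exact: besov_integrand_ge0.
move=> a b a0 ab; have itv_gt0 t : `[a, b]%classic t -> 0 < t.
  by rewrite /= in_itv /= => /andP[ta _]; exact: lt_le_trans ta.
have pdf_ge0 t : `[a, b]%classic t -> (0 <= (log_logistic_pdf de (D `^ de) t)%:E)%E.
  by move=> _; rewrite lee_fin log_logistic_pdf_ge0 ?(ltW w0) ?(ltW de0).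
have mpdf : measurable_fun `[a, b] (fun t => (log_logistic_pdf de (D `^ de) t)%:E).
  apply/measurable_EFinP; apply: subspace_continuous_measurable_fun => //.
  apply: continuous_in_subspaceT => t; rewrite inE => /itv_gt0 t0.
  exact: continuous_log_logistic_pdf.
apply: (@le_trans _ _ (\int[leb]_(t in `[a, b]) (K%:E * (log_logistic_pdf de (D `^ de) t)%:E))%E).
  apply: ge0_le_integral => //.
  - by move=> t /itv_gt0; exact: besov_integrand_ge0.
  - apply: measurable_funS (@measurable_besov_integrand R k r p th f) => // t /itv_gt0.
    by rewrite /= in_itv /= andbT.
  - exact: measurable_funeM.
  - by move=> t /itv_gt0; rewrite -EFinM; exact: besov_integrand_le_log_logistic.
rewrite (ge0_integralZl leb _ mpdf pdf_ge0) // -[leRHS]mule1 lee_wpmul2l //.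
exact: integral_log_logistic_pdf_le1.
Qed.

Lemma besov_seminorm_le theta : (1 <= theta)%E ->
  (besov_seminorm k r p theta f <= (A * D `^ r * (4 / de + 1))%:E)%E.
Proof.
have d4 : 0 < 4 / de by rewrite divr_gt0.
have AD0 : 0 <= A * D `^ r by rewrite mulr_ge0 ?powR_ge0 // ltW.
case: theta => [th| |//] th1; last first.
  apply: ub_ereal_sup => _ [t + <-]; rewrite /= in_itv /= andbT => t0.
  apply: le_trans (scaled_omega_le_besov_kernel t0) _; rewrite lee_fin ler_wpM2l //.
  by apply: le_trans (besov_kernel_le1 _) _; [rewrite mulr_gt0|lra].
rewrite lee_fin in th1; have th0 : 0 < th by exact: lt_le_trans th1.
have thV0 : 0 <= th^-1 by rewrite invr_ge0 ltW.
apply: le_trans (le_poweR thV0 (besov_integral_ge0 _ _ _ _ _) (besov_integral_le th1)) _.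
rewrite poweR_EFin lee_fin powRM ?powR_ge0 ?(ltW d4) // powRK ?gt_eqF // ler_wpM2l //.
apply: (@le_trans _ _ ((4 / de + 1) `^ th^-1)).
  by rewrite ge0_ler_powR ?nnegrE ?(ltW d4) //; lra.
have d41 : 1 <= 4 / de + 1 by lra.
by rewrite -[leRHS](powRr1 (le_trans ler01 d41)) ler_powR // invf_le1.
Qed.

End function.
End kernel.
End besov_norm_upper_bound.

Section golay_pairs.
Variable R : realType.
Local Notation C := R[i].
Implicit Types (N n : nat) (p q : int -> C) (x : R).

Definition unimodular_block N p := forall j, normc (p j) = (0 <= j < N%:Z)%R%:R.

Lemma unimodular_block_eq0 N p j : unimodular_block N p -> ~~ (0 <= j < N%:Z) -> p j = 0.
Proof. by move=> pN jN; apply: eq0_normc; rewrite pN (negbTE jN). Qed.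

Lemma bandlimited_unimodular_block N p : unimodular_block N p -> bandlimited N p.
Proof. by move=> pN j jN; apply: unimodular_block_eq0 pN _; apply/negP; lia. Qed.

Lemma unimodular_block_cat N p q (a : C) : unimodular_block N p -> unimodular_block N q ->
  normc a = 1 -> unimodular_block (N + N) (fun j => p j + a * q (j - N%:Z)).
Proof.
move=> pN qN a1 j; have [jN|jN] := ltP j N%:Z.
  rewrite (unimodular_block_eq0 qN) ?mulr0 ?addr0 ?pN; last by apply/negP; lia.
  by congr ((nat_of_bool _)%:R); apply/idP/idP; lia.
rewrite (unimodular_block_eq0 pN) ?add0r; last by apply/negP; lia.
by rewrite normcM a1 mul1r qN; congr ((nat_of_bool _)%:R); apply/idP/idP; lia.
Qed.

Definition golay_pair N p q := [/\ unimodular_block N p, unimodular_block N q &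
  forall x, normc (trigpoly N p x) ^+ 2 + normc (trigpoly N q x) ^+ 2 = (2 * N)%:R].

Lemma golay_pair1 : golay_pair 1 (fun j => (j == 0)%:R) (fun j => (j == 0)%:R).
Proof.
have delta1 : unimodular_block 1 (fun j => (j == 0)%:R).
  by move=> j; rewrite normc_nat; congr ((nat_of_bool _)%:R); apply/idP/idP; lia.
have delta_poly x : trigpoly 1 (fun j => (j == 0)%:R) x = 1 :> C.
  rewrite /trigpoly (@sum_freqs_single _ _ _ 0) ?eqxx ?expi0 ?mulr1 //.
  - by move=> j /(bandlimited_unimodular_block delta1) ->; rewrite mul0r.
  - by move=> j /negbTE ->; rewrite mul0r.
by split=> // x; rewrite delta_poly normc1 expr1n.
Qed.

Lemma parallelogram_normc (u v : C) :
  normc (u + v) ^+ 2 + normc (u - v) ^+ 2 = 2 * (normc u ^+ 2 + normc v ^+ 2).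
Proof. by rewrite -[v in u + v]opprK !sqr_normcB normcN rmorphN mulrN raddfN /=; ring. Qed.

(* The Rudin-Shapiro step [(P, Q) -> (P + z ^ N Q, P - z ^ N Q)]. *)
Lemma golay_pair_double N p q : golay_pair N p q ->
  golay_pair (N + N) (fun j => p j + 1 * q (j - N%:Z)) (fun j => p j + (-1) * q (j - N%:Z)).
Proof.
move=> [pN qN pqN].
split=> [||x].
- by apply: unimodular_block_cat; rewrite ?normc1.
- by apply: unimodular_block_cat; rewrite ?normcN ?normc1.
have pE : trigpoly (N + N) p x = trigpoly N p x.
  by apply: trigpoly_widen; [exact: leq_addr|exact: bandlimited_unimodular_block].
have qE : trigpoly (N + N) (fun j => q (j - N%:Z)) x = expi N x * trigpoly N q x.
  by rewrite -trigpoly_modulate //; exact: bandlimited_unimodular_block.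
rewrite !trigpolyD !trigpolyZ pE qE mul1r mulN1r parallelogram_normc.
by rewrite normcM normc_expi mul1r pqN -natrM addnn -mul2n.
Qed.

Lemma exists_golay_pair n : exists p q, golay_pair (2 ^ n) p q.
Proof.
elim: n => [|n [p [q pq]]]; first by do 2 eexists; exact: golay_pair1.
by rewrite expnS mul2n -addnn; do 2 eexists; exact: golay_pair_double pq.
Qed.

End golay_pairs.

Section extremal_blocks.
Variable R : realType.
Local Notation C := R[i].
Implicit Types (p : \bar R) (s i k : nat) (phi : int -> C) (h eta : R).

Definition extremal_block p s phi :=
  [/\ bandlimited (2 ^ s.+2) phi,
      forall n, plateau s n -> 1 <= normc (phi n) &
      forall i h eta, 0 < eta -> symbol_bounded (2 ^ s.+3) h eta ->
        (Tnorm p (Deltak i h (trigpoly (2 ^ s.+2) phi)) <=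
          (27 * (2 * eta) ^+ i * (2 ^ s)%:R `^ (2^-1 - l2_loss p))%:E)%E].

Lemma exists_extremal_block_ge2 p s : (1 <= p)%E -> einv p <= 2^-1 ->
  exists phi, extremal_block p s phi.
Proof.
move=> p1 p2; have [q [q' [qN _ q_sum]]] := exists_golay_pair R s.+1.
have qb := bandlimited_unimodular_block qN.
pose phi n := q (n - (2 ^ s.+1)%:Z).
have degE : (2 ^ s.+2 = 2 ^ s.+1 + `|(2 ^ s.+1)%:Z|)%N by rewrite expnS mul2n -addnn.
have phib : bandlimited (2 ^ s.+2) phi.
  by rewrite degE => n nN; apply: qb; move: nN; move: (2 ^ s.+1)%N => N; lia.
have phi_sup x : normc (trigpoly (2 ^ s.+2) phi x) <= 2 * Num.sqrt (2 ^ s)%:R.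
  rewrite -ler_sqr ?nnegrE ?normc_ge0 ?mulr_ge0 ?sqrtr_ge0 // exprMn sqr_sqrtr ?ler0n //.
  rewrite degE trigpoly_modulate // normcM normc_expi mul1r.
  rewrite -natrX -natrM -expnD [(2 ^ (2 + s))%N]expnS -(q_sum x).
  by rewrite lerDl sqr_ge0.
exists phi; split=> [//|n|i h eta eta0 symbol].
  rewrite /plateau /phi qN => ns; rewrite (_ : (_ <= _ < _) = true) //.
  by move: ns; rewrite expnS; move: (2 ^ s)%N => N; lia.
have -> : l2_loss p = 0 by rewrite /l2_loss max_r // subr_le0.
rewrite subr0 powR12_sqrt ?ler0n //; apply: Tnorm_le_bounded => //.
  by rewrite Deltak_trigpoly; exact: cmeasurable_trigpoly.
move=> x; apply: le_trans (bernstein i _ phib phi_sup (ltW eta0) _ x) _.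
- by rewrite expn_gt0.
- by move=> n nD; apply: symbol; rewrite expnS.
have e0 : 0 <= (2 * eta) ^+ i by rewrite exprn_ge0 // mulr_ge0 // ltW.
by have := mulr_ge0 e0 (sqrtr_ge0 ((2 ^ s)%:R : R)); lra.
Qed.

Lemma normc_modulated_vp_le a (l : nat) (x : R) : (0 < l)%N ->
  normc (modulated_vp a l x) <= 5 * l%:R.
Proof.
move=> l0; rewrite normcM normc_expi mul1r vallee_poussinE.
apply: le_trans (normc_trigpoly_le _ _ _) _.
apply: (@le_trans _ _ (\sum_(n <- freqs (2 * l)) 1)).
  apply: ler_sum => n _; rewrite normc_real ger0_norm ?vp_coef_ge0 //.
  exact: vp_coef_le1.
rewrite big_const_seq count_predT iter_addr_0 size_freqs -natrM ler_nat.
by lia.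
Qed.

Lemma Tnorm1_Deltak_modulated_vp_le k h eta a (l : nat) : (0 < l)%N -> 0 <= eta ->
  symbol_bounded (2 * l + `|a|) h eta ->
  (Tnorm 1 (Deltak k h (modulated_vp a l)) <= (3 * (2 * eta) ^+ k)%:E)%E.
Proof.
move=> l0 eta0 symbol; rewrite Tnorm1E.
apply: (@integral_torus_le_grid_mean _ (2 * (2 * l + `|a|)).+1) => //.
- move=> x; congr normc; apply: Deltak_periodic; rewrite modulated_vp_trigpoly.
  exact: trigpoly_periodic.
- apply: measurable_normc; rewrite modulated_vp_trigpoly Deltak_trigpoly.
  exact: cmeasurable_trigpoly.
- by move=> x; exact: normc_ge0.
- by move=> x; exact: grid_mean_Deltak_modulated_vp_le.
Qed.

Lemma exists_extremal_block_lt2 p s : (1 <= p)%E -> 2^-1 < einv p ->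
  exists phi, extremal_block p s phi.
Proof.
move=> p1 p2; pose a := (2 ^ s.+1)%:Z; pose l := (2 ^ s)%N.
have l0 : (0 < l)%N by rewrite expn_gt0.
pose phi n : C := (vp_coef l (n - a))%:C.
have degE : (2 ^ s.+2 = 2 * l + `|a|)%N by rewrite /a /l /= !expnS; lia.
have phiE : trigpoly (2 ^ s.+2) phi = modulated_vp a l by rewrite modulated_vp_trigpoly degE.
have phib : bandlimited (2 ^ s.+2) phi.
  by rewrite degE => n nN; apply: (@bandlimited_vp_coef R l); move: nN; lia.
exists phi; split=> [//|n|i h eta eta0 symbol].
  rewrite /plateau /phi => ns; rewrite vp_coef_eq1 ?normc1 //.
  by move: ns; rewrite /a /l expnS; move: (2 ^ s)%N => N; lia.
have X0 : 0 < (2 * eta) ^+ i by rewrite exprn_gt0 // mulr_gt0.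
have L0 : (0 : R) < l%:R by rewrite ltr0n.
have sup_le x : normc (Deltak i h (trigpoly (2 ^ s.+2) phi) x) <= 27 * (2 * eta) ^+ i * l%:R.
  have phi_sup y : normc (trigpoly (2 ^ s.+2) phi y) <= 5 * l%:R.
    by rewrite phiE normc_modulated_vp_le.
  apply: le_trans (bernstein i _ phib phi_sup (ltW eta0) _ x) _; first by rewrite expn_gt0.
    by move=> n nD; apply: symbol; rewrite expnS.
  by have := mulr_ge0 (ltW X0) (ltW L0); lra.
have L1_le : (Tnorm 1 (Deltak i h (trigpoly (2 ^ s.+2) phi)) <= (27 * (2 * eta) ^+ i)%:E)%E.
  rewrite phiE; apply: le_trans (Tnorm1_Deltak_modulated_vp_le i l0 (ltW eta0) _) _.
    by move=> n nD; apply: symbol; rewrite -degE in nD; apply: leq_trans nD _; rewrite leq_exp2l.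
  by rewrite lee_fin; lra.
have W0 : 0 < 27 * (2 * eta) ^+ i by rewrite mulr_gt0.
have mD : cmeasurable (Deltak i h (trigpoly (2 ^ s.+2) phi)).
  by rewrite Deltak_trigpoly; exact: cmeasurable_trigpoly.
apply: le_trans (Tnorm_L1_bounded_le p1 mD (mulr_gt0 W0 L0) (ltW W0) sup_le L1_le) _.
have -> : 2^-1 - l2_loss p = 1 - einv p.
  by rewrite /l2_loss max_l ?subr_ge0 ?(ltW p2) //; lra.
rewrite lee_fin -/l; move: (27 * _) (l%:R : R) W0 L0 => W L W0 L0.
by rewrite powRM ?(ltW W0) ?(ltW L0) // mulrAC -powRD_gt0 // subrK powRr1 ?(ltW W0).
Qed.

Lemma exists_extremal_block p s : (1 <= p)%E -> exists phi, extremal_block p s phi.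
Proof.
move=> p1; have [p2|p2] := leP (einv p) 2^-1; first exact: exists_extremal_block_ge2.
exact: exists_extremal_block_lt2.
Qed.

Lemma symbol_bounded_min (D : nat) h t : `|h| <= t ->
  symbol_bounded D h (2 * Num.min 1 (D%:R * t)).
Proof.
move=> ht n nD; have [_|Dt] := leP 1 (D%:R * t); first by rewrite mulr1 normc_expiB1_le2.
apply: le_trans (normc_expiB1_le n h) _; apply: (@le_trans _ _ (D%:R * t)).
  rewrite normrM; apply: ler_pM => //.
  by rewrite -intr_norm -abszE -[leRHS]/(D%:Z%:~R) ler_int lez_nat.
have : 0 <= D%:R * t by rewrite mulr_ge0 // (le_trans _ ht).
by lra.
Qed.

Lemma omega_extremal_block_le p s k phi t : 0 < t -> extremal_block p s phi ->
  (omega k p (trigpoly (2 ^ s.+2) phi) t <= (27 * 4 ^+ k * (2 ^ s)%:R `^ (2^-1 - l2_loss p) *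
     Num.min 1 ((2 ^ s.+3)%:R * t) ^+ k)%:E)%E.
Proof.
move=> t0 [_ _ phi_diff]; apply: ub_ereal_sup => _ [h /= ht <-].
have min0 : 0 < 2 * Num.min 1 ((2 ^ s.+3)%:R * t).
  by rewrite mulr_gt0 // lt_min ltr01 mulr_gt0 // ltr0n expn_gt0.
apply: le_trans (phi_diff k h _ min0 _) _; first exact: symbol_bounded_min.
rewrite lee_fin (_ : 2 * (2 * _) = 4 * Num.min 1 ((2 ^ s.+3)%:R * t)); last by ring.
by rewrite exprMn le_eqVlt; apply/orP; left; apply/eqP; ring.
Qed.

Lemma Tnorm_extremal_block_le p s phi : extremal_block p s phi ->
  (Tnorm p (trigpoly (2 ^ s.+2) phi) <= (27 * (2 ^ s)%:R `^ (2^-1 - l2_loss p))%:E)%E.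
Proof.
move=> [_ _ phi_diff]; have := phi_diff 0%N 0 1 ltr01; rewrite expr0 mulr1; apply=> n _.
by rewrite expi_arg0 subrr normc0.
Qed.

End extremal_blocks.

Section besov_class_membership.
Variable R : realType.
Local Notation C := R[i].
Implicit Types (p theta : \bar R) (r t A D : R) (k : nat) (f : R -> C).

Lemma omega_pZl k p f (a t B : R) : (1 <= p)%E -> 0 <= a ->
  (forall h, cmeasurable (Deltak k h f)) -> (omega k p f t <= B%:E)%E ->
  (omega k p (fun x => (a%:C * f x)%R) t <= (a * B)%:E)%E.
Proof.
move=> p1 a0 mf fB; apply: ub_ereal_sup => _ [h /= ht <-].
rewrite DeltakZ Tnorm_pZl // EFinM lee_wpmul2l //.
exact: le_trans (Tnorm_Deltak_le_omega k p f ht) fB.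
Qed.

Lemma besov_class_scaled k r p theta f A D : (1 <= p)%E -> (1 <= theta)%E ->
  0 < r -> r < k%:R -> 0 < A -> 1 <= D -> periodic2pi f -> cmeasurable f ->
  (forall h, cmeasurable (Deltak k h f)) -> (Tnorm p f <= A%:E)%E ->
  (forall t, 0 < t -> (omega k p f t <= (A * Num.min 1 (D * t) ^+ k)%:E)%E) ->
  besov_class k r p theta
    (fun x => ((A * D `^ r * (4 / Num.min r (k%:R - r) + 2))^-1%:C * f x)%R).
Proof.
move=> p1 th1 r0 rk A0 D1 fp mf mDf fA f_omega; set de := Num.min r _; set a := _^-1.
have D0 : 0 < D by exact: lt_le_trans D1.
have de0 : 0 < de by rewrite lt_min r0 subr_gt0.
have d4 : 0 < 4 / de by rewrite divr_gt0.
have a0 : 0 < a by rewrite invr_gt0 mulr_gt0 ?addr_gt0 // mulr_gt0 // powR_gt0.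
have afA : (Tnorm p (fun x => (a%:C * f x)%R) <= (a * A)%:E)%E.
  by rewrite Tnorm_pZl ?(ltW a0) // EFinM lee_wpmul2l // lee_fin ltW.
split.
  split; [by move=> x; rewrite fp|split; first exact: cmeasurableZ].
  exact: le_lt_trans afA (ltry _).
rewrite besov_normE; apply: (@le_trans _ _ (a * A + a * A * D `^ r * (4 / de + 1))%:E).
  rewrite EFinD leeD //; apply: besov_seminorm_le => //.
  - by rewrite ge_min lexx.
  - by rewrite ge_min lexx orbT.
  - exact: mulr_gt0.
  - by move=> t t0; rewrite -mulrA; apply: omega_pZl => //; [exact: ltW|exact: f_omega].
have Dr1 : 1 <= D `^ r by rewrite -(powRr0 D) ler_powR // ltW.
rewrite lee_fin (_ : _ + _ = a * (A * (1 + D `^ r * (4 / de + 1)))); last by ring.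
rewrite mulrC ler_pdivrMr ?mul1r; last by rewrite -invr_gt0.
rewrite -[leRHS]mulrA ler_wpM2l ?(ltW A0) //.
by rewrite (_ : D `^ r * (4 / de + 2) = D `^ r + D `^ r * (4 / de + 1)) ?lerD2r //; ring.
Qed.

End besov_class_membership.

Section lower_estimate.
Variable R : realType.
Local Notation C := R[i].
Implicit Types (p theta : \bar R) (r : R) (k s m : nat).

Definition extremal_block_bound p r k s : R :=
  27 * 4 ^+ k * (2 ^ s)%:R `^ (2^-1 - l2_loss p) * (2 ^ s.+3)%:R `^ r *
  (4 / Num.min r (k%:R - r) + 2).

Lemma extremal_block_bound_gt0 p r k s : 0 < r -> r < k%:R -> 0 < extremal_block_bound p r k s.
Proof.
by move=> r0 rk; rewrite mulr_gt0 ?addr_gt0 ?divr_gt0 ?lt_min ?r0 ?subr_gt0.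
Qed.

Lemma besov_class_extremal_block p theta r k s phi : (1 <= p)%E -> (1 <= theta)%E ->
  0 < r -> r < k%:R -> extremal_block p s phi ->
  besov_class k r p theta
    (trigpoly (2 ^ s.+2) (fun n => (extremal_block_bound p r k s)^-1%:C * phi n)).
Proof.
move=> p1 th1 r0 rk block; rewrite /extremal_block_bound; set w := (2 ^ s)%:R `^ _; set a := _^-1.
have w0 : 0 < w by rewrite powR_gt0 // ltr0n expn_gt0.
have k1 : 1 <= 4 ^+ k :> R by rewrite exprn_ege1 // ler1n.
rewrite (_ : trigpoly _ _ = (fun x => a%:C * trigpoly (2 ^ s.+2) phi x)); last first.
  by apply/funext => x; rewrite trigpolyZ.
apply: besov_class_scaled => //.
- by rewrite mulr_gt0 // mulr_gt0 // (lt_le_trans ltr01).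
- by rewrite ler1n expn_gt0.
- exact: trigpoly_periodic.
- exact: cmeasurable_trigpoly.
- by move=> h; rewrite Deltak_trigpoly; exact: cmeasurable_trigpoly.
- apply: le_trans (Tnorm_extremal_block_le block) _.
  by rewrite lee_fin ler_wpM2r ?(ltW w0) // ler_peMr.
- by move=> t t0; exact: omega_extremal_block_le.
Qed.

Lemma em_class_besov_ge_block p theta r k s m : (1 <= p)%E -> (1 <= theta)%E ->
  0 < r -> r < k%:R -> (2 * m <= 2 ^ s)%N ->
  (((extremal_block_bound p r k s)^-1 * Num.sqrt (2 ^ s)%:R / 4)%:E <=
   em_class m (besov_class k r p theta))%E.
Proof.
move=> p1 th1 r0 rk ms; have [phi block] := exists_extremal_block s p1.
have member := besov_class_extremal_block p1 th1 r0 rk block; have [phib phi1 _] := block.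
have a0 : 0 <= (extremal_block_bound p r k s)^-1.
  by rewrite invr_ge0 ltW // extremal_block_bound_gt0.
apply: le_trans (ereal_sup_ubound _); last by eexists; [exact: member|reflexivity].
apply: le_em_fun_trigpoly => // n; first by move=> nD; rewrite phib ?mulr0.
by move=> ns; rewrite normcM normc_real ger0_norm // ler_peMr // phi1.
Qed.

Lemma dyadic_scale_exponent (a b e g r N : R) : 0 < a -> 0 < b -> 0 < e -> 0 < N ->
  (a * N `^ (2^-1 - g) * (b * N) `^ r * e)^-1 * Num.sqrt N =
  (a * b `^ r * e)^-1 * N `^ (- (r - g)).
Proof.
move=> a0 b0 e0 N0; rewrite -powR12_sqrt ?(ltW N0) // powRM ?(ltW b0) ?(ltW N0) //.
have -> : N `^ 2^-1 = N `^ (2^-1 - g) * N `^ r * N `^ (- (r - g)).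
  by rewrite -!powRD_gt0 //; congr (_ `^ _); ring.
by field; rewrite !gt_eqF ?powR_gt0.
Qed.

Lemma le_em_class_besov p theta r k : (1 <= p)%E -> (1 <= theta)%E ->
  Num.max (einv p) 2^-1 < r -> r < k%:R -> exists2 c : R, 0 < c & forall m, (0 < m)%N ->
    ((c * m%:R `^ (- (r - l2_loss p)))%:E <= em_class m (besov_class k r p theta))%E.
Proof.
move=> p1 th1; rewrite gt_max => /andP[rp r2] rk; have r0 : 0 < r by exact: lt_trans r2.
have rl : 0 <= r - l2_loss p.
  by rewrite subr_ge0 /l2_loss ge_max (ltW r0) andbT; lra.
pose e : R := 4 / Num.min r (k%:R - r) + 2.
have e0 : 0 < e by rewrite addr_gt0 // divr_gt0 // lt_min r0 subr_gt0.
pose K : R := 27 * 4 ^+ k * 8 `^ r * e.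
have k0 : 0 < 27 * 4 ^+ k :> R by rewrite mulr_gt0 // exprn_gt0.
have K0 : 0 < K by rewrite mulr_gt0 // mulr_gt0 // powR_gt0.
exists (K^-1 * 4 `^ (- (r - l2_loss p)) / 4).
  by rewrite divr_gt0 // mulr_gt0 ?invr_gt0 ?powR_gt0.
move=> m m0; pose s := up_log 2 (2 * m); have /andP[s_gt s_ge] : (2 ^ s.-1 < 2 * m <= 2 ^ s)%N.
  by apply: up_log_bounds => //; move: m0; clear; lia.
have s_le : (2 ^ s <= 4 * m)%N.
  by move: s_gt m0; clear; case: s => [|s']; rewrite ?expn0 /= ?expnS; lia.
apply: le_trans (em_class_besov_ge_block p1 th1 r0 rk s_ge).
rewrite lee_fin /extremal_block_bound.
have S0 : (0 : R) < (2 ^ s)%:R by rewrite ltr0n expn_gt0.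
rewrite (_ : (2 ^ s.+3)%:R = 8 * (2 ^ s)%:R :> R); last by rewrite -natrM !expnS !mulnA.
rewrite -/e dyadic_scale_exponent // -/K [leLHS]mulrAC ler_wpM2r // -[leLHS]mulrA.
rewrite ler_wpM2l ?invr_ge0 ?(ltW K0) //.
rewrite -powRM // !powRN lef_pV2 ?posrE ?powR_gt0 ?mulr_gt0 ?ltr0n ?expn_gt0 //.
by rewrite ge0_ler_powR ?nnegrE ?mulr_ge0 // -natrM ler_nat.
Qed.

End lower_estimate.

Theorem theorem3 (R : realType) (p theta : \bar R) (r : R) (k : nat) :
  (1 <= p)%E -> (1 <= theta)%E ->
  Num.max (einv p) 2^-1 < r -> r < k%:R ->
  exists C1 C2 : R, 0 < C1 /\ C1 < C2 /\
    forall m : nat, (0 < m)%N ->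
      (C1%:E * em_class m (besov_class k r p theta)
         <= ((m%:R) `^ (- r + Num.max (einv p - 2^-1) 0))%:E)%E /\
      (((m%:R) `^ (- r + Num.max (einv p - 2^-1) 0))%:E
         <= C2%:E * em_class m (besov_class k r p theta))%E.
Proof.
move=> p1 th1 pr rk.
have [K K0 em_le] := em_class_besov_le k p1 th1 pr.
have [c c0 em_ge] := le_em_class_besov p1 th1 pr rk.
have c1 : 0 < c^-1 by rewrite invr_gt0.
have K1 : 0 < K^-1 by rewrite invr_gt0.
exists K^-1, (c^-1 + K^-1); do 2!split=> //; first by rewrite ltrDr.
move=> m m0; have := em_le m m0; have := em_ge m m0.
have -> : - r + Num.max (einv p - 2^-1) 0 = - (r - l2_loss p) by rewrite /l2_loss opprB addrC.
have rate0 : 0 <= m%:R `^ (- (r - l2_loss p)) :> R by exact: powR_ge0.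
move: (em_class _ _) (m%:R `^ _ : R) rate0 => [e| |//] rate rate0; last by rewrite leye_eq.
rewrite -!EFinM !lee_fin => rate_le le_rate; split; first by rewrite mulrC ler_pdivrMr // mulrC.
have e0 : 0 <= e by apply: le_trans rate_le; rewrite mulr_ge0 // ltW.
by rewrite mulrDl ler_wpDr ?mulr_ge0 ?(ltW K1) // mulrC ler_pdivlMr // mulrC.
Qed.
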